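(* Let $\Sigma$ be a compact Riemann surface of genus $g\ge2$ with canonical bundle $K$, $p\ge1$, and let $(a_1,\dots,a_p)$, $a_i\in H^0(\Sigma,K^{2i})$, be regular. Let $D$ be the set of zeros of $a_p$, $D=D_+\sqcup D_-$. Let $(W,V,Q_W,Q_V,\beta,\gamma)$ be the $SO(p+1,p)$-Higgs bundle associated to the spectral data $L=\mathcal O$ and $e_x=\pm1$ according to whether $x\in D_+$ or $x\in D_-$. Let $B=K^{-p}(D_+)$ (so $B^*\cong K^{-p}(D_-)$) and let $s_\pm$ be sections of $\mathcal O(D_\pm)$ vanishing on $D_\pm$ with $s_+s_-=a_p/2$. Then, up to isomorphism, $(W,V,Q_W,Q_V,\beta,\gamma)$ is given by: $$W=K^{p-1}\oplus K^{p-3}\oplus\cdots\oplus K^{-(p-1)},$$ $$V=\left(K^{p-2}\oplus K^{p-4}\oplus\cdots\oplus K^{-(p-2)}\right)\oplus B\oplus B^*=W_0\oplus B\oplus B^*,$$ $$Q_W(w_i,w'_j)=\begin{cases}0,& i+j<p+1,\\ h_{i+j-(p+1)}w_iw'_j,& i+j\ge p+1,\end{cases}$$ $$Q_V=Q_{W_0}\oplus\begin{pmatrix}0&1\\1&0\end{pmatrix}\quad\text{(the dual pairing on } B\oplus B^* ),$$ $$Q_{W_0}(v_i,v'_j)=\begin{cases}0,& i+j<p,\\ h_{i+j-p}v_iv'_j,& i+j\ge p,\end{cases}$$ $$\beta(w_1,\dots,w_p)=(w_1-w_pa_{p-1},\,w_2-w_pa_{p-2},\dots,w_{p-1}-w_pa_1,\,w_ps_+,\,-w_ps_-),$$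 $$\gamma(v_1,\dots,v_{p-1},g,h)=(s_+h-s_-g,\,v_1,\dots,v_{p-1}).$$ Here $w_i,w'_j,v_i,v'_j$ are respectively sections of $K^{(p+1)-2i}$, $K^{(p+1)-2j}$, $K^{p-2i}$, $K^{p-2j}$, $g$ is a section of $B$, $h$ is a section of $B^*$, and $w_j,v_j$ are identified with the sections of $W$, $W_0$ having them in the $j$-th slot and zero elsewhere (similarly for $w'_j,v'_j$).
   Context: Orthogonal bundle: holomorphic vector bundle with a non-degenerate symmetric bilinear form. An $SO(p+1,p)$-Higgs bundle consists of orthogonal bundles $(V,Q_V)$ of rank $p+1$ and $(W,Q_W)$ of rank $p$ on $\Sigma$, a holomorphic map $\beta:W\to V\otimes K$ and an isomorphism $\det V\cong\det W$ of $\mathbb{Z}_2$-line bundles; $\gamma=\beta^t:V\to W\otimes K$ is the orthogonal transpose, $Q_V(\beta w,v)=Q_W(w,\gamma v)$. The Higgs field $\Phi=\begin{pmatrix}0&\beta\\ \gamma&0\end{pmatrix}$ satisfies $\det(\eta-\Phi)=\eta(\eta^{2p}+a_1\eta^{2p-2}+\dots+a_p)$; put $a_0=1$. Regular: $\{\eta^{2p}+a_1\eta^{2p-2}+\dots+a_p=0\}\subset\mathrm{Tot}(K)$ is smooth and $a_p,a_{p-1}$ have no common zero. $h_u$ ($u\ge0$): let $\xi_1,\dots,\xi_p$ be the roots of $\xi^p+a_1(x)\xi^{p-1}+\dots+a_p(x)$; $h_u=\sum_{1\le i_1\le\dots\le i_u\le p}\xi_{i_1}\cdots\xi_{i_u}\in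 H^0(\Sigma,K^{2u})$ is the complete homogeneous symmetric polynomial, $h_0=1$. Spectral data. Let $\bar S=\{\xi^p+a_1\xi^{p-1}+\dots+a_p=0\}\subset\mathrm{Tot}(K^2)$, $\bar\pi:\bar S\to\Sigma$, and for $x\in D$ let $x'\in\bar S$ be the zero of $\xi$ over $x$. Spectral data is an orthogonal line bundle $(L,Q_L)$ on $\bar S$ together with unit vectors $e_x\in L_{x'}$, $x\in D$ (for $L=\mathcal O$, $e_x=\pm1$). The associated Higgs bundle is: $W=\bar\pi_*(L\otimes\bar\pi^*K^{p-1})$, with $Q_W(w,w')(x)=\sum_{y\in\bar\pi^{-1}(x)}Q_L(w,w')(y)/d\bar\pi(y)$, where $d\bar\pi$ is the $\xi$-derivative of the defining polynomial; $\beta_F:W\to W\otimes K^2$ is the push-forward of multiplication by $\xi$. Let $V_0=K^{-p}$ with $Q_0=a_p:K^{-p}\otimes K^{-p}\to\mathcal O$. For $x\in D$ let $J_x=\ker(\beta_F)_x\subset W_x\otimes K_x^{-1}$, so $J_x\otimes K_x^p\cong L_{x'}\otimes K_x^{2p-2}$ canonically, and let $i_x:K_x^{-p}\to J_x$ be the map corresponding to $a_{p-1}(x)e_x\in L_{x'}\otimes K_x^{2p-2}$. Then $\mathcal O(V)$ is the sheaf of meromorphic sections of $(W\otimes K^{-1})\oplus K^{-p}$ with at most first order poles on $D$ and residue at $x$ in $\Gamma_x=\{(-i_x(w),w)\}$; away from $D$, $Q_V((a,b),(c,d))=Q_W(\beta_Fa,c)+a_pbd$, $\beta(u)=(u,0)$,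 $\gamma(v,w)=\beta_F(v)$, and these extend over $D$. *)

(* Defs.v *)
From mathcomp Require Import all_boot all_order all_algebra.
From mathcomp Require Import all_classical all_reals all_analysis.
From mathcomp.real_closed Require Import complex.
Set Implicit Arguments.
Unset Strict Implicit.
Unset Printing Implicit Defensive.
Import Order.TTheory GRing.Theory Num.Theory.
Import numFieldNormedType.Exports.
Local Open Scope classical_set_scope.
Local Open Scope ring_scope.

(* Complex numbers over a realType, with the topology and norm that
   MathComp-Analysis puts on every numClosedFieldType. *)
Definition Cx (R : realType) : numClosedFieldType := R[i].

(* A (connected, Hausdorff) Riemann surface: [coord c] is a homeomorphism of the
   open set [dom c] onto an open subset of C with inverse [icoord c]; values of
   [coord c] off [dom c] and of [icoord c] off the image are irrelevant. *)
Record riemann_surface (R : realType) := RiemannSurface {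
  points :> topologicalType;
  chart : Type;
  dom : chart -> set points;
  coord : chart -> points -> Cx R;
  icoord : chart -> Cx R -> points;
  points_hausdorff : hausdorff_space points;
  points_connected : connected [set: points];
  dom_open : forall c, open (dom c);
  dom_cover : forall x, exists c, dom c x;
  coordK : forall c x, dom c x -> icoord c (coord c x) = x;
  coord_continuous : forall c (A : set (Cx R)),
    open A -> open (dom c `&` coord c @^-1` A);
  coord_open : forall c (A : set points),
    open A -> A `<=` dom c -> open (coord c @` A);
  transition_holomorphic : forall c d x, dom c x -> dom d x ->
    derivable (coord d \o icoord c : Cx R -> Cx R) (coord c x) 1 }.

Definition holomorphic_on (R : realType) (S : riemann_surface R) (U : set S)
    (f : S -> Cx R) : Prop :=
  forall c x, U x -> dom c x ->
    derivable (f \o icoord c : Cx R -> Cx R) (coord c x) 1.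

(* Line bundles are given by transition functions: a section is a family s_i of
   functions on the U_i with s_j = s_i * lb_tr i j on the overlaps. *)
Record line_bundle (R : realType) (S : riemann_surface R) := LineBundle {
  lb_idx : Type;
  lb_dom : lb_idx -> set S;
  lb_tr : lb_idx -> lb_idx -> S -> Cx R }.

Definition is_line_bundle (R : realType) (S : riemann_surface R)
    (N : line_bundle S) : Prop :=
  [/\ forall i : lb_idx N, open (lb_dom i),
      forall x, exists i : lb_idx N, lb_dom i x,
      forall i j : lb_idx N, holomorphic_on (lb_dom i `&` lb_dom j) (lb_tr i j),
      forall (i j : lb_idx N) x, lb_dom i x -> lb_dom j x -> lb_tr i j x != 0 &
      forall (i j k : lb_idx N) x, lb_dom i x -> lb_dom j x -> lb_dom k x ->
        lb_tr i j x * lb_tr j k x = lb_tr i k x].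

Definition lb_family (R : realType) (S : riemann_surface R) (N : line_bundle S) :=
  lb_idx N -> S -> Cx R.

(* Holomorphic sections over an open U. Each local function is extended by 0, so
   that equality of sections is equality of families; restriction is [cut]. *)
Definition sections (R : realType) (S : riemann_surface R) (N : line_bundle S)
    (U : set S) : set (lb_family N) :=
  [set s | [/\ forall i, holomorphic_on (U `&` lb_dom i) (s i),
     forall i j x, U x -> lb_dom i x -> lb_dom j x -> s j x = s i x * lb_tr i j x &
     forall i x, ~ (U x /\ lb_dom i x) -> s i x = 0]].
Arguments sections {R S} N U.

Definition cut (I T : Type) (M : zmodType) (U : set T) (s : I -> T -> M) :
    I -> T -> M :=
  fun i => patch (fun=> 0) U (s i).

Definition zero_locus (R : realType) (S : riemann_surface R) (N : line_bundle S)
    (s : lb_family N) : set S :=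
  [set x | forall i, lb_dom i x -> s i x = 0].

(* s is a global section with divisor A (all zeros simple), i.e. N = O(A). *)
Definition section_with_divisor (R : realType) (S : riemann_surface R)
    (N : line_bundle S) (s : lb_family N) (A : set S) : Prop :=
  [/\ sections N setT s, zero_locus s = A &
      forall (c : chart S) (i : lb_idx N) x, A x -> dom c x -> lb_dom i x ->
        derive1 (s i \o icoord c : Cx R -> Cx R) (coord c x) != 0].

Definition lb_tensor (R : realType) (S : riemann_surface R)
    (M N : line_bundle S) : line_bundle S :=
  {| lb_idx := (lb_idx M * lb_idx N)%type;
     lb_dom := fun i => lb_dom i.1 `&` lb_dom i.2;
     lb_tr := fun i j x => lb_tr i.1 j.1 x * lb_tr i.2 j.2 x |}.

Definition lb_pow (R : realType) (S : riemann_surface R)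
    (N : line_bundle S) (n : int) : line_bundle S :=
  {| lb_idx := lb_idx N;
     lb_dom := @lb_dom R S N;
     lb_tr := fun i j x => lb_tr i j x ^ n |}.

(* The section s of K stands for the form s_c dz_c; hence the transition
   function from c to d is dz_c / dz_d. *)
Definition canonical (R : realType) (S : riemann_surface R) : line_bundle S :=
  {| lb_idx := chart S;
     lb_dom := @dom R S;
     lb_tr := fun c d x =>
       derive1 (coord c \o icoord d : Cx R -> Cx R) (coord d x) |}.

Arguments canonical {R} S.

Definition Kpow (R : realType) (S : riemann_surface R) (n : int) :
  line_bundle S := lb_pow (canonical S) n.

(* Families indexed by the charts: the sections of all the K^n are of this type. *)
Definition K_family (R : realType) (S : riemann_surface R) :=
  chart S -> S -> Cx R.

(* genus = dim H^0(S, K): there is a basis of g global holomorphic 1-forms. *)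
Definition has_genus (R : realType) (S : riemann_surface R) (g : nat) : Prop :=
  exists omega : 'I_g -> K_family S,
    (forall k, sections (canonical S) setT (omega k)) /\
    forall s, sections (canonical S) setT s ->
      exists! t : 'rV[Cx R]_g,
        s = fun c x => \sum_(k < g) t 0 k * omega k c x.

(* A holomorphic vector bundle E is given by the sheaves of sections of E (x) K^n
   for all n : int. [secs n U] are the sections of E (x) K^n over the open set U,
   [rest] is restriction, and [act k] is multiplication by a section k of K^m,
   which maps E (x) K^n to E (x) K^(m + n); for m = 0 it is the O-module
   structure. *)
Record bundle (R : realType) (S : riemann_surface R) := Bundle {
  raw : zmodType;
  secs : int -> set S -> set raw;
  rest : set S -> raw -> raw;
  act : K_family S -> raw -> raw }.

Arguments secs {R S} b n U.
Arguments rest {R S} b U s.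
Arguments act {R S} b k s.

(* An isomorphism E -> F of O-modules, together with the isomorphisms
   E (x) K^n -> F (x) K^n it induces: these are forced by compatibility with
   multiplication by local sections of the powers of K. *)
Definition bundle_iso (R : realType) (S : riemann_surface R) (E F : bundle S)
    (phi : int -> set S -> raw E -> raw F) : Prop :=
  [/\ forall n U, open U -> set_bij (secs E n U) (secs F n U) (phi n U),
      forall n U s t, open U -> secs E n U s -> secs E n U t ->
        phi n U (s + t) = phi n U s + phi n U t,
      forall n U U' s, open U -> open U' -> U' `<=` U -> secs E n U s ->
        phi n U' (rest E U' s) = rest F U' (phi n U s) &
      forall m n U k s, open U -> sections (Kpow S m) U k -> secs E n U s ->
        phi (m + n) U (act E k s) = act F k (phi n U s)].

(* The data (W, V, Q_W, Q_V, beta, gamma), with forms and Higgs field given by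
   their graphs on sections over each open U:
     higgs_QW U w w' q      q = Q_W(w, w') on U,
     higgs_beta U w v       v = beta(w), v a section of V (x) K,
     higgs_gamma U v w      w = gamma(v), w a section of W (x) K.
   The predicates are only meant for sections of the right bundles. *)
Record higgs (R : realType) (S : riemann_surface R) := Higgs {
  higgs_W : bundle S;
  higgs_V : bundle S;
  higgs_QW : set S -> raw higgs_W -> raw higgs_W -> (S -> Cx R) -> Prop;
  higgs_QV : set S -> raw higgs_V -> raw higgs_V -> (S -> Cx R) -> Prop;
  higgs_beta : set S -> raw higgs_W -> raw higgs_V -> Prop;
  higgs_gamma : set S -> raw higgs_V -> raw higgs_W -> Prop }.

Definition higgs_iso (R : realType) (S : riemann_surface R) (E F : higgs S) : Prop :=
  let WE := higgs_W E in let VE := higgs_V E in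
  exists (phi : int -> set S -> raw WE -> raw (higgs_W F))
         (psi : int -> set S -> raw VE -> raw (higgs_V F)),
  bundle_iso phi /\ bundle_iso psi /\
  forall U, open U ->
  [/\ forall w w' q, secs WE 0 U w -> secs WE 0 U w' ->
        (higgs_QW U w w' q <-> higgs_QW U (phi 0 U w) (phi 0 U w') q),
      forall v v' q, secs VE 0 U v -> secs VE 0 U v' ->
        (higgs_QV U v v' q <-> higgs_QV U (psi 0 U v) (psi 0 U v') q),
      forall w v, secs WE 0 U w -> secs VE 1 U v ->
        (higgs_beta U w v <-> higgs_beta U (phi 0 U w) (psi 1 U v)) &
      forall v w, secs VE 0 U v -> secs WE 1 U w ->
        (higgs_gamma U v w <-> higgs_gamma U (psi 0 U v) (phi 1 U w))].

(* In what follows a k is a section of K^(2k) for 1 <= k <= p; a 0 is ignored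
   and replaced by the convention a_0 = 1. *)
Definition acoef (R : realType) (S : riemann_surface R) (a : nat -> K_family S)
    (k : nat) : K_family S :=
  if k == 0%N then fun _ _ => 1 else a k.

(* xi^p + a_1 xi^(p-1) + ... + a_p over x, in the fibre coordinate (dz_c)^2 of K^2. *)
Definition spoly (R : realType) (S : riemann_surface R) (p : nat)
    (a : nat -> K_family S) (c : chart S) (x : S) : {poly Cx R} :=
  \sum_(0 <= k < p.+1) acoef a k c x *: 'X^(p - k).

(* Smoothness of the divisor {eta^(2p) + a_1 eta^(2p-2) + ... + a_p = 0} in Tot(K)
   is the Jacobian criterion: the equation and its two partial derivatives in the
   coordinates (z_c, eta) have no common zero. *)
Definition regular (R : realType) (S : riemann_surface R) (p : nat)
    (a : nat -> K_family S) : Prop :=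
  (forall (c : chart S) x (eta : Cx R), dom c x ->
     root (spoly p a c x \Po 'X^2) eta ->
     ~ ((spoly p a c x \Po 'X^2)^`().[eta] = 0 /\
        derive1 (fun z : Cx R => (spoly p a c (icoord c z) \Po 'X^2).[eta] : Cx R)
          (coord c x) = 0)) /\
  (forall (c : chart S) x, dom c x ->
     ~ (acoef a p c x = 0 /\ acoef a p.-1 c x = 0)).

(* h_u in the chart c: complete homogeneous symmetric polynomial in the roots
   (listed with multiplicity) of spoly. *)
Definition hsym (R : realType) (S : riemann_surface R) (p : nat)
    (a : nat -> K_family S) (u : nat) (c : chart S) (x : S) : Cx R :=
  let r := sval (closed_field_poly_normal (spoly p a c x)) in
  \sum_(t : u.-tuple 'I_p | sorted (fun k l : 'I_p => (k <= l)%N) t)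
    \prod_(k <- t) r`_k.

(* The second argument xi : Cx R is the coordinate of a point (x, xi (dz_c)^2) of
   Tot(K^2) in the chart c. *)
Definition curve_family (R : realType) (S : riemann_surface R) :=
  chart S -> S -> Cx R -> Cx R.

(* Sections over the inverse image of U in the curve {spoly = 0} in Tot(K^2) of
   the pull-back of K^m, i.e. sections over U of its push-forward: locally
   restrictions of holomorphic functions of (z_c, xi), extended by 0. *)
Definition curve_sections (R : realType) (S : riemann_surface R) (p : nat)
    (a : nat -> K_family S) (m : int) (U : set S) : set (curve_family S) :=
  [set f | [/\
     forall c x xi, U x -> dom c x -> root (spoly p a c x) xi ->
       exists2 F : (Cx R * Cx R)%type -> Cx R,
         \forall y \near (coord c x, xi), differentiable F y &
         \forall y \near (coord c x, xi),
           root (spoly p a c (icoord c y.1)) y.2 -> f c (icoord c y.1) y.2 = F y,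
     forall c d x xi, U x -> dom c x -> dom d x -> root (spoly p a c x) xi ->
       let kappa : Cx R := lb_tr (l := canonical S) c d x in
       f d x (xi * kappa ^+ 2) = f c x xi * kappa ^ m &
     forall c x xi, ~ [/\ U x, dom c x & root (spoly p a c x) xi] ->
       f c x xi = 0]].

Definition mul_curve (R : realType) (S : riemann_surface R) (k : K_family S)
    (f : curve_family S) : curve_family S :=
  fun c x xi => k c x * f c x xi.

(* Multiplication by the tautological section xi of the pull-back of K^2. *)
Definition beta_F (R : realType) (S : riemann_surface R) (f : curve_family S) :
    curve_family S :=
  fun c x xi => xi * f c x xi.

(* q = Q_W(f, f') on U: the sum over the fibre of f f' / P'(xi) where the fibre has
   no multiple point, extended holomorphically over the branch points. *)
Definition curve_form (R : realType) (S : riemann_surface R) (p : nat)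
    (a : nat -> K_family S) (U : set S) (f f' : curve_family S) (q : S -> Cx R) :
    Prop :=
  holomorphic_on U q /\
  forall c x, U x -> dom c x ->
    (forall xi, root (spoly p a c x) xi -> (spoly p a c x)^`().[xi] != 0) ->
    q x = \sum_(xi \in [set xi : Cx R | root (spoly p a c x) xi])
            f c x xi * f' c x xi / (spoly p a c x)^`().[xi].

Definition spectral_W (R : realType) (S : riemann_surface R) (p : nat)
    (a : nat -> K_family S) : bundle S :=
  {| raw := curve_family S : zmodType;
     secs := fun n U => curve_sections p a (p%:Z - 1 + n) U;
     rest := fun U f => cut U f;
     act := fun k f => mul_curve k f |}.

(* Gluing at a point x of D. A pair (f, b) has at most a simple pole at x when,
   zeta being the local coordinate z_c - z_c(x), zeta f and zeta b extend to
   sections f1 of W (x) K^(n-1) and b1 of K^(n-p) near x; the residue is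
   (f1(x), b1(x)). It lies in Gamma_x = {(-i_x(t), t)} when
   - f1(x) is in J_x: beta_F f1 vanishes at x as a section of the vector bundle
     W (x) K^(n+1), i.e. beta_F f1 = zeta f2 with f2 a section near x;
   - under J_x = L_(x') (x) K_x^(p-2+n), given by the value at x' = (x, xi = 0),
     f1(x) is - a_(p-1)(x) e_x b1(x). *)
Definition residue_in_Gamma (R : realType) (S : riemann_surface R) (p : nat)
    (a : nat -> K_family S) (D : set S) (e : S -> Cx R) (n : int) (x : S)
    (f : curve_family S) (b : K_family S) : Prop :=
  forall c : chart S, dom c x ->
  let zeta : K_family S := fun _ y => coord c y - coord c x in
  exists (O : set S) (f1 f2 : curve_family S) (b1 : K_family S),
  [/\ open O, O x & O `<=` dom c] /\
  [/\ curve_sections p a (p%:Z - 2 + n) O f1,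
      curve_sections p a (p%:Z + n) O f2 &
      sections (Kpow S (n - p%:Z)) O b1] /\
  [/\ cut (O `\` D) f1 = cut (O `\` D) (mul_curve zeta f),
      cut (O `\` D) b1 = cut (O `\` D) (fun d y => zeta d y * b d y),
      beta_F f1 = mul_curve zeta f2 &
      f1 c x 0 = - (acoef a p.-1 c x * e x * b1 c x)].

(* Sections of V over U are recorded by their restrictions to U \ D. *)
Definition spectral_V (R : realType) (S : riemann_surface R) (p : nat)
    (a : nat -> K_family S) (D : set S) (e : S -> Cx R) : bundle S :=
  {| raw := (curve_family S * K_family S)%type : zmodType;
     secs := fun n U => [set v |
       [/\ curve_sections p a (p%:Z - 2 + n) (U `\` D) v.1,
           sections (Kpow S (n - p%:Z)) (U `\` D) v.2 &
           forall x, U x -> D x -> residue_in_Gamma p a D e n x v.1 v.2]];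
     rest := fun U v => (cut U v.1, cut U v.2);
     act := fun k v => (mul_curve k v.1, fun c x => k c x * v.2 c x) |}.

(* The Higgs bundle of the spectral data L = O, Q_L the product of functions, and
   unit vectors e x. Q_V and gamma are determined on U \ D and extended over D. *)
Definition spectral_higgs (R : realType) (S : riemann_surface R) (p : nat)
    (a : nat -> K_family S) (D : set S) (e : S -> Cx R) : higgs S :=
  {| higgs_W := spectral_W p a;
     higgs_V := spectral_V p a D e;
     higgs_QW := fun U f f' q => curve_form p a U f f' q;
     higgs_QV := fun U v v' q =>
       holomorphic_on U q /\
       exists2 q1, curve_form p a (U `\` D) (beta_F v.1) v'.1 q1 &
         forall c x, (U `\` D) x -> dom c x ->
           q x = q1 x + acoef a p c x * v.2 c x * v'.2 c x;
     higgs_beta := fun U f v => v = (cut (U `\` D) f, 0);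
     higgs_gamma := fun U v f =>
       cut (U `\` D) f = cut (U `\` D) (beta_F v.1) |}.

(* Direct sum of K^(m - 2i), 1 <= i <= r, a section being (w_1, ..., w_r) with
   w_i = 0 for the other i : nat. *)
Definition K_sum_sections (R : realType) (S : riemann_surface R) (r : nat)
    (m : int) (U : set S) : set (nat -> K_family S) :=
  [set w | (forall i, (1 <= i <= r)%N -> sections (Kpow S (m - (2 * i)%:Z)) U (w i)) /\
           (forall i, ~~ (1 <= i <= r)%N -> w i = 0)].

(* The form with entries h_(i+j-m) for i + j >= m, and 0 for i + j < m, on
   (w_1, ..., w_r). *)
Definition hankel (R : realType) (S : riemann_surface R) (p : nat)
    (a : nat -> K_family S) (r m : nat) (w w' : nat -> K_family S) (c : chart S)
    (x : S) : Cx R :=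
  \sum_(1 <= i < r.+1) \sum_(1 <= j < r.+1)
    if (i + j < m)%N then 0 else hsym p a (i + j - m) c x * w i c x * w' j c x.

Definition explicit_W (R : realType) (S : riemann_surface R) (p : nat) : bundle S :=
  {| raw := (nat -> K_family S) : zmodType;
     secs := fun n U => K_sum_sections p (p%:Z + 1 + n) U;
     rest := fun U w => fun i => cut U (w i);
     act := fun k w => fun i c x => k c x * w i c x |}.

(* N is O(D_+), so B = K^(-p) (x) N, and B^* = K^p (x) N^(-1); a section of V is
   ((v, g), h) with g in B and h in B^*. *)
Definition explicit_V (R : realType) (S : riemann_surface R) (p : nat)
    (N : line_bundle S) : bundle S :=
  let B n := lb_tensor (Kpow S (- p%:Z + n)) N in
  let Bdual n := lb_tensor (Kpow S (p%:Z + n)) (lb_pow N (-1)) in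
  {| raw := ((nat -> K_family S) * (chart S * lb_idx N -> S -> Cx R)
             * (chart S * lb_idx N -> S -> Cx R))%type : zmodType;
     secs := fun n U => [set v |
       [/\ K_sum_sections p.-1 (p%:Z + n) U v.1.1,
           sections (B n) U v.1.2 & sections (Bdual n) U v.2]];
     rest := fun U v => (fun i => cut U (v.1.1 i), cut U v.1.2, cut U v.2);
     act := fun k v => (fun i c x => k c x * v.1.1 i c x,
                        fun ij x => k ij.1 x * v.1.2 ij x,
                        fun ij x => k ij.1 x * v.2 ij x) |}.

(* sp is s_+, a section of N = O(D_+); sm is s_-, a section of
   O(D_-) = K^(2p) (x) N^(-1). *)
Definition explicit_higgs (R : realType) (S : riemann_surface R) (p : nat)
    (a : nat -> K_family S) (N : line_bundle S) (sp : lb_family N)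
    (sm : lb_family (lb_tensor (Kpow S (2 * p)%:Z) (lb_pow N (-1)))) : higgs S :=
  {| higgs_W := explicit_W S p;
     higgs_V := explicit_V p N;
     higgs_QW := fun U w w' q => forall c x, U x -> dom c x ->
       q x = hankel p a p p.+1 w w' c x;
     higgs_QV := fun U v v' q => forall c j x, U x -> dom c x -> lb_dom j x ->
       q x = hankel p a p.-1 p v.1.1 v'.1.1 c x
             + (v.1.2 (c, j) x * v'.2 (c, j) x + v.2 (c, j) x * v'.1.2 (c, j) x);
     higgs_beta := fun U w v => forall c j x, U x -> dom c x -> lb_dom j x ->
       [/\ forall i, (1 <= i < p)%N ->
             v.1.1 i c x = w i c x - w p c x * a (p - i)%N c x,
           v.1.2 (c, j) x = w p c x * sp j x &
           v.2 (c, j) x = - (w p c x * sm (c, j) x)];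
     higgs_gamma := fun U v w => forall c j x, U x -> dom c x -> lb_dom j x ->
       w 1%N c x = sp j x * v.2 (c, j) x - sm (c, j) x * v.1.2 (c, j) x /\
       forall i, (1 <= i < p)%N -> w i.+1 c x = v.1.1 i c x |}.

(* Main.v *)
(* Write P for the polynomial xi^p + a_1 xi^(p-1) + ... + a_p.

   The map phi sends (w_1, ..., w_p) to the function sum w_i xi^(i-1) on the curve P = 0.
   Over a point with p distinct roots the w_i are recovered by Lagrange interpolation, and
   they extend over the branch points by Riemann's theorem on removable singularities:
   smoothness makes z - z_0 negligible against dP/dxi on the curve near a branch point
   over z_0, so (z - z_0) w_i tends to 0. The sum of F / P' over a fibre is the coefficient
   of xi^(p-1) in F mod P, and for F = xi^(p-1+u) this is h_u, whence Q_W.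

   Away from D put t = (g / s_+ - h / s_-) / 2 and b = - (g / s_+ + h / s_-) / 2, so that
   g = s_+ (t - b) and h = - s_- (t + b). The map psi sends (v, g, h) to the pair (f, b)
   with f = sum v_i xi^(i-1) + t (xi^(p-1) + a_1 xi^(p-2) + ... + a_(p-1)). Since xi times
   the last bracket is - a_p on the curve, the residue of f lies in ker beta_F exactly when
   the v_i are holomorphic; as a_(p-1) is nonzero on D, the residue of (f, b) lies in Gamma
   exactly when moreover the residue of t is - e_x times that of b, which says that g and h
   are holomorphic. Away from D all compatibilities are identities in t, b and v_i, and
   they extend over D by continuity. *)

Require Import Defs.
From mathcomp Require Import all_boot all_order all_algebra.
From mathcomp Require Import all_classical all_reals all_analysis.
From mathcomp.real_closed Require Import complex.
From mathcomp Require Import ring lra zify.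
Require Import Defs.
Set Implicit Arguments.
Unset Strict Implicit.
Unset Printing Implicit Defensive.
Import Order.TTheory GRing.Theory Num.Theory.
Import numFieldNormedType.Exports.
Local Open Scope classical_set_scope.
Local Open Scope ring_scope.

(** * Contour integrals over rectangles *)

(** The obstacles are local. Over a branch point the values of a function on the fibre do not
    determine the coefficients of a polynomial in xi, and sections of V are recorded off D only. So
    everything is proved over simple fibres or off D and then carried across isolated points, by
    continuity for identities and by removable singularities for existence. The complex analysis
    needed rests on Goursat's theorem for rectangles; the integral of 1/(z - w) is never evaluated,
    because dividing by it only requires that it is nonzero.

    The origin of t and b: put E = xi^(p-1) + a_1 xi^(p-2) + ... + a_(p-1). On pairs (t E, b) the
    form Q_V is a_p (b b' - t t'), and these pairs are orthogonal to W_0. Its isotropic lines t = -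
    b and t = b are B and its dual, and as a_p = 2 s_+ s_-, the sections g = s_+ (t - b) and h = -
    s_- (t + b) turn the form into the dual pairing. At D_+ the gluing allows a pole of t - b only,
    at D_- of t + b only; s_+ and s_- absorb exactly these poles. *)

Section RealIntegral.
Context {R : realType}.
Implicit Types (g h : R -> R) (a b m : R).

Definition rint g a b : R := (\int[lebesgue_measure]_(t in `[a, b]) g t)%R.
Definition rcont g a b := forall t, a <= t <= b -> {for t, continuous g}.

Lemma rcont_integrable g a b : rcont g a b ->
  lebesgue_measure.-integrable `[a, b] (EFin \o g).
Proof.
move=> cg; apply: continuous_compact_integrable; first exact: segment_compact.
apply: continuous_in_subspaceT => t; rewrite inE /= in_itv /= => tab.
exact: cg.
Qed.

Lemma rintD g h a b : rcont g a b -> rcont h a b ->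
  rint (fun t => g t + h t) a b = rint g a b + rint h a b.
Proof. by move=> cg ch; rewrite /rint RintegralD//; exact: rcont_integrable. Qed.

Lemma rintZ k g a b : rcont g a b -> rint (fun t => k * g t) a b = k * rint g a b.
Proof. by move=> cg; rewrite /rint RintegralZl//; exact: rcont_integrable. Qed.

Lemma rint_cst k a b : a <= b -> rint (fun=> k) a b = k * (b - a).
Proof.
move=> ab; rewrite /rint Rintegral_cst//=; congr (_ * _).
rewrite lebesgue_measure_itv/= lte_fin.
by case: ltgtP ab => //= ->; rewrite subrr.
Qed.

Lemma rint_le g h a b : rcont g a b -> rcont h a b ->
  (forall t, a <= t <= b -> g t <= h t) -> rint g a b <= rint h a b.
Proof.
move=> cg ch gh; apply: le_Rintegral => //; try exact: rcont_integrable.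
Qed.

Lemma rint_split g a m b : rcont g a b -> a <= m <= b ->
  rint g a b = rint g a m + rint g m b.
Proof.
move=> cg /andP[am mb].
have gi := rcont_integrable cg.
have /eqP := @Rintegral_itvB _ g (BLeft a) (BRight b) m gi am mb.
rewrite subr_eq addrC => /eqP; rewrite /rint => ->; congr (_ + _).
apply: Rintegral_itv_obnd_cbnd; apply: integrableS gi => //=.
by apply: subset_itvr; rewrite bnd_simp.
Qed.

Lemma rint_bound g a b M : a <= b -> rcont g a b ->
  (forall t, a <= t <= b -> `|g t| <= M) -> `|rint g a b| <= M * (b - a).
Proof.
move=> ab cg gM; rewrite ler_norml -mulNr -!rint_cst//.
have cc k : rcont (fun=> k) a b by move=> t _; exact: cvg_cst.
by apply/andP; split; apply: rint_le => // t /gM; rewrite ler_norml => /andP[].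
Qed.

End RealIntegral.

(** * Real-valued norm and epsilon-delta forms of complex differentiability *)

Section ComplexNorm.
Context {R : realType}.
Local Notation C := (Cx R).
Implicit Types (z w : C) (f g : C -> C).

(** The norm [|z|] lies in [C], which is only partially ordered; a norm with values in the ordered
    field [R] makes the estimates accessible to linear arithmetic. *)
Definition nrm z : R := Normc.normc (z : R[i]).

Lemma nrmE z : `|z| = (nrm z)%:C%C. Proof. by []. Qed.
Lemma nrm_ge0 z : 0 <= nrm z.
Proof. by rewrite -lecR -nrmE; exact: normr_ge0. Qed.
Lemma nrm0 : nrm 0 = 0. Proof. exact: Normc.normc0. Qed.
Lemma nrm1 : nrm 1 = 1. Proof. exact: Normc.normc1. Qed.
Lemma nrmM z w : nrm (z * w) = nrm z * nrm w. Proof. exact: Normc.normcM. Qed.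
Lemma nrmV z : nrm z^-1 = (nrm z)^-1. Proof. exact: Normc.normcV. Qed.
Lemma nrmX z n : nrm (z ^+ n) = nrm z ^+ n.
Proof. by elim: n => [|n IH]; rewrite ?expr0 ?nrm1// !exprS nrmM IH. Qed.
Lemma nrmN z : nrm (- z) = nrm z. Proof. exact: normcN. Qed.
Lemma nrmB z w : nrm (z - w) = nrm (w - z). Proof. by rewrite -nrmN opprB. Qed.
Lemma nrmD z w : nrm (z + w) <= nrm z + nrm w. Proof. exact: le_normcD. Qed.
Lemma nrmBD z w : nrm (z - w) <= nrm z + nrm w.
Proof. by rewrite -[nrm w]nrmN; exact: nrmD. Qed.
Lemma nrm_eq0 z : (nrm z == 0) = (z == 0).
Proof.
apply/eqP/eqP => [|->]; last exact: nrm0.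
exact: Normc.eq0_normc.
Qed.
Lemma nrm_gt0 z : (0 < nrm z) = (z != 0).
Proof. by rewrite lt_neqAle nrm_ge0 andbT eq_sym nrm_eq0. Qed.
Lemma nrm_real (x : R) : nrm (x%:C%C : C) = `|x|.
Proof. by rewrite /nrm /= expr0n /= addr0 sqrtr_sqr. Qed.
Lemma nrm_i : nrm ('i%C : C) = 1.
Proof. by rewrite /nrm /= expr0n /= add0r expr1n sqrtr1. Qed.

Lemma nrm_Re z : `|complex.Re z| <= nrm z.
Proof. by rewrite -lecR; exact: normc_ge_Re. Qed.
Lemma nrm_Im z : `|complex.Im z| <= nrm z.
Proof.
have := nrm_Re (z * 'i%C); rewrite nrmM nrm_i mulr1.
by rewrite ReiNIm normrN.
Qed.

Lemma nrm_le_ReIm z : nrm z <= `|complex.Re z| + `|complex.Im z|.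
Proof.
rewrite {1}[z]complexE; apply: le_trans (nrmD _ _) _.
by rewrite nrmM nrm_i mul1r !nrm_real.
Qed.

Lemma ltCxE z w :
  (z < w) = (complex.Im w == complex.Im z) && (complex.Re z < complex.Re w).
Proof. exact: (@ltcE R z w). Qed.

(** A positive element of [C] is a positive real, so complex radii may be traded for real ones. *)
Lemma nbhsCP z (A : set C) :
  nbhs z A <-> exists2 d : R, 0 < d & forall w, nrm (w - z) < d -> A w.
Proof.
split => [/nbhs_ballP[e /= e0 zA]|[d d0 zA]].
  have /andP[/eqP ei er] : (complex.Im e == 0) && (0 < complex.Re e).
    by rewrite -(ltCxE 0 e).
  exists (complex.Re e) => // w wd; apply: zA; rewrite /ball/= distrC.
  rewrite nrmE ltCxE /= wd andbT; apply/eqP; exact: ei.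
apply/nbhs_ballP; exists (d%:C)%C => /=; first by rewrite ltCxE /= eqxx.
move=> w; rewrite /ball/= distrC nrmE ltCxE /= eqxx; exact: zA.
Qed.

Lemma cvgCP (T : Type) (F : set_system T) (FF : Filter F) (f : T -> C) (l : C) :
  f @ F --> l <-> forall e : R, 0 < e -> \forall t \near F, nrm (f t - l) < e.
Proof.
split=> [fl e e0|fl].
  have := fl [set w | nrm (w - l) < e]; apply; apply/nbhsCP.
  by exists e.
move=> A /nbhsCP[d d0 dA]; have := fl _ d0; apply: filterS => t; exact: dA.
Qed.

(** Differentiability without division. The weak inequality also holds at w = z, so no punctured
    neighbourhood is needed. *)
Definition cdif f z (l : C) := forall e : R, 0 < e -> exists2 d : R, 0 < d &
  forall w, nrm (w - z) < d -> nrm (f w - f z - l * (w - z)) <= e * nrm (w - z).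

Lemma cdifP f z l : is_derive z (1 : C) f l <-> cdif f z l.
Proof.
split.
  move=> [df Dl] e e0.
  have : (fun h : C => h^-1 *: ((f \o shift z) (h *: (1 : C)) - f z)) @ (0 : C)^' --> l.
    by rewrite -Dl; exact: df.
  move/cvgCP => /(_ e e0); rewrite near_withinE => /nbhsCP[d d0 hd].
  exists d => // w wz; have [->|wnz] := eqVneq w z.
    by rewrite !subrr mulr0 subrr nrm0 mulr0.
  have wz0 : w - z != 0 by rewrite subr_eq0.
  have := hd (w - z); rewrite subr0 => /(_ wz wz0).
  rewrite /= [_ *: 1]mulr1 [_ *: _]mulrC subrK => H.
  have -> : f w - f z - l * (w - z) = ((f w - f z) * (w - z)^-1 - l) * (w - z).
    by rewrite mulrBl divfK.
  by rewrite nrmM; rewrite ler_wpM2r ?nrm_ge0// ltW.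
move=> H.
have cv : (fun h : C => h^-1 *: ((f \o shift z) (h *: (1 : C)) - f z)) @ (0 : C)^' --> l.
  apply/cvgCP => e e0; rewrite near_withinE; apply/nbhsCP.
  (* Halving [e] turns the weak inequality of [cdif] into the strict one of a limit. *)
  have [d d0 hd] := H (e / 2) (divr_gt0 e0 (ltr0Sn _ _)).
  exists d => // h; rewrite subr0 => hlt h0.
  rewrite /= [_ *: 1]mulr1 [_ *: _]mulrC.
  have := hd (h + z); rewrite addrK => /(_ hlt) hh.
  have -> : (f (h + z) - f z) * h^-1 - l = (f (h + z) - f z - l * h) * h^-1.
    by rewrite [RHS]mulrBl mulfK.
  rewrite nrmM nrmV ltr_pdivrMr ?nrm_gt0//.
  apply: le_lt_trans hh _; rewrite ltr_pM2r ?nrm_gt0//.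
  by rewrite ltr_pdivrMr// ltr_pMr// ltr1n.
split; first by apply/cvg_ex; exists l.
exact: cvg_lim cv.
Qed.

Lemma cdif_derivable f z l : cdif f z l -> derivable f z 1.
Proof. by move/cdifP => -[]. Qed.
Lemma derivable_cdif f z : derivable f z 1 -> cdif f z (derive1 f z).
Proof. by move=> df; apply/cdifP; rewrite derive1E; exact: derivableP. Qed.
Lemma cdif_derive1 f z l : cdif f z l -> derive1 f z = l.
Proof. by move/cdifP => -[_ <-]; rewrite derive1E. Qed.

Lemma ctsM f g z : {for z, continuous f} -> {for z, continuous g} ->
  {for z, continuous (fun w => f w * g w)}.
Proof. exact: (@continuousM C C). Qed.
Lemma ctsD f g z : {for z, continuous f} -> {for z, continuous g} ->
  {for z, continuous (fun w => f w + g w)}.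
Proof. exact: (@continuousD C C C). Qed.
Lemma ctsN f z : {for z, continuous f} -> 
  {for z, continuous (fun w => - f w)}.
Proof. exact: (@continuousN C C C). Qed.
Lemma ctsC (k : C) z : {for z, continuous (fun w : C => k)}.
Proof. exact: (@cst_continuous C C k). Qed.
Lemma ctsId z : {for z, continuous (fun w : C => w)}.
Proof. exact: cvg_id. Qed.
Lemma ctsV f z : f z != 0 -> {for z, continuous f} -> {for z, continuous (fun w => (f w)^-1)}.
Proof. exact: (@continuousV C C). Qed.

Lemma derD f g z : derivable f z 1 -> derivable g z 1 ->
  derivable (fun w => f w + g w) z 1.
Proof. exact: (@derivableD C C C f g z 1). Qed.
Lemma derN f z : derivable f z 1 -> derivable (fun w => - f w) z 1.
Proof. exact: (@derivableN C C C f z 1). Qed.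
Lemma derM f g z : derivable f z 1 -> derivable g z 1 ->
  derivable (fun w => f w * g w) z 1.
Proof. exact: (@derivableM C C f g z 1). Qed.
Lemma derV f z : f z != 0 -> derivable f z 1 -> derivable (fun w => (f w)^-1) z 1.
Proof. exact: (@derivableV C C f z 1). Qed.
Lemma derC (k : C) z : derivable (fun w : C => k) z 1.
Proof. exact: (@derivable_cst C C C k z 1). Qed.
Lemma derId z : derivable (fun w : C => w) z 1.
Proof. exact: (@derivable_id C C z 1). Qed.

End ComplexNorm.
Arguments derC {R} k z.
Arguments derId {R} z.

Section ContourIntegral.
Context {R : realType}.
Local Notation C := (Cx R).
Implicit Types (g h : R -> C) (f : C -> C) (a b c d m : R).

Definition pt (x y : R) : C := (x +i* y)%C.

Definition cint g a b : C :=
  (rint (@complex.Re R \o g) a b +i* rint (@complex.Im R \o g) a b)%C.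

Definition ccont g a b := rcont (@complex.Re R \o g) a b /\ rcont (@complex.Im R \o g) a b.

Lemma cintD g h a b : ccont g a b -> ccont h a b ->
  cint (fun t => g t + h t) a b = cint g a b + cint h a b.
Proof.
move=> [g1 g2] [h1 h2]; rewrite /cint.
have -> : @complex.Re R \o (fun t => g t + h t) =
  fun t => (@complex.Re R \o g) t + (@complex.Re R \o h) t.
  by apply/funext => t /=; case: (g t) => ? ?; case: (h t).
have -> : @complex.Im R \o (fun t => g t + h t) =
  fun t => (@complex.Im R \o g) t + (@complex.Im R \o h) t.
  by apply/funext => t /=; case: (g t) => ? ?; case: (h t).
by rewrite !rintD.
Qed.

Lemma rcontZ k (g : R -> R) a b : rcont g a b -> rcont (fun t => k * g t) a b.
Proof. by move=> cg t tab; apply: cvgM; [exact: cvg_cst|exact: cg]. Qed.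

Lemma cintZ (k : C) g a b : ccont g a b ->
  cint (fun t => k * g t) a b = k * cint g a b.
Proof.
move=> [g1 g2]; case: k => k1 k2; rewrite /cint.
have -> : @complex.Re R \o (fun t => (k1 +i* k2)%C * g t) =
  fun t => k1 * (@complex.Re R \o g) t + (- k2) * (@complex.Im R \o g) t.
  by apply/funext => t /=; case: (g t) => ? ? /=; rewrite mulNr.
have -> : @complex.Im R \o (fun t => (k1 +i* k2)%C * g t) =
  fun t => k1 * (@complex.Im R \o g) t + k2 * (@complex.Re R \o g) t.
  by apply/funext => t /=; case: (g t) => x y /=; rewrite [k2 * x]mulrC.
rewrite !rintD; try exact: rcontZ.
rewrite !rintZ// mulNr.
by congr (_ +i* _)%C; rewrite [k2 * _]mulrC.
Qed.

Lemma cint_cst (k : C) a b : a <= b -> cint (fun=> k) a b = k * (b - a)%:C%C.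
Proof.
move=> ab; case: k => k1 k2; rewrite /cint !rint_cst//=.
rewrite /GRing.mul/= !mulr0 subr0 add0r.
by congr (_ +i* _)%C; rewrite mulrC.
Qed.

Lemma cint_split g a m b : ccont g a b -> a <= m <= b ->
  cint g a b = cint g a m + cint g m b.
Proof. by move=> [g1 g2] amb; rewrite /cint (rint_split g1 amb) (rint_split g2 amb). Qed.

(** Real and imaginary parts are bounded separately, whence the factor 2. The sharp constant is
    irrelevant to the limits taken later. *)
Lemma cint_bound g a b (M : R) : a <= b -> ccont g a b ->
  (forall t, a <= t <= b -> nrm (g t) <= M) -> nrm (cint g a b) <= 2 * M * (b - a).
Proof.
move=> ab [g1 g2] gM; apply: le_trans (nrm_le_ReIm _) _ => /=.
have -> : 2 * M * (b - a) = M * (b - a) + M * (b - a) by ring.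
apply: lerD; apply: rint_bound => // t /gM; apply: le_trans.
  exact: nrm_Re.
exact: nrm_Im.
Qed.

Lemma cts_along f (gam : R -> C) t :
  (forall s, nrm (gam s - gam t) <= `|s - t|) ->
  {for gam t, continuous f} ->
  {for t, continuous (@complex.Re R \o f \o gam)} /\
  {for t, continuous (@complex.Im R \o f \o gam)}.
Proof.
move=> gl /cvgCP cf; split; apply/cvgrPdist_lt => e e0;
  have /nbhsCP[dl dl0 fd] := cf e e0; apply/nbhs_normP; exists dl => //= s;
  rewrite /= => sd; rewrite distrC.
  have := nrm_Re (f (gam s) - f (gam t)).
  rewrite raddfB => /le_lt_trans; apply; apply: fd.
  by apply: le_lt_trans (gl s) _; rewrite distrC.
have := nrm_Im (f (gam s) - f (gam t)).
rewrite raddfB => /le_lt_trans; apply; apply: fd.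
by apply: le_lt_trans (gl s) _; rewrite distrC.
Qed.

Lemma ptBx s t y : pt s y - pt t y = (s - t)%:C%C.
Proof. by apply/eqP; rewrite eq_complex /= subrr !eqxx. Qed.
Lemma ptBy x s t : pt x s - pt x t = (s - t)%:C%C * 'i%C.
Proof. by apply/eqP; rewrite eq_complex /= subrr !mulr0 !mul0r mulr1 subr0 addr0 !eqxx. Qed.

Definition hline f y := fun x => f (pt x y).
Definition vline f x := fun y => f (pt x y).

Lemma hline_ccont f y a b :
  (forall x, a <= x <= b -> {for pt x y, continuous f}) -> ccont (hline f y) a b.
Proof.
move=> H; split=> t /H /(@cts_along _ (fun x => pt x y)) [] // s.
all: by rewrite ptBx nrm_real.
Qed.

Lemma vline_ccont f x c d :
  (forall y, c <= y <= d -> {for pt x y, continuous f}) -> ccont (vline f x) c d.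
Proof.
move=> H; split=> t /H /(@cts_along _ (fun y => pt x y)) [] // s.
all: by rewrite ptBy nrmM nrm_i mulr1 nrm_real.
Qed.

(** The counterclockwise integral of f dz over the boundary of [a, b] x [c, d]: bottom minus top,
    and dz = i dy on the vertical sides. *)
Definition rcint f a b c d : C :=
  (cint (hline f c) a b - cint (hline f d) a b) +
  'i%C * (cint (vline f b) c d - cint (vline f a) c d).

Definition bdry_cont f a b c d :=
  [/\ ccont (hline f c) a b, ccont (hline f d) a b,
      ccont (vline f b) c d & ccont (vline f a) c d].

Lemma rcintD f1 f2 a b c d : bdry_cont f1 a b c d -> bdry_cont f2 a b c d ->
  rcint (fun z => f1 z + f2 z) a b c d = rcint f1 a b c d + rcint f2 a b c d.
Proof.
move=> [? ? ? ?] [? ? ? ?]; rewrite /rcint /hline /vline !cintD//.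
ring.
Qed.

Lemma rcintZ k f a b c d : bdry_cont f a b c d ->
  rcint (fun z => k * f z) a b c d = k * rcint f a b c d.
Proof.
move=> [? ? ? ?]; rewrite /rcint /hline /vline !cintZ//.
ring.
Qed.

Lemma rcint_splitx f a m b c d : bdry_cont f a b c d -> a <= m <= b ->
  rcint f a b c d = rcint f a m c d + rcint f m b c d.
Proof.
move=> [? ? ? ?] amb; rewrite /rcint.
rewrite (@cint_split (hline f c) a m b)// (@cint_split (hline f d) a m b)//.
ring.
Qed.

Lemma rcint_splity f a b c m d : bdry_cont f a b c d -> c <= m <= d ->
  rcint f a b c d = rcint f a b c m + rcint f a b m d.
Proof.
move=> [? ? ? ?] amb; rewrite /rcint.
rewrite (@cint_split (vline f a) c m d)// (@cint_split (vline f b) c m d)//.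
ring.
Qed.

Lemma rcint_bound f a b c d M : a <= b -> c <= d -> bdry_cont f a b c d ->
  (forall x y, a <= x <= b -> c <= y <= d -> (x == a) || (x == b) || (y == c) || (y == d) ->
     nrm (f (pt x y)) <= M) ->
  nrm (rcint f a b c d) <= 4 * M * ((b - a) + (d - c)).
Proof.
move=> ab cd [c1 c2 c3 c4] fM.
have -> : 4 * M * ((b - a) + (d - c)) =
  (2 * M * (b - a) + 2 * M * (b - a)) + (2 * M * (d - c) + 2 * M * (d - c)) by ring.
apply: le_trans (nrmD _ _) _; apply: lerD; last rewrite nrmM nrm_i mul1r.
all: apply: le_trans (nrmBD _ _) _; apply: lerD; apply: cint_bound => // t tab.
all: by apply: fM => //; rewrite ?eqxx ?orbT ?lexx ?ab ?cd.
Qed.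

Definition rect_cont f a b c d :=
  forall x y, a <= x <= b -> c <= y <= d -> {for pt x y, continuous f}.

Lemma bdry_contP f a b c d :
  (forall x, a <= x <= b -> {for pt x c, continuous f} /\ {for pt x d, continuous f}) ->
  (forall y, c <= y <= d -> {for pt a y, continuous f} /\ {for pt b y, continuous f}) ->
  bdry_cont f a b c d.
Proof.
move=> fx fy; split.
- by apply: hline_ccont => x /fx[].
- by apply: hline_ccont => x /fx[].
- by apply: vline_ccont => x /fy[].
- by apply: vline_ccont => x /fy[].
Qed.

Lemma rect_cont_bdry f a b c d : a <= b -> c <= d ->
  rect_cont f a b c d -> bdry_cont f a b c d.
Proof.
by move=> ab cd H; apply: bdry_contP => t tab; split; apply: H;
  rewrite /= ?lexx ?ab ?cd ?andbT ?tab.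
Qed.

Lemma bdry_cst (k : C) a b c d : bdry_cont (fun=> k) a b c d.
Proof. by split; split=> t _; exact: cvg_cst. Qed.

Lemma bdry_id a b c d : bdry_cont id a b c d.
Proof. by apply: bdry_contP => t _; split; exact: cvg_id. Qed.

Lemma rcint_cst (k : C) a b c d : a <= b -> c <= d -> rcint (fun=> k) a b c d = 0.
Proof.
by move=> ab cd; rewrite /rcint /hline /vline !cint_cst// !subrr mulr0 addr0.
Qed.

(** On opposite sides [id] differs by a constant, and the two differences integrate to opposite
    multiples of the area. *)
Lemma rcint_id a b c d : a <= b -> c <= d -> rcint id a b c d = 0.
Proof.
move=> ab cd; rewrite /rcint.
have [i1 i2 i3 i4] := bdry_id a b c d.
have -> : hline id c = fun x => hline id d x + (c - d)%:C%C * 'i%C.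
  apply/funext => x; rewrite /hline /pt /=; simpc.
  by congr (_ +i* _)%C; ring.
have -> : vline id b = fun y => vline id a y + (b - a)%:C%C.
  apply/funext => x; rewrite /vline /pt /=; simpc.
  by congr (_ +i* _)%C; ring.
have ck (k : C) x y : ccont (fun=> k) x y by split=> t _; exact: cvg_cst.
rewrite !cintD// !cint_cst//.
rewrite !raddfB/=; ring.
Qed.

End ContourIntegral.

(** * Goursat's theorem and Cauchy's formula *)

Section Goursat.
Context {R : realType}.
Local Notation C := (Cx R).
Implicit Types (f : C -> C) (a b c d m : R).

Lemma derivable_cts f (z : C) : derivable f z 1 -> {for z, continuous f}.
Proof. by move=> /derivable1_diffP /differentiable_continuous. Qed.

Lemma nested_intervals (a b : nat -> R) :
  (forall n, a n <= a n.+1) -> (forall n, b n.+1 <= b n) -> (forall n, a n <= b n) ->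
  exists x, forall n, a n <= x <= b n.
Proof.
move=> ai bd ab.
have am (n m : nat) : (n <= m)%N -> a n <= a m.
  by apply: (@homo_leq _ _ (fun x y => x <= y)) => // ? ? ?; exact: le_trans.
have bm (n m : nat) : (n <= m)%N -> b m <= b n.
  by apply: (@homo_leq _ _ (fun x y => y <= x)) => // ? ? ? /[swap]; exact: le_trans.
have ub (m : nat) : ubound (range a) (b m).
  move=> _ [n _ <-]; case: (leqP n m) => [nm|/ltnW mn].
    exact: le_trans (am _ _ nm) (ab m).
  exact: le_trans (ab n) (bm _ _ mn).
exists (sup (range a)) => n; apply/andP; split.
  apply: sup_upper_bound; last by exists n.
  by split; [exists (a 0%N); exists 0%N|exists (b 0%N)].
by apply: ge_sup => //; exists (a 0%N); exists 0%N.
Qed.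

(** The integral is the sum of those over the four quarters, so one of them carries at least a
    fourth of its norm. *)
Lemma quarter f a b c d : a <= b -> c <= d -> rect_cont f a b c d ->
  exists q : R * R * R * R, let: (a', b', c', d') := q in
  [/\ a <= a' /\ b' <= b, c <= c' /\ d' <= d, b' - a' = (b - a) / 2,
      d' - c' = (d - c) / 2 & nrm (rcint f a b c d) <= 4 * nrm (rcint f a' b' c' d')].
Proof.
move=> ab cd fc.
pose m := (a + b) / 2; pose k := (c + d) / 2.
have amb : a <= m <= b by rewrite /m; lra.
have ckd : c <= k <= d by rewrite /k; lra.
have [am mb] := andP amb; have [ck kd] := andP ckd.
have sub a' b' c' d' : a <= a' -> a' <= b' -> b' <= b -> c <= c' -> c' <= d' -> d' <= d ->
    bdry_cont f a' b' c' d'.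
  move=> aa' a'b' bb' cc' c'd' dd'; apply: rect_cont_bdry => // x y /andP[? ?] /andP[? ?].
  by apply: fc; apply/andP; split; lra.
have J4 : rcint f a b c d = (rcint f a m c k + rcint f a m k d) +
    (rcint f m b c k + rcint f m b k d).
  rewrite (@rcint_splitx _ f a m b c d)//; last exact: sub.
  rewrite (@rcint_splity _ f a m c k d)//; last exact: sub.
  by rewrite (@rcint_splity _ f m b c k d)//; exact: sub.
have N4 : nrm (rcint f a b c d) <= (nrm (rcint f a m c k) + nrm (rcint f a m k d)) +
    (nrm (rcint f m b c k) + nrm (rcint f m b k d)).
  by rewrite J4; apply: le_trans (nrmD _ _) _; apply: lerD; exact: nrmD.
have h1 : m - a = (b - a) / 2 by rewrite /m; field.
have h2 : b - m = (b - a) / 2 by rewrite /m; field.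
have h3 : k - c = (d - c) / 2 by rewrite /k; field.
have h4 : d - k = (d - c) / 2 by rewrite /k; field.
set x1 := nrm (rcint f a m c k) in N4; set x2 := nrm (rcint f a m k d) in N4.
set x3 := nrm (rcint f m b c k) in N4; set x4 := nrm (rcint f m b k d) in N4.
set x0 := nrm _ in N4 *.
have [l1|l1] := leP x0 (4 * x1); first by exists (a, m, c, k).
have [l2|l2] := leP x0 (4 * x2); first by exists (a, m, k, d).
have [l3|l3] := leP x0 (4 * x3); first by exists (m, b, c, k).
have [l4|l4] := leP x0 (4 * x4); first by exists (m, b, k, d).
exfalso; lra.
Qed.

(** Affine functions integrate to 0 around the rectangle, so only the remainder counts. It is at
    most [e * s] in norm, on a contour of length [2 * s]. *)
Lemma rcint_affine_approx f a b c d x y l e (s := (b - a) + (d - c)) :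
  0 <= e -> rect_cont f a b c d -> a <= x <= b -> c <= y <= d ->
  (forall w, nrm (w - pt x y) <= s ->
    nrm (f w - f (pt x y) - l * (w - pt x y)) <= e * nrm (w - pt x y)) ->
  nrm (rcint f a b c d) <= 4 * e * s ^+ 2.
Proof.
move=> e0 fc /andP[ax xb] /andP[cy yd] fd.
have ab := le_trans ax xb; have cd := le_trans cy yd.
pose A := f (pt x y) - l * pt x y.
pose rem w := f w - A - l * w.
have bf := rect_cont_bdry ab cd fc.
have bid := bdry_id a b c d; have bA k := bdry_cst k a b c d.
have bl : bdry_cont (fun w => l * w) a b c d.
  by apply: bdry_contP => t _; split; apply: ctsM; do ?[exact: ctsC|exact: ctsId].
have br : bdry_cont rem a b c d.
  apply: (rect_cont_bdry ab cd) => t u tt uu; rewrite /rem.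
  have h1 : {for pt t u, continuous (fun w : C => f w - A)}.
    by apply: (@ctsD _ f (fun=> - A)); [exact: fc|exact: ctsC].
  have h2 : {for pt t u, continuous (fun w : C => l * w)}.
    by apply: (@ctsM _ (fun=> l) id); [exact: ctsC|exact: ctsId].
  exact: (ctsD h1 (ctsN h2)).
have bAl : bdry_cont (fun w => A + l * w) a b c d.
  by apply: bdry_contP => t _; split; (apply: ctsD; [exact: ctsC|
    apply: ctsM; [exact: ctsC|exact: ctsId]]).
have -> : rcint f a b c d = rcint rem a b c d.
  have -> : f = fun w => rem w + (A + l * w).
    by apply/funext => w; rewrite /rem; ring.
  rewrite rcintD// rcintD// rcint_cst// rcintZ// rcint_id// mulr0 !addr0.
  by congr rcint; apply/funext => w; rewrite /rem; ring.
rewrite expr2 mulrA -/s; have -> : 4 * e * s = 4 * (e * s) by ring.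
apply: rcint_bound => // t u /andP[a1 a2] /andP[a3 a4] _.
have ns : nrm (pt t u - pt x y) <= s.
  apply: le_trans (nrm_le_ReIm _) _; rewrite /pt; simpc => /=.
  by apply: lerD; rewrite ler_norml; apply/andP; split; lra.
have -> : rem (pt t u) = f (pt t u) - f (pt x y) - l * (pt t u - pt x y).
  by rewrite /rem /A; ring.
by apply: le_trans (fd _ ns) _; apply: ler_wpM2l.
Qed.

Theorem goursat f a b c d : a <= b -> c <= d ->
  (forall x y, a <= x <= b -> c <= y <= d -> derivable f (pt x y) 1) ->
  rcint f a b c d = 0.
Proof.
move=> ab cd fd.
have fc : rect_cont f a b c d by move=> x y xx yy; apply: derivable_cts; exact: fd.
apply/eqP; rewrite -nrm_eq0; apply/eqP/le_anti; rewrite nrm_ge0 andbT.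
(* Bisection produces a nested sequence of subrectangles: [ok] is its invariant, [rel] the relation
   between consecutive members. *)
pose ok (q : R * R * R * R) := let: (a', b', c', d') := q in
  [/\ a <= a', a' <= b', b' <= b & [/\ c <= c', c' <= d' & d' <= d]].
pose rel (q q' : R * R * R * R) := let: (a, b, c, d) := q in let: (a', b', c', d') := q' in
  [/\ a <= a' /\ b' <= b, c <= c' /\ d' <= d, b' - a' = (b - a) / 2,
      d' - c' = (d - c) / 2 & nrm (rcint f a b c d) <= 4 * nrm (rcint f a' b' c' d')].
have [nx nxP] : {nx : R * R * R * R -> R * R * R * R & forall q, ok q -> rel q (nx q)}.
  apply: (@boolp.choice _ _ (fun q q' => ok q -> rel q q')) => -[[[a' b'] c'] d'].
  have [[aa' a'b' bb' [cc' c'd' dd']]|H] := pselect (ok (a', b', c', d')); last first.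
    by exists (a', b', c', d') => /H.
  have [|q qP] := @quarter f a' b' c' d' a'b' c'd'; last by exists q.
  by move=> x y /andP[? ?] /andP[? ?]; apply: fc; apply/andP; split; lra.
pose Q n := iter n nx (a, b, c, d).
have okQ n : ok (Q n).
  elim: n => [|n IH]; first by rewrite /Q /= ab cd !lexx.
  have := nxP _ IH; rewrite /Q iterS -/(Q n); move: IH.
  case: (Q n) => [[[a1 b1] c1] d1]; case: (nx _) => [[[a2 b2] c2] d2] /=.
  move=> [? ? ? [? ? ?]] [[? ?] [? ?] ? ? _].
  by split; [lra|lra|lra|split; lra].
have relQ n : rel (Q n) (Q n.+1) by apply: nxP.
pose a_ n := (Q n).1.1.1; pose b_ n := (Q n).1.1.2; pose c_ n := (Q n).1.2; pose d_ n := (Q n).2.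
have QE n : Q n = (a_ n, b_ n, c_ n, d_ n).
  by rewrite /a_ /b_ /c_ /d_; case: (Q n) => [[[]]].
have okE n : [/\ a <= a_ n, a_ n <= b_ n, b_ n <= b & [/\ c <= c_ n, c_ n <= d_ n & d_ n <= d]].
  by have := okQ n; rewrite QE.
have relE n : [/\ a_ n <= a_ n.+1 /\ b_ n.+1 <= b_ n, c_ n <= c_ n.+1 /\ d_ n.+1 <= d_ n,
    b_ n.+1 - a_ n.+1 = (b_ n - a_ n) / 2, d_ n.+1 - c_ n.+1 = (d_ n - c_ n) / 2 &
    nrm (rcint f (a_ n) (b_ n) (c_ n) (d_ n)) <=
      4 * nrm (rcint f (a_ n.+1) (b_ n.+1) (c_ n.+1) (d_ n.+1))].
  by have := relQ n; rewrite !QE.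
have [x xP] : exists x, forall n, a_ n <= x <= b_ n.
  apply: nested_intervals => n; first by case: (relE n) => -[].
    by case: (relE n) => -[].
  by case: (okE n).
have [y yP] : exists x, forall n, c_ n <= x <= d_ n.
  apply: nested_intervals => n; first by case: (relE n) => _ -[].
    by case: (relE n) => _ -[].
  by case: (okE n) => _ _ _ [].
pose s := (b - a) + (d - c).
have sE n : (b_ n - a_ n) + (d_ n - c_ n) = s / 2 ^+ n.
  elim: n => [|n IH]; first by rewrite expr0 divr1.
  have [_ _ -> -> _] := relE n.
  by rewrite -mulrDl IH exprSr invfM mulrA.
have JE n : nrm (rcint f a b c d) <= 4 ^+ n * nrm (rcint f (a_ n) (b_ n) (c_ n) (d_ n)).
  elim: n => [|n IH]; first by rewrite expr0 mul1r.
  apply: le_trans IH _; rewrite exprSr -mulrA ler_wpM2l//.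
  by have [] := relE n.
have s0 : 0 <= s by rewrite /s; lra.
have xy : derivable f (pt x y) 1.
  by apply: fd; [have := xP 0%N|have := yP 0%N].
apply/ler_addgt0Pl => e e0; rewrite addr0.
(* The factor 4^n lost in n bisections cancels against the square of the half-perimeter s / 2^n,
   which leaves 4 s^2 times this constant. The summand 1 covers a degenerate rectangle with s =
   0. *)
have e1 : 0 < e / (4 * (s ^+ 2 + 1)).
  by apply: divr_gt0 => //; apply: mulr_gt0 => //; rewrite ltr_wpDl// sqr_ge0.
have [dl dl0 dlP] := derivable_cdif xy e1.
have [n sn] : exists n, s / 2 ^+ n < dl.
  have [N NP] : exists N : nat, s / dl < N%:R by exists (Num.Def.archi_bound (s / dl)); apply: archi_boundP; apply: divr_ge0 => //; exact: ltW.
  exists N; rewrite ltr_pdivrMr ?exprn_gt0// mulrC -ltr_pdivrMr//.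
  apply: lt_trans NP _; rewrite -natrX ltr_nat; exact: ltn_expl.
have [aa' a'b' bb' [cc' c'd' dd']] := okE n.
apply: le_trans (JE n) _.
have := @rcint_affine_approx f (a_ n) (b_ n) (c_ n) (d_ n) x y (derive1 f (pt x y)) _ (ltW e1).
rewrite sE => /(_ _ (xP n) (yP n)) H.
have {}H : nrm (rcint f (a_ n) (b_ n) (c_ n) (d_ n)) <= 4 * (e / (4 * (s ^+ 2 + 1))) * (s / 2 ^+ n) ^+ 2.
  apply: H.
    by move=> t u /andP[? ?] /andP[? ?]; apply: fc; apply/andP; split; lra.
  by move=> w ws; apply: dlP; exact: le_lt_trans ws sn.
have p4 : (0 : R) < 4 ^+ n by exact: exprn_gt0.
apply: le_trans (ler_wpM2l (ltW p4) H) _.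
have -> : (s / 2 ^+ n) ^+ 2 = s ^+ 2 / 4 ^+ n.
  rewrite exprMn; congr (_ * _); rewrite exprVn -exprM mulnC exprM; congr (_ ^+ _)^-1; by rewrite -natrX.
have s1 : 0 < s ^+ 2 + 1 by rewrite ltr_wpDl// sqr_ge0.
have -> : 4 ^+ n * (4 * (e / (4 * (s ^+ 2 + 1))) * (s ^+ 2 / 4 ^+ n)) = e * (s ^+ 2 / (s ^+ 2 + 1)).
  by field; rewrite lt0r_neq0// lt0r_neq0.
by rewrite ler_piMr// ?ltW// ltr_pdivrMr// mul1r ltrDl.
Qed.

End Goursat.

Section CauchyFormula.
Context {R : realType}.
Local Notation C := (Cx R).
Implicit Types (f g : C -> C) (a b c d m : R).

Lemma pt_neq x y u v : (x != u) || (y != v) -> pt x y != pt u v :> C.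
Proof. by rewrite /pt eq_complex /= negb_and. Qed.

(** The integral equals the one around a square of half-side [dl] about the puncture, which is at
    most [16 * M * dl] and hence arbitrarily small. *)
Lemma goursat_punctured g a b c d u v (M r : R) :
  a < u < b -> c < v < d ->
  (forall x y, a <= x <= b -> c <= y <= d -> pt x y != pt u v :> C ->
     derivable g (pt x y) 1) ->
  0 < r -> (forall z, nrm (z - pt u v) < r -> z != pt u v -> nrm (g z) <= M) ->
  rcint g a b c d = 0.
Proof.
move=> /andP[au ub] /andP[cv vd] gd r0 gM.
apply/eqP; rewrite -nrm_eq0; apply/eqP/le_anti; rewrite nrm_ge0 andbT.
have M0 : 0 <= M.
  apply: le_trans (nrm_ge0 (g (pt (u + r / 2) v))) _; apply: gM.
    by rewrite ptBx nrm_real addrC addKr ger0_norm; lra.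
  by apply: pt_neq; apply/orP; left; apply/eqP; lra.
apply/ler_addgt0Pl => e e0; rewrite addr0.
have [dl [dl0 d1 d2 [d3 d4 [d5 d6]]]] : exists dl, [/\ 0 < dl, dl <= u - a, dl <= b - u &
    [/\ dl <= v - c, dl <= d - v & 2 * dl < r /\ 16 * M * dl <= e]].
  (* [M] may be 0, hence [M + 1] in the denominator. The bound r / 3 keeps the small square inside
     the disc where g is bounded. *)
  have M1 : 0 < 16 * (M + 1) by lra.
  pose t1 := Num.min (u - a) (b - u); pose t2 := Num.min (v - c) (d - v).
  pose t3 := Num.min (r / 3) (e / (16 * (M + 1))).
  pose t := Num.min t1 (Num.min t2 t3).
  have mle (x y : R) : Num.min x y <= x /\ Num.min x y <= y.
    by rewrite !ge_min !lexx orbT.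
  have mgt (x y : R) : 0 < x -> 0 < y -> 0 < Num.min x y by rewrite lt_min => -> ->.
  have [tt1 tt1'] := mle t1 (Num.min t2 t3); have [tt2 tt3] := mle t2 t3.
  have p1 : 0 < t1 by apply: mgt; lra.
  have p2 : 0 < t2 by apply: mgt; lra.
  have p3 : 0 < t3 by apply: mgt; apply: divr_gt0 => //; lra.
  have t0 : 0 < t by apply: (mgt _ _ p1); apply: mgt.
  have [q1 q2] := mle (u - a) (b - u); have [q3 q4] := mle (v - c) (d - v).
  have [q5 q6] := mle (r / 3) (e / (16 * (M + 1))).
  rewrite -/t1 in q1 q2; rewrite -/t2 in q3 q4; rewrite -/t3 in q5 q6; rewrite -/t in tt1 tt1'.
  exists t; split; [by []|lra|lra|split; [lra|lra|split; [lra|]]].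
  have : t <= e / (16 * (M + 1)) by lra.
  rewrite ler_pdivlMr// => h; apply: le_trans h; rewrite mulrC; apply: ler_wpM2l; [exact: ltW|lra].
have cts x y : a <= x <= b -> c <= y <= d -> (x != u) || (y != v) ->
    {for pt x y, continuous g}.
  by move=> xx yy xy; apply: derivable_cts; apply: gd => //; exact: pt_neq.
have bd a' b' c' d' : a <= a' -> a' < u -> u < b' -> b' <= b ->
    c <= c' -> c' < v -> v < d' -> d' <= d -> bdry_cont g a' b' c' d'.
  move=> *; apply: bdry_contP => t /andP[? ?]; split; apply: cts; rewrite /= ?andbT;
  first [apply/andP; split; lra | apply/orP; right; apply/eqP; lra | apply/orP; left; apply/eqP; lra].
have z a' b' c' d' : a <= a' -> a' <= b' -> b' <= b -> c <= c' -> c' <= d' -> d' <= d ->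
    (b' < u) || (u < a') || (d' < v) || (v < c') -> rcint g a' b' c' d' = 0.
  move=> ? ? ? ? ? ? out; apply: goursat => // x y /andP[? ?] /andP[? ?]; apply: gd.
  - by apply/andP; split; lra.
  - by apply/andP; split; lra.
  apply: pt_neq; case/orP: out => [/orP[/orP[|]|]|] ?; apply/orP;
  first [left; apply/eqP; lra|right; apply/eqP; lra].
(* The strips to the left, to the right, below and above are removed in turn; each misses the
   puncture. *)
have s1 : rcint g a b c d = rcint g (u - dl) (u + dl) (v - dl) (v + dl).
  rewrite (@rcint_splitx _ g a (u - dl) b)//; last 2 first.
    by apply: bd; lra.
    by apply/andP; split; lra.
  rewrite z ?add0r; [|lra..].
  rewrite (@rcint_splitx _ g _ (u + dl) b)//; last 2 first.
    by apply: bd; lra.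
    by apply/andP; split; lra.
  rewrite [X in _ + X]z ?addr0; [|lra..].
  rewrite (@rcint_splity _ g _ _ c (v - dl))//; last 2 first.
    by apply: bd; lra.
    by apply/andP; split; lra.
  rewrite z ?add0r; [|lra..].
  rewrite (@rcint_splity _ g _ _ _ (v + dl))//; last 2 first.
    by apply: bd; lra.
    by apply/andP; split; lra.
  by rewrite [X in _ + X]z ?addr0//; lra.
rewrite s1; apply: (@le_trans _ _ (4 * M * ((u + dl - (u - dl)) + (v + dl - (v - dl))))).
  apply: rcint_bound; [lra|lra|by apply: bd; lra|].
  move=> x y /andP[? ?] /andP[? ?] xy; apply: gM.
    apply: le_lt_trans (nrm_le_ReIm _) _; rewrite /pt; simpc => /=.
    apply: le_lt_trans d5; rewrite mulr2n mulrDl mul1r.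
    by apply: lerD; rewrite ler_norml; apply/andP; split; lra.
  apply: pt_neq; case/orP: xy => [/orP[/orP[|]|]|] /eqP ->; apply/orP;
  first [left; apply/eqP; lra|right; apply/eqP; lra].
by have -> : 4 * M * ((u + dl - (u - dl)) + (v + dl - (v - dl))) = 16 * M * dl by ring.
Qed.

End CauchyFormula.

Section Square.
Context {R : realType}.
Local Notation C := (Cx R).
Variables (u v r : R).
Hypothesis r0 : 0 < r.
Let z0 : C := pt u v.
Implicit Types (f g : C -> C) (w z : C).

Definition sqint f := rcint f (u - r) (u + r) (v - r) (v + r).

(** The closed square without the open inscribed disc. It contains the four sides, and distance at
    least [r] from the centre is what the estimates on them use. *)
Definition sq_bdry x y := [/\ u - r <= x <= u + r, v - r <= y <= v + r & r <= nrm (pt x y - z0)].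
Definition sq_bcont f := forall x y, sq_bdry x y -> {for pt x y, continuous f}.

Lemma sq_dist x y : (x == u - r) || (x == u + r) || (y == v - r) || (y == v + r) ->
  r <= nrm (pt x y - z0).
Proof.
have r1 := r0.
have X : `|x - u| <= nrm (pt x y - z0).
  by have := nrm_Re (pt x y - z0); rewrite /z0 /pt; simpc.
have Y : `|y - v| <= nrm (pt x y - z0).
  by have := nrm_Im (pt x y - z0); rewrite /z0 /pt; simpc.
case/orP => [/orP[/orP[|]|]|] /eqP E; rewrite E in X Y *.
- apply: le_trans X; have -> : u - r - u = - r by ring.
  by rewrite normrN ger0_norm// ltW.
- apply: le_trans X; have -> : u + r - u = r by ring.
  by rewrite ger0_norm// ltW.
- apply: le_trans Y; have -> : v - r - v = - r by ring.
  by rewrite normrN ger0_norm// ltW.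
- apply: le_trans Y; have -> : v + r - v = r by ring.
  by rewrite ger0_norm// ltW.
Qed.

Lemma sq_bcont_bdry f : sq_bcont f -> bdry_cont f (u - r) (u + r) (v - r) (v + r).
Proof.
have r1 := r0.
move=> fc; apply: bdry_contP => t tt; split; apply: fc; split=> //;
  try (by apply/andP; split; lra); by apply: sq_dist; rewrite eqxx ?orbT.
Qed.

Lemma sqint_bound f M : sq_bcont f ->
  (forall x y, sq_bdry x y -> nrm (f (pt x y)) <= M) -> nrm (sqint f) <= 16 * M * r.
Proof.
have r1 := r0.
move=> fc fM; have -> : 16 * M * r = 4 * M * ((u + r - (u - r)) + (v + r - (v - r))) by ring.
apply: (@rcint_bound _ f); [lra|lra|exact: sq_bcont_bdry|].
by move=> x y xx yy xy; apply: fM; split => //; exact: sq_dist.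
Qed.

Lemma sq_far x y w : sq_bdry x y -> nrm (w - z0) <= r / 2 -> r / 2 <= nrm (pt x y - w).
Proof.
have r1 := r0.
move=> [_ _ h] wz; have := nrmBD (pt x y - w) (z0 - w).
have -> : pt x y - w - (z0 - w) = pt x y - z0 by ring.
rewrite [nrm (z0 - w)]nrmB => H; lra.
Qed.

Lemma sq_far_neq x y w : sq_bdry x y -> nrm (w - z0) <= r / 2 -> pt x y - w != 0.
Proof. by have r1 := r0; move=> xy /(sq_far xy) h; rewrite -nrm_gt0; lra. Qed.

Lemma sq_inv_cont w : nrm (w - z0) <= r / 2 -> sq_bcont (fun z => (z - w)^-1).
Proof.
have r1 := r0.
move=> wz x y xy; apply: (@ctsV _ (fun z => z - w)).
  exact: sq_far_neq xy wz.
by apply: ctsD; [exact: ctsId|exact: ctsC].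
Qed.

Lemma sq_bcontM f g : sq_bcont f -> sq_bcont g -> sq_bcont (fun z => f z * g z).
Proof. by move=> fc gc x y xy; apply: ctsM; [exact: fc|exact: gc]. Qed.

Lemma sqintD f g : sq_bcont f -> sq_bcont g ->
  sqint (fun z => f z + g z) = sqint f + sqint g.
Proof. by move=> fc gc; apply: rcintD; exact: sq_bcont_bdry. Qed.

Lemma sqintZ k f : sq_bcont f -> sqint (fun z => k * f z) = k * sqint f.
Proof. by move=> fc; apply: rcintZ; exact: sq_bcont_bdry. Qed.

Lemma z0_near : nrm (z0 - z0) <= r / 2.
Proof. by have r1 := r0; rewrite subrr nrm0; lra. Qed.

(** Integrate the finite geometric series of 1/(z - w) in powers of h = w - z0, with remainder h^3 /
    ((z - z0)^3 (z - w)). Continuity of [f] on the contour suffices; holomorphy enters in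
    [sq_cauchy]. *)
Lemma cauchy_kernel_expansion f M : sq_bcont f ->
  (forall x y, sq_bdry x y -> nrm (f (pt x y)) <= M) ->
  exists A0 A1 A2 K, forall w, nrm (w - z0) <= r / 2 ->
    nrm (sqint (fun z => f z * (z - w)^-1)
         - (A0 + (w - z0) * A1 + (w - z0) ^+ 2 * A2)) <= K * nrm (w - z0) ^+ 3.
Proof.
have r1 := r0.
move=> fc fM.
pose i z := (z - z0)^-1.
have ic : sq_bcont i by apply: sq_inv_cont; exact: z0_near.
pose g1 z := f z * i z; pose g2 z := g1 z * i z; pose g3 z := g2 z * i z.
have c1 : sq_bcont g1 := sq_bcontM fc ic.
have c2 : sq_bcont g2 := sq_bcontM c1 ic.
have c3 : sq_bcont g3 := sq_bcontM c2 ic.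
exists (sqint g1), (sqint g2), (sqint g3), (16 * (M * r ^- 3 * (r / 2)^-1) * r) => w wz.
set h := w - z0.
pose rem z := f z * (z - w)^-1 + (-1) * (g1 z + (h * g2 z + h ^+ 2 * g3 z)).
have cst k : sq_bcont (fun=> k) by move=> x y _; exact: ctsC.
have cw : sq_bcont (fun z => f z * (z - w)^-1).
  exact: (sq_bcontM fc (sq_inv_cont wz)).
have ch2 : sq_bcont (fun z => h * g2 z) := sq_bcontM (cst h) c2.
have ch3 : sq_bcont (fun z => h ^+ 2 * g3 z) := sq_bcontM (cst (h ^+ 2)) c3.
have c23 : sq_bcont (fun z => h * g2 z + h ^+ 2 * g3 z).
  by move=> x y xy; exact: (ctsD (ch2 x y xy) (ch3 x y xy)).
have c123 : sq_bcont (fun z => g1 z + (h * g2 z + h ^+ 2 * g3 z)).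
  by move=> x y xy; exact: (ctsD (c1 x y xy) (c23 x y xy)).
have cm : sq_bcont (fun z => (-1) * (g1 z + (h * g2 z + h ^+ 2 * g3 z))) := sq_bcontM (cst (-1)) c123.
have crem : sq_bcont rem by move=> x y xy; exact: (ctsD (cw x y xy) (cm x y xy)).
have -> : sqint (fun z => f z * (z - w)^-1) - (sqint g1 + h * sqint g2 + h ^+ 2 * sqint g3) = sqint rem.
  rewrite /rem sqintD// sqintZ// sqintD// sqintD// !sqintZ//; ring.
have -> : 16 * (M * r ^- 3 * (r / 2)^-1) * r * nrm h ^+ 3 = 16 * (M * r ^- 3 * (r / 2)^-1 * nrm h ^+ 3) * r.
  by ring.
apply: sqint_bound => // x y xy.
have [_ _ far0] := xy.
have n0 := sq_far_neq xy z0_near; have nw := sq_far_neq xy wz.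
have -> : rem (pt x y) = f (pt x y) * (pt x y - z0)^-1 ^+ 3 * (pt x y - w)^-1 * h ^+ 3.
  rewrite /rem /g3 /g2 /g1 /i /h; field.
  by rewrite n0 nw.
rewrite 3!nrmM 2!nrmX 2!nrmV; apply: ler_wpM2r; first exact: exprn_ge0 (nrm_ge0 _).
apply: ler_pM; [|by rewrite invr_ge0 nrm_ge0| |].
- by apply: mulr_ge0; [exact: nrm_ge0|rewrite exprn_ge0// invr_ge0 nrm_ge0].
- apply: ler_pM; [exact: nrm_ge0|by rewrite exprn_ge0// invr_ge0 nrm_ge0|exact: fM|].
  rewrite -exprVn; apply: lerXn2r.
  + by rewrite nnegrE invr_ge0 nrm_ge0.
  + by rewrite nnegrE invr_ge0 ltW.
  + by rewrite lef_pV2 ?posrE//; exact: lt_le_trans r0 far0.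
have := sq_far xy wz => h2; rewrite lef_pV2// posrE; lra.
Qed.

(** This replaces the value 2 pi i. Every side contributes a nonnegative imaginary part, and the
    bottom side a positive one. *)
Lemma sq_int_im_pos : 0 < complex.Im (sqint (fun z => (z - z0)^-1)).
Proof.
have r1 := r0.
have cb := sq_bcont_bdry (sq_inv_cont z0_near).
have [[c1 c1'] [c2 c2'] [c3 c3'] [c4 c4']] := cb.
have -> : complex.Im (sqint (fun z => (z - z0)^-1)) =
   rint (@complex.Im R \o hline (fun z => (z - z0)^-1) (v - r)) (u - r) (u + r)
   + (- rint (@complex.Im R \o hline (fun z => (z - z0)^-1) (v + r)) (u - r) (u + r))
   + rint (@complex.Re R \o vline (fun z => (z - z0)^-1) (u + r)) (v - r) (v + r)
   + (- rint (@complex.Re R \o vline (fun z => (z - z0)^-1) (u - r)) (v - r) (v + r)).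
  rewrite /sqint /rcint /cint; simpc => /=; ring.
have bE x y : (x = u - r \/ x = u + r) \/ (y = v - r \/ y = v + r) -> 0 < (x - u) ^+ 2 + (y - v) ^+ 2.
  have sr : 0 < r ^+ 2 by exact: exprn_gt0.
  case=> -[] ->.
  - have -> : u - r - u = - r by ring.
    by rewrite sqrrN ltr_wpDr// sqr_ge0.
  - have -> : u + r - u = r by ring.
    by rewrite ltr_wpDr// sqr_ge0.
  - have -> : v - r - v = - r by ring.
    by rewrite sqrrN ltr_wpDl// sqr_ge0.
  - have -> : v + r - v = r by ring.
    by rewrite ltr_wpDl// sqr_ge0.
have invE x y : (pt x y - z0)^-1 = ((x - u) / ((x - u) ^+ 2 + (y - v) ^+ 2) -i* ((y - v) / ((x - u) ^+ 2 + (y - v) ^+ 2)))%C.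
  by rewrite /pt /z0 /pt; simpc.
have cc k a b : rcont (fun=> k : R) a b by move=> t _; exact: cvg_cst.
have ur : u - r <= u + r by lra.
have vr : v - r <= v + r by lra.
have p1 : 0 < rint (@complex.Im R \o hline (fun z => (z - z0)^-1) (v - r)) (u - r) (u + r).
  (* On the bottom side the integrand is r / ((t - u)^2 + r^2), and |t - u| is at most r. *)
  apply: (@lt_le_trans _ _ (rint (fun=> r / (2 * r ^+ 2)) (u - r) (u + r))).
    rewrite rint_cst//; apply: mulr_gt0; last lra.
    by apply: divr_gt0 => //; apply: mulr_gt0 => //; exact: exprn_gt0.
  apply: rint_le => // t tt; rewrite /comp /hline invE /=.
  have -> : - ((v - r - v) / ((t - u) ^+ 2 + (v - r - v) ^+ 2)) = r / ((t - u) ^+ 2 + r ^+ 2).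
    have -> : v - r - v = - r by ring.
    by rewrite mulNr opprK sqrrN.
  have sr : 0 < r ^+ 2 by exact: exprn_gt0.
  rewrite ler_pM2l// lef_pV2; [|by rewrite posrE; apply: mulr_gt0|by rewrite posrE ltr_wpDl// sqr_ge0].
  have : (t - u) ^+ 2 <= r ^+ 2 by nra.
  lra.
have p2 : 0 <= - rint (@complex.Im R \o hline (fun z => (z - z0)^-1) (v + r)) (u - r) (u + r).
  rewrite oppr_ge0; have <- : rint (fun=> 0) (u - r) (u + r) = 0 by rewrite rint_cst// mul0r.
  apply: rint_le => // t tt; rewrite /comp /hline invE /= oppr_le0.
  by apply: divr_ge0; [lra|apply/ltW/bE; right; right].
have p3 : 0 <= rint (@complex.Re R \o vline (fun z => (z - z0)^-1) (u + r)) (v - r) (v + r).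
  have <- : rint (fun=> 0) (v - r) (v + r) = 0 by rewrite rint_cst// mul0r.
  apply: rint_le => // t tt; rewrite /comp /vline invE /=.
  by apply: divr_ge0; [lra|apply/ltW/bE; left; right].
have p4 : 0 <= - rint (@complex.Re R \o vline (fun z => (z - z0)^-1) (u - r)) (v - r) (v + r).
  rewrite oppr_ge0; have <- : rint (fun=> 0) (v - r) (v + r) = 0 by rewrite rint_cst// mul0r.
  apply: rint_le => // t tt; rewrite /comp /vline invE /=.
  have -> : u - r - u = - r by ring.
  rewrite mulNr oppr_le0; apply: divr_ge0; first exact: ltW.
  by rewrite addr_ge0// sqr_ge0.
lra.
Qed.

(** The quotient (f z - f w) / (z - w) is bounded near w, so [goursat_punctured] applies to it. The
    kernel is written [1 * (z - w)^-1] so that [cauchy_kernel_expansion] covers it as the case of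
    the constant function 1. *)
Lemma sq_cauchy f w : (forall z, nrm (z - z0) <= 2 * r -> derivable f z 1) ->
  nrm (w - z0) <= r / 2 ->
  sqint (fun z => f z * (z - w)^-1) = f w * sqint (fun z => 1 * (z - w)^-1).
Proof.
have r1 := r0.
move=> fd wz.
have dw : derivable f w 1 by apply: fd; lra.
have insq x y : u - r <= x <= u + r -> v - r <= y <= v + r -> nrm (pt x y - z0) <= 2 * r.
  move=> /andP[? ?] /andP[? ?]; apply: le_trans (nrm_le_ReIm _) _.
  rewrite /z0 /pt; simpc => /=; have -> : 2 * r = r + r by ring.
  by apply: lerD; rewrite ler_norml; apply/andP; split; lra.
have fc : sq_bcont f by move=> x y [xx yy _]; apply: derivable_cts; apply: fd; exact: insq.
have c1 : sq_bcont (fun=> 1 : C) by move=> x y _; exact: ctsC.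
have cw := sq_inv_cont wz.
have cfw : sq_bcont (fun=> - f w) by move=> x y _; exact: ctsC.
have : sqint (fun z => f z * (z - w)^-1 + (- f w) * (1 * (z - w)^-1)) = 0.
  have [M [d d0 dM]] : exists M, exists2 d, 0 < d & forall z, nrm (z - w) < d -> z != w ->
      nrm (f z * (z - w)^-1 + (- f w) * (1 * (z - w)^-1)) <= M.
    have [d d0 dP] := derivable_cdif dw ltr01.
    exists (1 + nrm (derive1 f w)), d => // z zw znw.
    have zw0 : z - w != 0 by rewrite subr_eq0.
    have -> : f z * (z - w)^-1 + - f w * (1 * (z - w)^-1) =
      (f z - f w - derive1 f w * (z - w)) * (z - w)^-1 + derive1 f w by field.
    apply: le_trans (nrmD _ _) _; rewrite lerD2r nrmM nrmV ler_pdivrMr ?nrm_gt0//.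
    exact: dP.
  have wE : w = pt (complex.Re w) (complex.Im w) by case: (w).
  have wr := nrm_Re (w - z0); have wi := nrm_Im (w - z0).
  have [wr' wi'] : `|complex.Re w - u| <= r / 2 /\ `|complex.Im w - v| <= r / 2.
    move: wr wi; rewrite wE /z0 /pt; simpc => /= wr wi.
    by split; [apply: le_trans wr _|apply: le_trans wi _]; move: wz; rewrite wE /z0 /pt; simpc.
  move: wr' wi'; rewrite !ler_norml => /andP[? ?] /andP[? ?].
  apply: (@goursat_punctured _ _ (u - r) (u + r) (v - r) (v + r) (complex.Re w) (complex.Im w) M d).
  - by apply/andP; split; lra.
  - by apply/andP; split; lra.
  - move=> x y xx yy; rewrite -wE => xy.
    have fxy : derivable f (pt x y) 1 by apply: fd; exact: insq.
    have zw0 : pt x y - w != 0 by rewrite subr_eq0.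
    have iw : derivable (fun z : C => (z - w)^-1) (pt x y) 1.
      have dz : derivable (fun z : C => z - w) (pt x y) 1.
        exact: (derD (derId (pt x y)) (derC (- w) (pt x y))).
      exact: (@derV R (fun z => z - w) (pt x y) zw0 dz).
    exact: (derD (derM fxy iw) (derM (derC (- f w) (pt x y)) (derM (derC 1 (pt x y)) iw))).
  - exact: d0.
  - by move=> z; rewrite -wE; exact: dM.
have c1w : sq_bcont (fun z => 1 * (z - w)^-1) := sq_bcontM c1 cw.
rewrite (sqintD (sq_bcontM fc cw) (sq_bcontM cfw c1w)) (sqintZ _ c1w).
by move/eqP; rewrite mulNr subr_eq0 => /eqP.
Qed.

End Square.

(** * Taylor expansion of order two *)

Section Taylor.
Context {R : realType}.
Local Notation C := (Cx R).
Implicit Types (f g : C -> C) (w z : C).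

Lemma nrm_le_expansion (A0 A1 A2 h y : C) (K : R) :
  nrm (y - (A0 + h * A1 + h ^+ 2 * A2)) <= K * nrm h ^+ 3 ->
  exists2 E, y = A0 + h * A1 + h ^+ 2 * A2 + E & nrm E <= K * nrm h ^+ 3.
Proof. by move=> H; exists (y - (A0 + h * A1 + h ^+ 2 * A2)) => //; ring. Qed.

(** By [sq_cauchy], f is the quotient of two integrals that both have quadratic expansions, and the
    denominator does not vanish at z0. Order two is what a derivative of the difference quotient at
    z0 requires. *)
Lemma holo_taylor2 f z0 : (\forall z \near z0, derivable f z 1) ->
  exists c1 c2 K, \forall z \near z0,
    nrm (f z - (f z0 + (z - z0) * c1 + (z - z0) ^+ 2 * c2)) <= K * nrm (z - z0) ^+ 3.
Proof.
move=> /nbhsCP[d1 d10 fd1].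
have df0 : derivable f z0 1 by apply: fd1; rewrite subrr nrm0.
have [d2 d20 fd2] := (nbhsCP _ _).1 ((cvgCP _ _ _).1 (derivable_cts df0) _ ltr01).
pose r := Num.min d1 d2 / 3.
have r0 : 0 < r by apply: divr_gt0 => //; rewrite lt_min d10.
have r3 : 3 * r = Num.min d1 d2 by rewrite /r; field.
have [r1 r2] : 3 * r <= d1 /\ 3 * r <= d2 by rewrite r3 !ge_min !lexx orbT.
have zE : z0 = pt (complex.Re z0) (complex.Im z0) by case: (z0).
set u := complex.Re z0 in zE; set v := complex.Im z0 in zE.
have fd z : nrm (z - z0) <= 2 * r -> derivable f z 1 by move=> h; apply: fd1; lra.
have insq x y : sq_bdry u v r x y -> nrm (pt x y - z0) <= 2 * r.
  move=> [/andP[? ?] /andP[? ?] _]; apply: le_trans (nrm_le_ReIm _) _.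
  rewrite zE /pt; simpc => /=; have -> : 2 * r = r + r by ring.
  by apply: lerD; rewrite ler_norml; apply/andP; split; lra.
have fc : sq_bcont u v r f by move=> x y xy; apply: derivable_cts; apply: fd; exact: insq.
have c1c : sq_bcont u v r (fun=> 1 : C) by move=> x y _; exact: ctsC.
have fM x y : sq_bdry u v r x y -> nrm (f (pt x y)) <= nrm (f z0) + 1.
  move=> xy; have -> : f (pt x y) = f z0 + (f (pt x y) - f z0) by ring.
  apply: le_trans (nrmD _ _) _; rewrite lerD2l; apply/ltW/fd2.
  by have := insq x y xy; lra.
have oM x y : sq_bdry u v r x y -> nrm (1 : C) <= 1 by move=> _; rewrite nrm1.
have [A0 [A1 [A2 [K]]]] := cauchy_kernel_expansion r0 fc fM.
have [B0 [B1 [B2 [L]]]] := cauchy_kernel_expansion r0 c1c oM.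
rewrite -zE => oE fE.
(* At w = z0 the error term vanishes, so [B0] is the kernel integral of [sq_int_im_pos]. *)
have B00 : B0 != 0.
  have : nrm (z0 - z0) <= r / 2 by rewrite subrr nrm0; lra.
  move/oE; rewrite subrr nrm0 !expr0n /= mulr0 !mul0r !addr0.
  move=> h; have /eqP : nrm (sqint u v r (fun z => 1 * (z - z0)^-1) - B0) == 0.
    by rewrite eq_le h nrm_ge0.
  move/eqP; rewrite nrm_eq0 subr_eq0 => /eqP <-.
  apply/eqP => E; have := sq_int_im_pos u v r0; rewrite -zE.
  have -> : (fun z => (z - z0)^-1) = (fun z => 1 * (z - z0)^-1) by apply/funext => z; rewrite mul1r.
  by rewrite E ltxx.
have K0 : 0 <= K.
  pose w := z0 + ((r / 2)%:C)%C; have nw : nrm (w - z0) = r / 2.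
    by rewrite /w addrC addKr nrm_real ger0_norm//; lra.
  have := fE w; rewrite nw lexx => /(_ isT) => h.
  have : 0 <= K * (r / 2) ^+ 3 by apply: le_trans (nrm_ge0 _) h.
  by rewrite pmulr_lge0// exprn_gt0//; lra.
have L0 : 0 <= L.
  pose w := z0 + ((r / 2)%:C)%C; have nw : nrm (w - z0) = r / 2.
    by rewrite /w addrC addKr nrm_real ger0_norm//; lra.
  have := oE w; rewrite nw lexx => /(_ isT) => h.
  have : 0 <= L * (r / 2) ^+ 3 by apply: le_trans (nrm_ge0 _) h.
  by rewrite pmulr_lge0// exprn_gt0//; lra.
(* The quotient of A0 + A1 h + A2 h^2 by B0 + B1 h + B2 h^2 modulo h^3; [N] collects all terms of
   order h^3. *)
pose c0 := A0 / B0; pose c1 := (A1 - B1 * c0) / B0; pose c2 := (A2 - B1 * c1 - B2 * c0) / B0.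
pose N := K + (L * nrm c0 + L * nrm c1 * r + L * nrm c2 * r ^+ 2)
   + (nrm B1 * nrm c2 + nrm B2 * nrm c1 + nrm B2 * nrm c2 * r).
(* Within this radius the kernel integral keeps at least half the norm of [B0]. *)
pose rho := Num.min (r / 2) (nrm B0 / (2 * (nrm B1 + nrm B2 * r + L * r ^+ 2 + 1))).
have b0 : 0 < nrm B0 by rewrite nrm_gt0.
have D0 : 0 < nrm B1 + nrm B2 * r + L * r ^+ 2 + 1.
  by rewrite ltr_wpDl// !addr_ge0// ?nrm_ge0// mulr_ge0// ?nrm_ge0// ?exprn_ge0// ltW.
have rho0 : 0 < rho by rewrite lt_min (divr_gt0 r0)//= (divr_gt0 b0)// (mulr_gt0 _ D0).
have [rho1 rho2] : rho <= r / 2 /\ rho <= nrm B0 / (2 * (nrm B1 + nrm B2 * r + L * r ^+ 2 + 1)).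
  by rewrite !ge_min !lexx orbT.
have key w : nrm (w - z0) <= rho ->
    nrm (f w - (c0 + (w - z0) * c1 + (w - z0) ^+ 2 * c2)) <= N / (nrm B0 / 2) * nrm (w - z0) ^+ 3.
  move=> wrho; have wr : nrm (w - z0) <= r / 2 by lra.
  have Cf := @sq_cauchy _ u v r r0 f w; rewrite -zE in Cf.
  move: (Cf fd wr) => {}Cf.
  have [E1 FE E1n] := nrm_le_expansion (fE _ wr).
  have [E2 OE E2n] := nrm_le_expansion (oE _ wr).
  set h := w - z0 in FE OE E1n E2n wr wrho *.
  set kap := sqint u v r (fun z => 1 * (z - w)^-1) in Cf OE.
  have h0 := nrm_ge0 h.
  have kapL : nrm B0 / 2 <= nrm kap.
    have e : nrm B0 <= nrm kap + nrm (h * (B1 + h * B2)) + nrm E2.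
      have -> : B0 = kap - h * (B1 + h * B2) - E2 by rewrite OE; ring.
      apply: le_trans (nrmBD _ _) _; rewrite lerD2r; exact: nrmBD.
    have e1 : nrm (h * (B1 + h * B2)) <= nrm h * (nrm B1 + nrm B2 * r).
      rewrite nrmM ler_wpM2l//; apply: le_trans (nrmD _ _) _; rewrite lerD2l nrmM mulrC.
      by apply: ler_wpM2l; [exact: nrm_ge0|lra].
    have e2 : nrm E2 <= nrm h * (L * r ^+ 2).
      apply: le_trans E2n _; rewrite exprS mulrCA ler_wpM2l// ler_wpM2l//.
      by rewrite ler_sqr ?nnegrE//; lra.
    have e3 : nrm h * (nrm B1 + nrm B2 * r + L * r ^+ 2 + 1) <= nrm B0 / 2.
      have : nrm h <= nrm B0 / (2 * (nrm B1 + nrm B2 * r + L * r ^+ 2 + 1)) by lra.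
      rewrite ler_pdivlMr; last by apply: mulr_gt0.
      by lra.
    by lra.
  have idt : kap * (f w - (c0 + h * c1 + h ^+ 2 * c2)) =
      E1 - E2 * (c0 + h * c1 + h ^+ 2 * c2) - h ^+ 3 * (B1 * c2 + B2 * c1 + h * (B2 * c2)).
    have e0 : A0 = B0 * c0 by rewrite /c0; field.
    have e1 : A1 = B0 * c1 + B1 * c0 by rewrite /c1; field.
    have e2 : A2 = B0 * c2 + B1 * c1 + B2 * c0 by rewrite /c2; field.
    rewrite mulrBr [kap * f w]mulrC -Cf FE OE e0 e1 e2; ring.
  have hr : nrm h <= r by lra.
  have bnd : nrm (kap * (f w - (c0 + h * c1 + h ^+ 2 * c2))) <= N * nrm h ^+ 3.
    rewrite idt; have -> : N * nrm h ^+ 3 = K * nrm h ^+ 3 +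
      (L * nrm h ^+ 3) * (nrm c0 + r * nrm c1 + r ^+ 2 * nrm c2) +
      nrm h ^+ 3 * ((nrm B1 * nrm c2 + nrm B2 * nrm c1) + r * (nrm B2 * nrm c2)) by rewrite /N; ring.
    have h3 : 0 <= nrm h ^+ 3 by exact: exprn_ge0.
    apply: le_trans (nrmBD _ _) _; apply: lerD.
      apply: le_trans (nrmBD _ _) _; apply: lerD => //.
      rewrite nrmM; apply: ler_pM; rewrite ?nrm_ge0//.
      apply: le_trans (nrmD _ _) _; apply: lerD.
        by apply: le_trans (nrmD _ _) _; rewrite lerD2l nrmM ler_wpM2r ?nrm_ge0.
      rewrite nrmM nrmX ler_wpM2r ?nrm_ge0// ler_sqr ?nnegrE//; lra.
    rewrite nrmM nrmX ler_wpM2l//; apply: le_trans (nrmD _ _) _; apply: lerD.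
      by apply: le_trans (nrmD _ _) _; rewrite (nrmM B1 c2) (nrmM B2 c1).
    rewrite nrmM (nrmM B2 c2); apply: ler_wpM2r => //; apply: mulr_ge0; exact: nrm_ge0.
  rewrite nrmM in bnd.
  have b2 : 0 < nrm B0 / 2 by apply: divr_gt0.
  have k0 : 0 < nrm kap by apply: lt_le_trans b2 kapL.
  rewrite (mulrAC N) ler_pdivlMr// mulrC; apply: le_trans bnd.
  by apply: ler_wpM2r => //; exact: nrm_ge0.
have fz0 : f z0 = c0.
  have := key z0; rewrite subrr nrm0 => /(_ (ltW rho0)).
  rewrite !expr0n /= !mul0r mulr0 !addr0 => h.
  by apply/eqP; rewrite -subr_eq0 -nrm_eq0 eq_le h nrm_ge0.
exists c1, c2, (N / (nrm B0 / 2)); apply/nbhsCP; exists rho => // w wz.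
by rewrite fz0; apply: key; exact: ltW.
Qed.

End Taylor.

(** * Removable singularities *)

Section RemovableSingularity.
Context {R : realType}.
Local Notation C := (Cx R).
Implicit Types (f g T q : C -> C) (w z : C).

Definition pnear z (P : C -> Prop) := exists2 d : R, 0 < d &
  forall w, nrm (w - z) < d -> w != z -> P w.
Definition cnear z (P : C -> Prop) := exists2 d : R, 0 < d &
  forall w, nrm (w - z) < d -> P w.

Lemma cnearP z (P : C -> Prop) : (\forall w \near z, P w) <-> cnear z P.
Proof. exact: nbhsCP. Qed.

Lemma ctsCP f z : {for z, continuous f} <->
  forall e : R, 0 < e -> cnear z (fun w => nrm (f w - f z) < e).
Proof.
split=> [/cvgCP fc e e0|H]; first by apply/cnearP; exact: fc.
apply: (iffRL (@cvgCP R _ (nbhs z) (nbhs_filter z) f (f z))) => e e0.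
by apply/cnearP; exact: H.
Qed.

Lemma cnear_at z P : cnear z P -> P z.
Proof. by move=> [d d0]; apply; rewrite subrr nrm0. Qed.

Lemma cnear_pnear z P : cnear z P -> pnear z P.
Proof. by move=> [d d0 dP]; exists d => // w wd _; exact: dP. Qed.

Lemma pnear_cnear z P : pnear z P -> P z -> cnear z P.
Proof.
move=> [d d0 dP] Pz; exists d => // w wd; have [->//|] := eqVneq w z; exact: dP.
Qed.

Lemma cnear_and z (P Q : C -> Prop) : cnear z P -> cnear z Q -> cnear z (fun w => P w /\ Q w).
Proof. by move=> /cnearP P1 /cnearP Q1; apply/cnearP; near do split. Unshelve. all: by end_near. Qed.

Lemma pnear_and z (P Q : C -> Prop) : pnear z P -> pnear z Q -> pnear z (fun w => P w /\ Q w).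
Proof.
move=> [d d0 dP] [e e0 eQ]; exists (Num.min d e); first by rewrite lt_min d0.
by move=> w; rewrite lt_min => /andP[wd we] wz; split; [exact: dP|exact: eQ].
Qed.

Lemma cnear_sub z (P Q : C -> Prop) : (forall w, P w -> Q w) -> cnear z P -> cnear z Q.
Proof. by move=> PQ [d d0 dP]; exists d => // w /dP/PQ. Qed.

Lemma pnear_sub z (P Q : C -> Prop) : (forall w, P w -> Q w) -> pnear z P -> pnear z Q.
Proof. by move=> PQ [d d0 dP]; exists d => // w wd /(dP w wd)/PQ. Qed.

Lemma cnear_cnear z P : cnear z P -> cnear z (fun w => cnear w P).
Proof.
move=> [d d0 dP]; exists d => // w wd; exists (d - nrm (w - z)); first by rewrite subr_gt0.
move=> t tw; apply: dP; have -> : t - z = (t - w) + (w - z) by ring.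
by apply: le_lt_trans (nrmD _ _) _; rewrite -ltrBrDr.
Qed.

Lemma pnear_pnear z P : pnear z P -> pnear z (fun w => cnear w P).
Proof.
move=> [d d0 dP]; exists d => // w wd wz.
have wz0 : 0 < nrm (w - z) by rewrite nrm_gt0 subr_eq0.
exists (Num.min (d - nrm (w - z)) (nrm (w - z))); first by rewrite lt_min subr_gt0 wd.
move=> t; rewrite lt_min => /andP[t1 t2]; apply: dP.
  have -> : t - z = (t - w) + (w - z) by ring.
  by apply: le_lt_trans (nrmD _ _) _; rewrite -ltrBrDr.
by apply: contraTneq t2 => ->; rewrite nrmB ltxx.
Qed.

Lemma cdif_near f g z l : cnear z (fun w => f w = g w) -> cdif f z l -> cdif g z l.
Proof.
move=> fg fl e e0; have [d d0 dP] := fl e e0; have [d' d'0 d'P] := fg.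
exists (Num.min d d'); first by rewrite lt_min d0.
move=> w; rewrite lt_min => /andP[w1 w2]; rewrite -!d'P ?subrr ?nrm0//; exact: dP.
Qed.

Lemma der_near f g z : cnear z (fun w => f w = g w) -> derivable f z 1 -> derivable g z 1.
Proof. by move=> fg /derivable_cdif /(cdif_near fg) /cdif_derivable. Qed.

(** The point is differentiability of the filled-in quotient at z0 itself; its derivative there is
    the second Taylor coefficient. *)
Lemma dquot_holo f z0 : cnear z0 (fun z => derivable f z 1) ->
  exists q, [/\ forall z, f z = f z0 + (z - z0) * q z, q z0 = derive1 f z0 &
    cnear z0 (fun z => derivable q z 1)].
Proof.
move=> fd; have df0 := cnear_at fd.
have fl := derivable_cdif df0.
pose q z : C := if z == z0 then derive1 f z0 else (f z - f z0) * (z - z0)^-1.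
exists q; split; first 1 last.
- by rewrite /q eqxx.
- apply: pnear_cnear.
    apply: pnear_sub (pnear_and (cnear_pnear fd) (pnear_pnear (_ : pnear z0 (fun z => z != z0)))); last first.
      by exists 1.
    move=> z [dz]; move=> zz; have znz := cnear_at zz.
    have zn0 : z - z0 != 0 by rewrite subr_eq0.
    have dz0 : derivable (fun z => z - z0) z 1 := derD (derId z) (derC (- z0) z).
    have di : derivable (fun z => (z - z0)^-1) z 1 := @derV R (fun z => z - z0) z zn0 dz0.
    have dq : derivable (fun z => (f z - f z0) * (z - z0)^-1) z 1 := derM (derD dz (derC (- f z0) z)) di.
    apply: der_near dq; apply: cnear_sub zz => w wz.
    by rewrite /q (negPf wz).
  have [c1 [c2 [K]]] := holo_taylor2 ((cnearP _ _).2 fd).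
  move=> /cnearP [d d0 H].
  (* The linear coefficient of the expansion is not known to be the derivative until the quadratic
     and cubic terms are shown to be o(h). *)
  have c1E : c1 = derive1 f z0.
    symmetry; apply: cdif_derive1 => e e0.
    exists (Num.min d (Num.min 1 (e / (`|K| + nrm c2 + 1)))).
      by rewrite !lt_min d0 ltr01/= divr_gt0// ltr_wpDl// addr_ge0// nrm_ge0.
    move=> w; rewrite !lt_min => /and3P[wd w1 we].
    set h := w - z0 in wd w1 we *.
    have -> : f w - f z0 - c1 * h = (f w - (f z0 + h * c1 + h ^+ 2 * c2)) + h ^+ 2 * c2 by ring.
    apply: le_trans (nrmD _ _) _; rewrite nrmM nrmX.
    have Hw := H w wd; rewrite -/h in Hw.
    have h0 := nrm_ge0 h; have c20 := nrm_ge0 c2.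
    have Ka := ler_norm K; have Kn := normr_ge0 K.
    have p : 0 < `|K| + nrm c2 + 1 by lra.
    move: we; rewrite ltr_pdivlMr// => we.
    have h3 : K * nrm h ^+ 3 <= `|K| * nrm h ^+ 2.
      have -> : K * nrm h ^+ 3 = nrm h ^+ 2 * (K * nrm h) by ring.
      rewrite [leRHS]mulrC; apply: ler_wpM2l; first exact: exprn_ge0.
      apply: le_trans (_ : `|K| * nrm h <= _); first exact: ler_wpM2r.
      by rewrite ler_piMr// ltW.
    have : nrm h ^+ 2 * (`|K| + nrm c2 + 1) <= e * nrm h.
      by rewrite expr2 -mulrA [leRHS]mulrC; apply: ler_wpM2l => //; exact: ltW.
    have : 0 <= nrm h ^+ 2 by exact: exprn_ge0.
    by nra.
  apply: (@cdif_derivable _ _ _ c2) => e e0.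
  exists (Num.min d (e / (`|K| + 1))); first by rewrite lt_min d0 divr_gt0// ltr_wpDl.
  move=> w; rewrite lt_min => /andP[wd we].
  rewrite /q eqxx; have [->|wz] := eqVneq w z0.
    by rewrite !subrr mulr0 subrr nrm0 mulr0.
  have wn0 : w - z0 != 0 by rewrite subr_eq0.
  have -> : (f w - f z0) * (w - z0)^-1 - derive1 f z0 - c2 * (w - z0) =
     (f w - (f z0 + (w - z0) * c1 + (w - z0) ^+ 2 * c2)) * (w - z0)^-1.
    by rewrite -c1E; field.
  have n0 : 0 < nrm (w - z0) by rewrite nrm_gt0.
  rewrite nrmM nrmV ler_pdivrMr//; apply: le_trans (H _ wd) _.
  move: we; rewrite ltr_pdivlMr ?ltr_wpDl// => we.
  have -> : K * nrm (w - z0) ^+ 3 = K * nrm (w - z0) * nrm (w - z0) * nrm (w - z0) by ring.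
  rewrite ler_pM2r// ler_pM2r//; apply: le_trans (_ : `|K| * nrm (w - z0) <= _).
    by rewrite ler_pM2r// ler_norm.
  have := nrm_ge0 (w - z0); lra.
- move=> z; rewrite /q; have [->|zz] := eqVneq z z0; first by rewrite subrr mul0r addr0.
  have zn0 : z - z0 != 0 by rewrite subr_eq0.
  by field.
Qed.

(** Riemann's trick: (z - z0)^2 T, extended by 0, is differentiable at z0 with derivative 0, so z -
    z0 can be divided out twice. *)
Lemma removable T z0 : pnear z0 (fun z => derivable T z 1) ->
  (forall e : R, 0 < e -> pnear z0 (fun z => nrm ((z - z0) * T z) <= e)) ->
  exists2 T', cnear z0 (fun z => derivable T' z 1) & pnear z0 (fun z => T' z = T z).
Proof.
move=> Td To.
pose h z : C := if z == z0 then 0 else (z - z0) ^+ 2 * T z.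
have h0 : h z0 = 0 by rewrite /h eqxx.
have hl : cdif h z0 0.
  move=> e e0; have [d d0 dP] := To e e0; exists d => // w wd.
  rewrite h0 mul0r !subr0 /h; have [->|wz] := eqVneq w z0.
    by rewrite subrr nrm0 mulr0.
  rewrite expr2 -mulrA mulrC nrmM; apply: ler_wpM2r; first exact: nrm_ge0.
  exact: dP.
have hd : cnear z0 (fun z => derivable h z 1).
  apply: pnear_cnear; last exact: cdif_derivable hl.
  apply: pnear_sub (pnear_and Td (pnear_pnear (_ : pnear z0 (fun z => z != z0)))); last first.
    by exists 1.
  move=> z [dz zz].
  have dz0 : derivable (fun z => z - z0) z 1 := derD (derId z) (derC (- z0) z).
  have dd : derivable (fun z => (z - z0) * (z - z0) * T z) z 1 := derM (derM dz0 dz0) dz.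
  apply: der_near dd; apply: cnear_sub zz => w wz.
  by rewrite /h (negPf wz) expr2.
have [q1 [q1E q1z q1d]] := dquot_holo hd.
have q10 : q1 z0 = 0 by rewrite q1z; exact: cdif_derive1.
have [q2 [q2E q2z q2d]] := dquot_holo q1d.
exists q2 => //; exists 1 => // z _ zz.
have zn0 : z - z0 != 0 by rewrite subr_eq0.
have := q1E z; rewrite h0 q2E q10 !add0r /h (negPf zz) => E.
by apply: (mulfI (mulf_neq0 zn0 zn0)); rewrite -mulrA -E expr2.
Qed.

Lemma eq_at_limit f g z0 : {for z0, continuous f} -> {for z0, continuous g} ->
  pnear z0 (fun z => f z = g z) -> f z0 = g z0.
Proof.
move=> /cvgCP fc /cvgCP gc [d d0 dP].
apply/eqP; rewrite -subr_eq0 -nrm_eq0; apply/eqP/le_anti; rewrite nrm_ge0 andbT.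
apply/ler_addgt0Pl => e e0; rewrite addr0.
have e2 : 0 < e / 2 by lra.
have /cnearP[d1 d10 d1P] := fc _ e2; have /cnearP[d2 d20 d2P] := gc _ e2.
pose m := Num.min d (Num.min d1 d2).
have m0 : 0 < m by rewrite !lt_min d0 d10.
pose w := z0 + ((m / 2)%:C)%C.
have nw : nrm (w - z0) = m / 2 by rewrite /w addrC addKr nrm_real ger0_norm//; lra.
have : m / 2 < m by lra.
rewrite {2}/m !lt_min -nw => /and3P[w0 w1 w2].
have wz : w != z0 by rewrite -subr_eq0 -nrm_gt0 nw; lra.
have -> : f z0 - g z0 = (g w - g z0) - (f w - f z0) by rewrite (dP w w0 wz); ring.
apply: le_trans (nrmBD _ _) _; have := d1P w w1; have := d2P w w2; lra.
Qed.

(** Caratheodory's criterion. The product rule, the chain rule and the implicit function argument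
    below are reduced to exhibiting a continuous g. *)
Lemma der_of_quotient (f g : C -> C) (z : C) : {for z, continuous g} ->
  cnear z (fun w => f w = f z + (w - z) * g w) -> cdif f z (g z).
Proof.
move=> /cvgCP gc [d d0 dP] e e0; have /cnearP[d' d'0 gP] := gc e e0.
exists (Num.min d d'); first by rewrite lt_min d0.
move=> w; rewrite lt_min => /andP[w1 w2]; rewrite (dP w w1).
have -> : f z + (w - z) * g w - f z - g z * (w - z) = (g w - g z) * (w - z) by ring.
by rewrite nrmM; apply: ler_wpM2r; [exact: nrm_ge0|exact/ltW/gP].
Qed.

(** The pointwise counterpart of [dquot_holo]: differentiability at the one point z0 gives a
    quotient that is continuous there. *)
Lemma dquot_cts f z0 : derivable f z0 1 ->
  exists q, [/\ forall z, f z = f z0 + (z - z0) * q z, q z0 = derive1 f z0 &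
    {for z0, continuous q}].
Proof.
move=> /derivable_cdif fd.
exists (fun z => if z == z0 then derive1 f z0 else (f z - f z0) * (z - z0)^-1); split.
- move=> z; have [->|zz] := eqVneq z z0; first by rewrite subrr mul0r addr0.
  have zn0 : z - z0 != 0 by rewrite subr_eq0.
  by field.
- by rewrite eqxx.
apply/ctsCP => e e0; have e2 : 0 < e / 2 by lra.
have [d d0 dP] := fd _ e2.
exists d => // w wd /=; rewrite eqxx.
have [_|wz] := eqVneq w z0; first by rewrite subrr nrm0.
have wn0 : w - z0 != 0 by rewrite subr_eq0.
have -> : (f w - f z0) * (w - z0)^-1 - derive1 f z0 = (f w - f z0 - derive1 f z0 * (w - z0)) * (w - z0)^-1.
  by field.
have n0 : 0 < nrm (w - z0) by rewrite nrm_gt0.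
by rewrite nrmM nrmV ltr_pdivrMr//; apply: le_lt_trans (dP _ wd) _; rewrite ltr_pM2r//; lra.
Qed.

Lemma cdif_quot f z l : cdif f z l -> exists q, [/\ forall w, f w = f z + (w - z) * q w, q z = l &
  {for z, continuous q}].
Proof.
move=> fl; have [q [q1 q2 q3]] := dquot_cts (cdif_derivable fl).
by exists q; split => //; rewrite q2 (cdif_derive1 fl).
Qed.

Lemma cdifM f g z (l m : C) : cdif f z l -> cdif g z m ->
  cdif (fun w => f w * g w) z (l * g z + f z * m).
Proof.
move=> fl gm; have gc := derivable_cts (cdif_derivable gm).
have [q [qE qz qc]] := cdif_quot fl; have [s [sE sz sc]] := cdif_quot gm.
have tc : {for z, continuous (fun w => q w * g w + f z * s w)}.
  exact: (@ctsD R (fun w => q w * g w) (fun w => f z * s w) z (ctsM qc gc) (ctsM (@ctsC R (f z) z) sc)).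
have := @der_of_quotient (fun w => f w * g w) _ z tc; rewrite qz sz; apply.
exists 1 => // w _; rewrite (_ : f w * g w = (f z + (w - z) * q w) * g w); last by rewrite -qE.
by rewrite mulrDl {1}(sE w); ring.
Qed.

Lemma cdif_comp f g z (l m : C) : cdif f z l -> cdif g (f z) m ->
  cdif (fun w => g (f w)) z (m * l).
Proof.
move=> fl gm; have fc := derivable_cts (cdif_derivable fl).
have [q [qE qz qc]] := cdif_quot fl; have [s [sE sz sc]] := cdif_quot gm.
have sfc : {for z, continuous (fun w => s (f w))}.
  apply/ctsCP => e e0; have [d d0 dP] := (ctsCP _ _).1 sc e e0.
  by apply: cnear_sub ((ctsCP _ _).1 fc d d0) => w; exact: dP.
have tc : {for z, continuous (fun w => s (f w) * q w)} := ctsM sfc qc.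
have := @der_of_quotient (fun w => g (f w)) _ z tc; rewrite sz qz; apply.
exists 1 => // w _; have e : f w - f z = (w - z) * q w by rewrite (qE w) addrC addKr.
by rewrite (sE (f w)) e; ring.
Qed.

Lemma der_comp f g z : derivable f z 1 -> derivable g (f z) 1 ->
  derivable (fun w => g (f w)) z 1.
Proof. by move=> /derivable_cdif fl /derivable_cdif gm; exact: cdif_derivable (cdif_comp fl gm). Qed.

Lemma cdif_uniq f z (l l' : C) : cdif f z l -> cdif f z l' -> l = l'.
Proof. by move=> /cdif_derive1 <- /cdif_derive1. Qed.

End RemovableSingularity.

(** * Continuity of the derivative of a holomorphic function *)

Section DerivativeContinuous.
Context {R : realType}.
Local Notation C := (Cx R).
Implicit Types (f g : C -> C).

(** Differentiation under the integral sign, with G(w) the integral of f / (z - w)^2. *)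
Lemma cauchy_kernel_deriv (u v r : R) (f : C -> C) (M : R) : 0 < r -> sq_bcont u v r f ->
  (forall x y, sq_bdry u v r x y -> nrm (f (pt x y)) <= M) ->
  exists2 G : C -> C,
    cnear (pt u v) (fun w => cdif (fun w => sqint u v r (fun z => f z * (z - w)^-1)) w (G w)) &
    {for pt u v, continuous G}.
Proof.
move=> r0 fc fM; set z0 := pt u v.
have bmul (g1 g2 : C -> C) : sq_bcont u v r g1 -> sq_bcont u v r g2 -> sq_bcont u v r (fun z => g1 z * g2 z).
  exact: sq_bcontM.
have cst (k : C) : sq_bcont u v r (fun=> k) by move=> x y _; exact: ctsC.
pose F w z := f z * (z - w)^-1; pose F2 w z := F w z * (z - w)^-1.
have near_in (w : C) : nrm (w - z0) < r / 2 -> nrm (w - z0) <= r / 2 by exact: ltW.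
have Fc (w : C) : nrm (w - z0) <= r / 2 -> sq_bcont u v r (F w).
  by move=> wz; exact: bmul fc (sq_inv_cont r0 wz).
have F2c (w : C) : nrm (w - z0) <= r / 2 -> sq_bcont u v r (F2 w).
  by move=> wz; exact: bmul (Fc w wz) (sq_inv_cont r0 wz).
have i0 : 0 < (r / 2)^-1 by rewrite invr_gt0; lra.
have inv_le x y (w : C) : sq_bdry u v r x y -> nrm (w - z0) <= r / 2 ->
    nrm (pt x y - w)^-1 <= (r / 2)^-1 /\ pt x y - w != 0.
  move=> xy wz; have h := sq_far r0 xy wz; split; last exact: (sq_far_neq r0 xy wz).
  by rewrite nrmV lef_pV2// posrE; lra.
(* One constant for both estimates. The factor 2 is needed for continuity of G, where a sum of two
   inverses occurs. *)
pose K := 16 * (`|M| * (2 * (r / 2)^-1) * (r / 2)^-1 * (r / 2)^-1) * r.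
have K0 : 0 <= K by rewrite /K !mulr_ge0// ltW.
have bound (g : C -> C) (t : R) : 0 <= t -> sq_bcont u v r g ->
    (forall x y, sq_bdry u v r x y ->
       nrm (g (pt x y)) <= `|M| * (2 * (r / 2)^-1) * (r / 2)^-1 * (r / 2)^-1 * t) ->
    nrm (sqint u v r g) <= K * t.
  move=> t0 gc gM; apply: le_trans (sqint_bound r0 gc gM) _.
  by rewrite /K le_eqVlt; apply/orP; left; apply/eqP; ring.
have fM' x y : sq_bdry u v r x y -> nrm (f (pt x y)) <= `|M|.
  by move=> /fM /le_trans; apply; exact: ler_norm.
exists (fun w => sqint u v r (F2 w)).
  exists (r / 2); first by lra.
  move=> w wz e e0.
  exists (Num.min (r / 2 - nrm (w - z0)) (e / (K + 1))).
    by rewrite lt_min subr_gt0 wz divr_gt0// ltr_wpDl.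
  move=> w'; rewrite lt_min => /andP[w'1 w'2]; set h := w' - w in w'1 w'2 *.
  have w'z : nrm (w' - z0) <= r / 2.
    have -> : w' - z0 = h + (w - z0) by rewrite /h; ring.
    by apply: le_trans (nrmD _ _) _; lra.
  have wz' := near_in w wz.
  pose rem z := F w' z + ((-1) * F w z + (- h) * F2 w z).
  have c1 : sq_bcont u v r (fun z => (-1) * F w z) := bmul _ _ (cst (-1)) (Fc w wz').
  have c2 : sq_bcont u v r (fun z => (- h) * F2 w z) := bmul _ _ (cst (- h)) (F2c w wz').
  have c3 : sq_bcont u v r (fun z => (-1) * F w z + (- h) * F2 w z).
    by move=> x y xy; exact: (ctsD (c1 x y xy) (c2 x y xy)).
  have crem : sq_bcont u v r rem.
    by move=> x y xy; exact: (ctsD (Fc w' w'z x y xy) (c3 x y xy)).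
  have -> : sqint u v r (fun z => f z * (z - w')^-1) - sqint u v r (fun z => f z * (z - w)^-1)
     - sqint u v r (F2 w) * h = sqint u v r rem.
    rewrite /rem (sqintD r0 (Fc w' w'z) c3) (sqintD r0 c1 c2) (sqintZ r0 _ (Fc w wz')) (sqintZ r0 _ (F2c w wz')).
    rewrite -/(F w') -/(F w); ring.
  apply: (@le_trans _ _ (K * nrm h ^+ 2)).
    apply: bound => //; first by rewrite exprn_ge0// nrm_ge0.
    move=> x y xy; have [n1 z1] := inv_le x y w' xy w'z; have [n2 z2] := inv_le x y w xy wz'.
    have -> : rem (pt x y) = f (pt x y) * (pt x y - w')^-1 * (pt x y - w)^-1 * (pt x y - w)^-1 * h ^+ 2.
      by rewrite /rem /F2 /F /h; field; rewrite z1 z2.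
    rewrite (nrmM _ (h ^+ 2)) nrmX; apply: ler_wpM2r; first by rewrite exprn_ge0// nrm_ge0.
    rewrite 3!nrmM; have M0 := normr_ge0 M.
    do ?[apply: ler_pM; rewrite ?mulr_ge0 ?nrm_ge0//]; rewrite ?fM'//.
    apply: le_trans n1 _; rewrite (_ : 2 * _ = (r / 2)^-1 + (r / 2)^-1); last by ring.
    by rewrite lerDl ltW.
  move: w'2; rewrite ltr_pdivlMr ?ltr_wpDl// => w'2.
  rewrite expr2 mulrA; apply: ler_wpM2r; first exact: nrm_ge0.
  by have := nrm_ge0 h; nra.
apply/ctsCP => e e0; exists (Num.min (r / 2) (e / (K + 1))).
  by rewrite lt_min !divr_gt0// ltr_wpDl.
move=> w; rewrite lt_min => /andP[w1 w2]; set h := w - z0 in w1 w2 *.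
have wz' := near_in w w1.
have zz : nrm (z0 - z0) <= r / 2 by rewrite subrr nrm0; lra.
pose rem z := F2 w z + (-1) * F2 z0 z.
have c1 : sq_bcont u v r (fun z => (-1) * F2 z0 z) := bmul _ _ (cst (-1)) (F2c z0 zz).
have crem : sq_bcont u v r rem by move=> x y xy; exact: (ctsD (F2c w wz' x y xy) (c1 x y xy)).
have -> : sqint u v r (F2 w) - sqint u v r (F2 z0) = sqint u v r rem.
  by rewrite /rem (sqintD r0 (F2c w wz') c1) (sqintZ r0 _ (F2c z0 zz)) mulN1r.
apply: (@le_lt_trans _ _ (K * nrm h)); last first.
  move: w2; rewrite ltr_pdivlMr ?ltr_wpDl// => w2.
  by have := nrm_ge0 h; nra.
apply: bound => //; first exact: nrm_ge0.
move=> x y xy; have [n1 z1] := inv_le x y w xy wz'; have [n2 z2] := inv_le x y z0 xy zz.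
have -> : rem (pt x y) = f (pt x y) * ((pt x y - w)^-1 + (pt x y - z0)^-1) * (pt x y - w)^-1 * (pt x y - z0)^-1 * h.
  by rewrite /rem /F2 /F /h; field; rewrite z1 z2.
rewrite (nrmM _ h); apply: ler_wpM2r; first exact: nrm_ge0.
rewrite 3!nrmM; have M0 := normr_ge0 M.
do ?[apply: ler_pM; rewrite ?mulr_ge0 ?nrm_ge0//]; rewrite ?fM'//.
by apply: le_trans (nrmD _ _) _; lra.
Qed.

(** Needed because the transition functions of K are derivatives of coordinate changes. With F = f k
    from Cauchy's formula, f' = (F' - f k') / k, and F' and k' are continuous at the centre. *)
Lemma derive1_continuous f z0 : cnear z0 (fun z => derivable f z 1) ->
  {for z0, continuous (fun z => derive1 f z)}.
Proof.
move=> [d1 d10 fd1].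
have df0 : derivable f z0 1 by apply: fd1; rewrite subrr nrm0.
have [d2 d20 fd2] := (ctsCP _ _).1 (derivable_cts df0) _ ltr01.
pose r := Num.min d1 d2 / 3.
have r0 : 0 < r by apply: divr_gt0 => //; rewrite lt_min d10.
have r3 : 3 * r = Num.min d1 d2 by rewrite /r; field.
have [r1 r2] : 3 * r <= d1 /\ 3 * r <= d2 by rewrite r3 !ge_min !lexx orbT.
have zE : z0 = pt (complex.Re z0) (complex.Im z0) by case: (z0).
set u := complex.Re z0 in zE; set v := complex.Im z0 in zE.
have fd z : nrm (z - z0) <= 2 * r -> derivable f z 1 by move=> h; apply: fd1; lra.
have insq x y : sq_bdry u v r x y -> nrm (pt x y - z0) <= 2 * r.
  move=> [/andP[? ?] /andP[? ?] _]; apply: le_trans (nrm_le_ReIm _) _.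
  rewrite zE /pt; simpc => /=; have -> : 2 * r = r + r by ring.
  by apply: lerD; rewrite ler_norml; apply/andP; split; lra.
have fc : sq_bcont u v r f by move=> x y xy; apply: derivable_cts; apply: fd; exact: insq.
have c1c : sq_bcont u v r (fun=> 1 : C) by move=> x y _; exact: ctsC.
have fM x y : sq_bdry u v r x y -> nrm (f (pt x y)) <= nrm (f z0) + 1.
  move=> xy; have -> : f (pt x y) = f z0 + (f (pt x y) - f z0) by ring.
  apply: le_trans (nrmD _ _) _; rewrite lerD2l; apply/ltW/fd2.
  by have := insq x y xy; lra.
have oM x y : sq_bdry u v r x y -> nrm (1 : C) <= 1 by move=> _; rewrite nrm1.
have [G Gd Gc] := cauchy_kernel_deriv r0 fc fM.
have [H Hd Hc] := cauchy_kernel_deriv r0 c1c oM.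
rewrite -zE in Gd Gc Hd Hc.
pose F (w : C) : C := sqint u v r (fun z => f z * (z - w)^-1).
pose k (w : C) : C := sqint u v r (fun z => 1 * (z - w)^-1).
have {}Gd : cnear z0 (fun w => cdif F w (G w)) := Gd.
have {}Hd : cnear z0 (fun w => cdif k w (H w)) := Hd.
have kz0 : k z0 != 0.
  apply/eqP => E; have := sq_int_im_pos u v r0; rewrite -zE.
  have -> : (fun z => (z - z0)^-1) = (fun z => 1 * (z - z0)^-1) by apply/funext => z; rewrite mul1r.
  by rewrite -/(k z0) E ltxx.
have kc : {for z0, continuous k} by apply: derivable_cts; exact: cdif_derivable (cnear_at Hd).
have fk : cnear z0 (fun w => F w = f w * k w).
  exists (r / 2); first by lra.
  move=> w wz; have := @sq_cauchy _ u v r r0 f w; rewrite -zE; apply => //.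
  exact: ltW.
have kn : cnear z0 (fun w => k w != 0).
  have k2 : 0 < nrm (k z0) by rewrite nrm_gt0.
  apply: cnear_sub ((ctsCP _ _).1 kc _ k2) => w; apply: contraTneq => ->.
  by rewrite sub0r nrmN ltxx.
have fdn : cnear z0 (fun w => derivable f w 1) by exists d1.
have E : cnear z0 (fun w => derive1 f w = (G w + - (f w * H w)) * (k w)^-1).
  have := cnear_and (cnear_cnear fk) (cnear_and kn (cnear_and fdn (cnear_and Gd Hd))).
  apply: cnear_sub => w [fkw [kw [fw [Gw Hw]]]].
  have m1 := cdifM (derivable_cdif fw) Hw.
  have m2 := cdif_near fkw Gw.
  by apply: (mulIf kw); rewrite divfK// (cdif_uniq m2 m1); ring.
have fc0 := derivable_cts df0.
have rhs : {for z0, continuous (fun w => (G w + - (f w * H w)) * (k w)^-1)}.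
  exact: (ctsM (ctsD Gc (ctsN (ctsM fc0 Hc))) (@ctsV R k z0 kz0 kc)).
apply/ctsCP => e e0; apply: cnear_sub (cnear_and E ((ctsCP _ _).1 rhs e e0)) => w [-> h].
by rewrite (cnear_at E).
Qed.

End DerivativeContinuous.

(** * Interpolation and the residue functional *)

Section PolyAlgebra.
Variable K : fieldType.
Implicit Types (P F G : {poly K}) (r : K) (rs : seq K).

(** The coefficients of (P - P(r)) / (X - r). Written out as polynomials in r and the coefficients
    of P, they visibly depend holomorphically on a parameter. *)
Definition qcoef P i r : K := \sum_(j < (size P).-1 - i) P`_(i.+1 + j) * r ^+ j.
Definition quot_root P r : {poly K} := \poly_(i < (size P).-1) qcoef P i r.

Lemma quot_rootE P r : ('X - r%:P) * quot_root P r = P - P.[r]%:P.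
Proof.
have [n nE] : exists n, n = (size P).-1 by eexists.
have Pn k : (n < k)%N -> P`_k = 0.
  by move=> nk; apply: nth_default; move: nk; rewrite nE; case: (size P) => [|m].
have hP : P.[r] = \sum_(j < n.+1) P`_j * r ^+ j.
  rewrite nE horner_coef; case: (posnP (size P)) => [s0|/prednK -> //].
  by rewrite s0 big_ord0 big_ord1 nth_default ?mul0r// s0.
rewrite /quot_root /qcoef -nE.
apply/polyP => i; rewrite mulrBl coefB coefXM coefCM coefB coefC !coef_poly.
case: i => [|i] /=.
  rewrite sub0r hP big_ord_recl expr0 mulr1 opprD addrA subrr sub0r; congr (- _).
  case: ifP => n0; last first.
    by move/negbT: n0; rewrite -leqNgt leqn0 => /eqP ->; rewrite big_ord0 mulr0.
  rewrite subn0 mulr_sumr; apply: eq_bigr => j _.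
  by rewrite /bump /= !add1n exprS mulrCA.
rewrite subr0; case: ltnP => i1; last first.
  rewrite Pn//; have -> : (i.+1 < n)%N = false by lia.
  by rewrite mulr0 subr0.
have -> : (n - i = (n - i.+1).+1)%N by lia.
rewrite big_ord_recl /= expr0 mulr1 addn0.
have -> : \sum_(j < n - i.+1) P`_(i.+1 + bump 0 j) * r ^+ bump 0 j =
   r * \sum_(j < n - i.+1) P`_(i.+2 + j) * r ^+ j.
  rewrite mulr_sumr; apply: eq_bigr => j _; rewrite /bump /= add1n exprS mulrCA.
  by rewrite addnS.
case: ifP => i2; first by rewrite addrK.
have -> : (n - i.+1 = 0)%N by lia.
by rewrite big_ord0 mulr0 addr0 subr0.
Qed.

Lemma size_quot_root P r : (size (quot_root P r) <= (size P).-1)%N.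
Proof. exact: size_poly. Qed.

Lemma quot_root_root P r : root P r -> ('X - r%:P) * quot_root P r = P.
Proof. by move=> /rootP Pr; rewrite quot_rootE Pr subr0. Qed.

Lemma quot_root_self P r : root P r -> (quot_root P r).[r] = P^`().[r].
Proof.
move=> Pr; rewrite -[in RHS](quot_root_root Pr) derivM hornerD !hornerM derivXsubC.
by rewrite hornerXsubC subrr mul0r addr0 hornerC mul1r.
Qed.

Lemma quot_root_other P r s : root P r -> root P s -> s != r -> (quot_root P r).[s] = 0.
Proof.
move=> Pr /rootP Ps sr; have := congr1 (fun F => F.[s]) (quot_root_root Pr).
rewrite Ps hornerM hornerXsubC => /eqP; rewrite mulf_eq0 subr_eq0 (negPf sr) /=.
by move/eqP.
Qed.

Lemma qcoef_lead P r : P \is monic -> qcoef P (size P).-2 r = 1 \/ (size P <= 1)%N.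
Proof.
move=> Pm; have [s1|s1] := leqP (size P) 1; [by right|left].
rewrite /qcoef; have -> : ((size P).-1 - (size P).-2 = 1)%N by lia.
rewrite big_ord1 expr0 mulr1 addn0; move: Pm; rewrite monicE lead_coefE => /eqP <-.
by congr (P`_ _); lia.
Qed.

(** Lagrange interpolation: at a simple root r, [quot_root P r] takes the value P'(r), and it
    vanishes at the other roots. *)
Definition lagrange P rs (f : K -> K) : {poly K} :=
  \sum_(r <- rs) (f r / P^`().[r]) *: quot_root P r.

Lemma size_lagrange P rs f : (size (lagrange P rs f) <= (size P).-1)%N.
Proof.
apply: (big_ind (fun F => (size F <= (size P).-1)%N)).
- by rewrite size_poly0.
- by move=> F G sF sG; apply: leq_trans (size_polyD _ _) _; rewrite geq_max sF.
by move=> r _; apply: leq_trans (size_scale_leq _ _) _; exact: size_quot_root.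
Qed.

Lemma coef_lagrange P rs f i : (i < (size P).-1)%N ->
  (lagrange P rs f)`_i = \sum_(r <- rs) f r / P^`().[r] * qcoef P i r.
Proof.
by move=> ip; rewrite coef_sum; apply: eq_bigr => r _; rewrite coefZ coef_poly ip.
Qed.

Lemma horner_lagrange P rs f s : uniq rs -> all (root P) rs ->
  P^`().[s] != 0 -> s \in rs -> (lagrange P rs f).[s] = f s.
Proof.
move=> rsu /allP rsP Ps srs; rewrite horner_sum (bigD1_seq s)//= big1_seq ?addr0.
  by rewrite hornerZ quot_root_self ?divfK//; exact: rsP.
move=> r /andP[rs' rrs]; rewrite hornerZ quot_root_other ?mulr0//; try exact: rsP.
by rewrite eq_sym.
Qed.

Lemma poly_eq_on (F G : {poly K}) rs : uniq rs -> (size F <= size rs)%N ->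
  (size G <= size rs)%N -> (forall r, r \in rs -> F.[r] = G.[r]) -> F = G.
Proof.
move=> rsu sF sG FG; apply/eqP; rewrite -subr_eq0; apply/eqP.
apply: (roots_geq_poly_eq0 (rs := rs)) => //.
  by apply/allP => r /FG; rewrite rootE hornerD hornerN => ->; rewrite subrr.
by apply: leq_trans (size_polyD _ _) _; rewrite size_polyN geq_max sF.
Qed.

(* The sum of F / P^`() over the roots of P, when these are simple (residE). *)
Definition resid P F : K := (F %% P)`_(size P).-2.

(** The remainder F mod P is the interpolation polynomial of F at the roots, and each
    [quot_root P r] has leading coefficient 1. *)
Lemma residE P rs F : P \is monic -> uniq rs -> all (root P) rs -> size P = (size rs).+1 ->
  (0 < size rs)%N -> (forall r, r \in rs -> P^`().[r] != 0) ->
  resid P F = \sum_(r <- rs) F.[r] / P^`().[r].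
Proof.
move=> Pm rsu rsP sP s0 P'.
have -> : resid P F = (lagrange P rs (fun r => F.[r]))`_(size P).-2.
  rewrite /resid; suff -> : F %% P = lagrange P rs (fun r => F.[r]) by [].
  apply: (poly_eq_on rsu).
  - by rewrite -ltnS -sP ltn_modp monic_neq0.
  - by apply: leq_trans (size_lagrange _ _ _) _; rewrite sP.
  move=> r rrs; rewrite horner_lagrange//; last exact: P'.
  rewrite [in RHS](divp_eq F P) hornerD hornerM.
  by have /rootP -> := allP rsP r rrs; rewrite mulr0 add0r.
rewrite coef_lagrange; last by rewrite sP /=; lia.
apply: eq_bigr => r _; have [-> |] := qcoef_lead r Pm; first by rewrite mulr1.
by rewrite sP; lia.
Qed.

Lemma residD P F G : resid P (F + G) = resid P F + resid P G.
Proof. by rewrite /resid modpD coefD. Qed.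

Lemma residZ P k F : resid P (k *: F) = k * resid P F.
Proof. by rewrite /resid modpZl coefZ. Qed.

Lemma resid0 P : resid P 0 = 0. Proof. by rewrite /resid mod0p coef0. Qed.

Lemma resid_sum (I : Type) P (s : seq I) (c : pred I) (F : I -> {poly K}) :
  resid P (\sum_(i <- s | c i) F i) = \sum_(i <- s | c i) resid P (F i).
Proof. exact: (big_morph _ (residD P) (resid0 P)). Qed.

Lemma resid_mul P F : resid P (P * F) = 0.
Proof. by rewrite /resid modp_mulr coef0. Qed.

Lemma resid_small P F : (size F < size P)%N -> resid P F = F`_(size P).-2.
Proof. by move=> sF; rewrite /resid modp_small. Qed.

Lemma residXn_small P k : (k < (size P).-2)%N -> resid P 'X^k = 0.
Proof.
move=> kP; rewrite resid_small ?size_polyXn; last by lia.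
by rewrite coefXn; case: eqP => //; lia.
Qed.

(** Multiplying a division with remainder by X - r again gives one, and the top coefficient of the
    remainder is unchanged. *)
Lemma resid_XsubC P r F : P \is monic ->
  resid (('X - r%:P) * P) (('X - r%:P) * F) = resid P F.
Proof.
move=> Pm; have P0 := monic_neq0 Pm.
have x0 : 'X - r%:P != 0 by rewrite polyXsubC_eq0.
have sm : (size (modp F P) < size P)%N by rewrite ltn_modp.
have -> : ('X - r%:P) * F = (divp F P) * (('X - r%:P) * P) + ('X - r%:P) * (F %% P).
  by rewrite {1}(divp_eq F P); ring.
rewrite /resid modp_addl_mul_small; last first.
  have [->|G0] := eqVneq (F %% P) 0; first by rewrite mulr0 size_poly0 size_poly_gt0 mulf_neq0.
  by rewrite !size_mul// size_XsubC /=.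
rewrite size_mul// size_XsubC /=.
move: (F %% P) sm => G sG; have [n nE] : exists n, n = size P by eexists.
rewrite -nE; rewrite -nE in sG.
rewrite mulrBl coefB coefXM coefCM [X in _ - r * X]nth_default ?mulr0 ?subr0; last first.
  by rewrite -ltnS; case: n sG {nE}.
case: eqP => // n1; rewrite nth_default//.
by move: sG n1; case: n {nE} => [|[|n]]//; case: (size G).
Qed.

(** * Complete homogeneous symmetric polynomials as residues *)

Section CompleteSymmetric.
Variables (p : nat) (rs : seq K).
Hypothesis prs : size rs = p.

(** The complete homogeneous symmetric polynomial of degree u in the entries of [rs] from position m
    on; the tails allow a recursion on the number of variables. *)
Definition csym_from (u m : nat) : K :=
  \sum_(t : u.-tuple 'I_p | sorted (fun k l : 'I_p => (k <= l)%N) t &&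
                            all (fun k : 'I_p => (m <= k)%N) t) \prod_(k <- t) rs`_k.

Definition tailprod m : {poly K} := \prod_(r <- drop m rs) ('X - r%:P).

Lemma csym_from0 m : csym_from 0 m = 1.
Proof.
rewrite /csym_from (big_pred1 [tuple]) ?big_nil// => t /=.
by rewrite tuple0 /= eqxx.
Qed.

Lemma csym_from_end u : csym_from u.+1 p = 0.
Proof.
apply: big1 => t /andP[_]; case/tupleP: t => k t /= /andP[pk _].
by have := ltn_ord k; rewrite ltnNge pk.
Qed.

(** A sorted monomial either begins with index m, and dropping that entry lowers the degree, or it
    uses larger indices only. *)
Lemma csym_fromS u m : (m < p)%N ->
  csym_from u.+1 m = rs`_m * csym_from u m + csym_from u.+1 m.+1.
Proof.
move=> mp; pose om := Ordinal mp.
have tr : transitive (fun k l : 'I_p => (k <= l)%N) by move=> k l q; exact: leq_trans.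
rewrite {1}/csym_from (bigID (fun t => thead t == om)) /=; congr (_ + _).
  rewrite (reindex_onto (fun t : u.-tuple 'I_p => [tuple of om :: t]) (fun t => [tuple of behead t])) /=; last first.
    move=> t /andP[_ /eqP th]; apply: val_inj => /=.
    by case/tupleP: t th => k t /=; rewrite theadE => ->.
  rewrite mulr_sumr; apply: eq_big => [t|t _]; last by rewrite big_cons.
  rewrite theadE eqxx andbT leqnn /=.
  rewrite (_ : (_ == t) = true) ?andbT; last by apply/eqP/val_inj.
  rewrite path_sortedE//; case: (all _ t); rewrite ?andbF ?andbT//.
apply: eq_bigl => t; case/tupleP: t => k t /=; rewrite theadE.
rewrite !path_sortedE//.
have [kt|] := boolP (all (fun l : 'I_p => (k <= l)%N) t) => //=.
case: (sorted _ t) => //=; rewrite -val_eqE /=.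
case: (ltngtP m k) => [mk|km|mk] //=; last by rewrite andbF.
have mS : all (fun l : 'I_p => (m < l)%N) t.
  by apply: sub_all kt => l; exact: leq_trans.
by rewrite mS andbT; apply/allP => l /(allP mS); exact: ltnW.
Qed.

Lemma tailprodS m : (m < p)%N -> tailprod m = ('X - (rs`_m)%:P) * tailprod m.+1.
Proof. by move=> mp; rewrite /tailprod (drop_nth 0) ?prs// big_cons. Qed.

Lemma tailprod_monic m : tailprod m \is monic.
Proof. exact: monic_prod_XsubC. Qed.

Lemma size_tailprod m : size (tailprod m) = (p - m).+1.
Proof. by rewrite size_prod_XsubC size_drop prs. Qed.

(** Both sides obey the recursion of [csym_fromS], by X^(k+1) = (X - r) X^k + r X^k and
    [resid_XsubC]. For u = 0 and m = p the modulus is 1, the residue 0 and the polynomial 1;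
    positivity excludes this case. *)
Lemma csym_fromE u m : (m <= p)%N -> (0 < u + (p - m))%N ->
  resid (tailprod m) 'X^((u + (p - m)).-1) = csym_from u m.
Proof.
elim: u m => [|u IHu] m mp.
  rewrite add0n => d0; rewrite csym_from0 resid_small; last first.
    by rewrite size_polyXn size_tailprod; lia.
  by rewrite size_tailprod coefXn /= eqxx.
move=> _; rewrite addSn /=; move dE : (p - m)%N => d.
elim: d m mp dE => [|d IHd] m mp dE.
  have -> : m = p by lia.
  rewrite csym_from_end /tailprod -prs drop_size big_nil /resid modp1 coef0//.
have mp' : (m < p)%N by lia.
rewrite csym_fromS// -IHu//; last by lia.
have -> : 'X^(u + d.+1) = ('X - (rs`_m)%:P) * 'X^(u + d) + rs`_m *: 'X^(u + d) :> {poly K}.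
  by rewrite mulrBl -exprS addnS -mul_polyC subrK.
rewrite residD residZ addrC; congr (_ * _ + _).
  by congr (resid _ 'X^_); rewrite dE addnS.
rewrite tailprodS// resid_XsubC ?tailprod_monic//.
by apply: IHd => //; lia.
Qed.

End CompleteSymmetric.

End PolyAlgebra.

(** * Families of polynomials over a disc *)

Section Limits.
Context {R : realType}.
Local Notation C := (Cx R).

Definition cnear2 (z x : C) (P : C -> C -> Prop) := exists2 d : R, 0 < d &
  forall w y, nrm (w - z) < d -> nrm (y - x) < d -> P w y.

Lemma cnear2P (z x : C) (P : C -> C -> Prop) :
  (\forall y \near (z, x), P y.1 y.2) <-> cnear2 z x P.
Proof.
split.
  move=> [[A B] /= [/cnearP [d d0 dA] /cnearP [e e0 eB]] AB].
  exists (Num.min d e); first by rewrite lt_min d0.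
  move=> w y; rewrite !lt_min => /andP[wd _] /andP[_ ye].
  by apply: (AB (w, y)); split; [exact: dA|exact: eB].
move=> [d d0 dP]; exists ([set w | nrm (w - z) < d], [set y | nrm (y - x) < d]).
  by split; apply/cnearP; exists d.
by move=> [w y] [/= wd yd]; exact: dP.
Qed.

Lemma cnear2_and z x (P Q : C -> C -> Prop) : cnear2 z x P -> cnear2 z x Q ->
  cnear2 z x (fun w y => P w y /\ Q w y).
Proof.
move=> [d d0 dP] [e e0 eQ]; exists (Num.min d e); first by rewrite lt_min d0.
move=> w y; rewrite !lt_min => /andP[wd we] /andP[yd ye]; split; [exact: dP|exact: eQ].
Qed.

Lemma cnear2_sub z x (P Q : C -> C -> Prop) : (forall w y, P w y -> Q w y) ->
  cnear2 z x P -> cnear2 z x Q.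
Proof. by move=> PQ [d d0 dP]; exists d => // w y wd yd; apply: PQ; exact: dP. Qed.

Lemma cnear_cnear2 z x (P : C -> Prop) : cnear z P -> cnear2 z x (fun w _ => P w).
Proof. by move=> [d d0 dP]; exists d => // w y wd _; exact: dP. Qed.

Lemma cnear2_at z x P : cnear2 z x P -> P z x.
Proof. by move=> [d d0]; apply; rewrite subrr nrm0. Qed.

Lemma cnear2_curve z (g : C -> C) (P : C -> C -> Prop) : {for z, continuous g} ->
  cnear2 z (g z) P -> cnear z (fun w => P w (g w)).
Proof.
move=> /cvgCP gc [d d0 dP]; have /cnearP[e e0 eP] := gc d d0.
exists (Num.min d e); first by rewrite lt_min d0.
by move=> w; rewrite lt_min => /andP[wd we]; apply: dP => //; exact: eP.
Qed.

Definition cts2 (f : C -> C -> C) z x :=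
  forall e : R, 0 < e -> cnear2 z x (fun w y => nrm (f w y - f z x) < e).

Lemma cts2P f z x : cts2 f z x <-> {for (z, x), continuous (fun y : (C * C)%type => f y.1 y.2)}.
Proof.
split=> [H|/cvgCP H e e0]; last by apply/cnear2P; exact: H.
by apply/cvgCP => e e0; have /cnear2P := H e e0.
Qed.

Lemma cts2C (k : C) z x : cts2 (fun _ _ => k) z x.
Proof. by move=> e e0; exists 1 => // w y _ _; rewrite subrr nrm0. Qed.
Lemma cts2_fst (f : C -> C) z x : {for z, continuous f} -> cts2 (fun w _ => f w) z x.
Proof. by move=> /cvgCP fc e e0; apply: cnear_cnear2; apply/cnearP; exact: fc. Qed.
Lemma cts2_snd z x : cts2 (fun _ y => y) z x.
Proof. by move=> e e0; exists e. Qed.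
Lemma cts2D f g z x : cts2 f z x -> cts2 g z x -> cts2 (fun w y => f w y + g w y) z x.
Proof.
move=> /cts2P fc /cts2P gc; apply/cts2P.
exact: (@cvgD _ C _ _ _ (fun y : (C * C)%type => f y.1 y.2) (fun y : (C * C)%type => g y.1 y.2) _ _ fc gc).
Qed.
Lemma cts2M f g z x : cts2 f z x -> cts2 g z x -> cts2 (fun w y => f w y * g w y) z x.
Proof.
move=> /cts2P fc /cts2P gc; apply/cts2P.
exact: (@cvgM C _ _ _ (fun y : (C * C)%type => f y.1 y.2) (fun y : (C * C)%type => g y.1 y.2) _ _ fc gc).
Qed.
Lemma cts2X f n z x : cts2 f z x -> cts2 (fun w y => f w y ^+ n) z x.
Proof.
move=> fc; elim: n => [|n IH].
  by rewrite (_ : (fun w y => f w y ^+ 0) = fun _ _ => 1)//; exact: cts2C.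
rewrite (_ : (fun w y => f w y ^+ n.+1) = fun w y => f w y * f w y ^+ n).
  exact: cts2M.
by apply/funext => w; apply/funext => y; rewrite exprS.
Qed.
Lemma cts2_sum (I : Type) (s : seq I) (f : I -> C -> C -> C) z x :
  (forall i, cts2 (f i) z x) -> cts2 (fun w y => \sum_(i <- s) f i w y) z x.
Proof.
move=> fc; elim: s => [|i s IH].
  rewrite (_ : (fun w y => \sum_(i <- [::]) f i w y) = fun _ _ => 0); first exact: cts2C.
  by apply/funext => w; apply/funext => y; rewrite big_nil.
rewrite (_ : (fun w y => \sum_(i <- i :: s) f i w y) =
   fun w y => f i w y + \sum_(i <- s) f i w y); first exact: cts2D.
by apply/funext => w; apply/funext => y; rewrite big_cons.
Qed.

Lemma cts2_bounded f z x : cts2 f z x -> cnear2 z x (fun w y => nrm (f w y) <= nrm (f z x) + 1).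
Proof.
move=> fc; apply: cnear2_sub (fc 1 ltr01) => w y h.
have -> : f w y = f z x + (f w y - f z x) by ring.
by apply: le_trans (nrmD _ _) _; rewrite lerD2l ltW.
Qed.

Lemma cts2_away f z x : cts2 f z x -> f z x != 0 ->
  cnear2 z x (fun w y => nrm (f z x) / 2 <= nrm (f w y)).
Proof.
move=> fc; rewrite -nrm_gt0 => f0.
have f2 : 0 < nrm (f z x) / 2 by lra.
apply: cnear2_sub (fc _ f2) => w y h.
have := nrmBD (f w y) (f w y - f z x); rewrite (_ : f w y - _ = f z x); [lra|ring].
Qed.

Lemma derX (f : C -> C) n (z : C) : derivable f z 1 -> derivable (fun w => f w ^+ n) z 1.
Proof.
move=> fd; elim: n => [|n IH].
  exact: (derC 1 z).
have -> : (fun w => f w ^+ n.+1) = fun w => f w * f w ^+ n.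
  by apply/funext => w; rewrite exprS.
exact: (@derM R f (fun w => f w ^+ n) z fd IH).
Qed.

Lemma der_sum (I : Type) (s : seq I) (f : I -> C -> C) (z : C) :
  (forall i, derivable (f i) z 1) -> derivable (fun w => \sum_(i <- s) f i w) z 1.
Proof.
move=> fd; elim: s => [|i s IH].
  have -> : (fun w => \sum_(i <- [::]) f i w) = fun=> 0 by apply/funext => w; rewrite big_nil.
  exact: (derC 0 z).
have -> : (fun w => \sum_(i <- i :: s) f i w) = fun w => f i w + \sum_(i <- s) f i w.
  by apply/funext => w; rewrite big_cons.
exact: (@derD R (f i) (fun w => \sum_(i <- s) f i w) z (fd i) IH).
Qed.

End Limits.

Lemma pnear_all (R : realType) (z : Cx R) (T : eqType) (s : seq T) (P : T -> Cx R -> Prop) :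
  (forall r, r \in s -> cnear z (P r)) -> cnear z (fun w => forall r, r \in s -> P r w).
Proof.
elim: s => [_|r s IH H]; first by exists 1.
have H1 := H r (mem_head _ _).
have H2 := IH (fun r' rs => H r' (mem_behead (s := r :: s) rs)).
apply: cnear_sub (cnear_and H1 H2) => w [w1 w2] r'.
by rewrite inE => /predU1P[->|/w2].
Qed.

Lemma nrm_sum (R : realType) (I : Type) (s : seq I) (f : I -> Cx R) :
  nrm (\sum_(i <- s) f i) <= \sum_(i <- s) nrm (f i).
Proof.
elim: s => [|i s IH]; first by rewrite !big_nil nrm0.
by rewrite !big_cons; apply: le_trans (nrmD _ _) _; rewrite lerD2l.
Qed.

Section SpectralPolynomial.
Context {R : realType}.
Local Notation C := (Cx R).
Variables (p : nat) (al : nat -> C -> C).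
Hypothesis al0 : forall z, al 0%N z = 1.

(** This is [spoly] read in a chart: [al k] will be the coefficient a_k as a function of the
    coordinate. *)
Definition fpoly (z : C) : {poly C} := \sum_(0 <= k < p.+1) al k z *: 'X^(p - k).

Lemma coef_fpoly z i : (fpoly z)`_i = if (i <= p)%N then al (p - i)%N z else 0.
Proof.
rewrite /fpoly big_mkord coef_sum; case: leqP => ip.
  rewrite (bigD1 (inord (p - i))) //= big1 ?addr0.
    rewrite coefZ coefXn inordK ?ltnS ?leq_subr// subKn// eqxx mulr1//.
  move=> k ki; rewrite coefZ coefXn; case: eqP => [ik|]; last by rewrite mulr0.
  by case/eqP: ki; apply: val_inj; rewrite /= inordK ?ltnS ?leq_subr// ik subKn// -ltnS.
apply: big1 => k _; rewrite coefZ coefXn; case: eqP => [ik|]; last by rewrite mulr0.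
by move: ip; rewrite ik ltnNge leq_subr.
Qed.

Lemma size_fpoly z : size (fpoly z) = p.+1.
Proof.
apply/anti_leq/andP; split.
  by apply/leq_sizeP => i ip; rewrite coef_fpoly leqNgt ip.
rewrite ltnNge; apply/negP => /leq_sizeP/(_ p (leqnn p))/eqP.
by rewrite coef_fpoly leqnn subnn al0 oner_eq0.
Qed.

Lemma monic_fpoly z : fpoly z \is monic.
Proof. by rewrite monicE lead_coefE size_fpoly /= coef_fpoly leqnn subnn al0. Qed.

Lemma horner_fpoly z x : (fpoly z).[x] = \sum_(k < p.+1) al k z * x ^+ (p - k).
Proof. by rewrite /fpoly big_mkord horner_sum; apply: eq_bigr => k _; rewrite hornerZ hornerXn. Qed.

Lemma deriv_fpoly z x : (fpoly z)^`().[x] = \sum_(k < p.+1) al k z * (x ^+ (p - k).-1 *+ (p - k)).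
Proof.
rewrite /fpoly big_mkord raddf_sum horner_sum; apply: eq_bigr => k _.
by rewrite /= derivZ hornerZ derivXn hornerMn hornerXn.
Qed.

Definition froots z : seq C := sval (closed_field_poly_normal (fpoly z)).

Lemma frootsE z : fpoly z = \prod_(r <- froots z) ('X - r%:P).
Proof.
rewrite /froots; case: closed_field_poly_normal => rs /= E.
by rewrite {1}E (monicP (monic_fpoly z)) scale1r.
Qed.

Lemma size_froots z : size (froots z) = p.
Proof. by have := size_fpoly z; rewrite frootsE size_prod_XsubC => -[]. Qed.

Lemma mem_froots z x : (x \in froots z) = root (fpoly z) x.
Proof. by rewrite frootsE root_prod_XsubC. Qed.

Lemma horner_froots z x : (fpoly z).[x] = \prod_(r <- froots z) (x - r).
Proof. by rewrite frootsE horner_prod; apply: eq_bigr => r _; rewrite hornerXsubC. Qed.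

Definition simple_fibre z := forall x, root (fpoly z) x -> (fpoly z)^`().[x] != 0.

Lemma simple_fibre_uniq z : simple_fibre z -> uniq (froots z).
Proof.
move=> gz; apply: contraT => /(uniqPn 0)[i [j [ij js E]]].
have xr : root (fpoly z) (nth 0 (froots z) i) by rewrite -mem_froots mem_nth// (ltn_trans ij).
have := gz _ xr; set x := nth 0 (froots z) i in E xr *.
have Exx := quot_root_root xr.
rewrite -(quot_root_self xr).
suff -> : (quot_root (fpoly z) x).[x] = 0 by rewrite eqxx.
have x0 : 'X - x%:P != 0 by rewrite polyXsubC_eq0.
(* Cancelling the factor of the entry at j leaves the factor X - x of the equal entry at i in the
   quotient. *)
move: Exx; rewrite frootsE -[froots z](cat_take_drop j) big_cat /= (drop_nth 0 js) big_cons -E -/x.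
have : x \in take j (froots z) by rewrite /x -(nth_take 0 ij) mem_nth// size_take js.
move=> xin; rewrite (perm_big _ (perm_to_rem xin)) /= big_cons /= -mulrA => /(mulfI x0) ->.
by rewrite mulrCA hornerM hornerXsubC subrr mul0r.
Qed.

Section At.
Variable z0 : C.
Hypothesis ald : forall k, (k <= p)%N -> derivable (al k) z0 1.

Lemma al_cts (k : 'I_p.+1) : {for z0, continuous (al k)}.
Proof. by apply: derivable_cts; apply: ald; rewrite -ltnS. Qed.

Lemma cts2_fpoly x : cts2 (fun z y => (fpoly z).[y]) z0 x.
Proof.
rewrite (_ : (fun z y => _) = fun z y => \sum_(k < p.+1) al k z * y ^+ (p - k)).
  apply: cts2_sum => k; apply: (@cts2M _ (fun z _ => al k z) (fun _ y => y ^+ (p - k))).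
    exact/cts2_fst/al_cts.
  exact/(@cts2X _ (fun _ y => y))/cts2_snd.
by apply/funext => z; apply/funext => y; rewrite horner_fpoly.
Qed.

Lemma cts2_dfpoly x : cts2 (fun z y => (fpoly z)^`().[y]) z0 x.
Proof.
rewrite (_ : (fun z y => _) = fun z y => \sum_(k < p.+1) al k z * ((p - k)%:R * y ^+ (p - k).-1)).
  apply: cts2_sum => k; apply: (@cts2M _ (fun z _ => al k z) (fun _ y => (p - k)%:R * y ^+ (p - k).-1)).
    exact/cts2_fst/al_cts.
  apply: (@cts2M _ (fun _ _ => (p - k)%:R) (fun _ y => y ^+ (p - k).-1)); first exact: cts2C.
  exact/(@cts2X _ (fun _ y => y))/cts2_snd.
apply/funext => z; apply/funext => y; rewrite deriv_fpoly.
by apply: eq_bigr => k _; rewrite mulr_natl.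
Qed.

Lemma prod_ge_pow (s : seq C) (x : C) (e : R) : 0 <= e -> (forall r, r \in s -> e <= nrm (x - r)) ->
  e ^+ size s <= nrm (\prod_(r <- s) (x - r)).
Proof.
move=> e0; elim: s => [|r s IH] H; first by rewrite big_nil nrm1.
rewrite big_cons nrmM /= exprS; apply: ler_pM => //; first exact: exprn_ge0.
  exact: H (mem_head _ _).
by apply: IH => r' rs; apply: H; rewrite inE rs orbT.
Qed.

(** Old roots persist: the norm of P_z(x) is the product of the distances from x to the roots of
    P_z, so a small value forces a root near x. *)
Lemma root_near x (e : R) : (0 < p)%N -> root (fpoly z0) x -> 0 < e ->
  cnear z0 (fun z => exists2 y, root (fpoly z) y & nrm (y - x) < e).
Proof.
move=> p0 /rootP xr e0.
have ep : 0 < e ^+ p by exact: exprn_gt0.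
have [d d0 dP] := cts2_fpoly x ep; exists d => // z zd.
have := dP z x zd; rewrite subrr nrm0 => /(_ d0); rewrite xr subr0 => sm.
apply: contrapT => nex; move: sm; rewrite ltNge horner_froots -[X in e ^+ X](size_froots z).
rewrite prod_ge_pow ?ltW// => r; rewrite mem_froots => rr.
rewrite leNgt; apply/negP => xe; apply: nex; exists r => //; by rewrite nrmB.
Qed.

(** Cauchy's bound for the roots, made uniform near z0 by allowing each coefficient to grow by 1. *)
Lemma roots_bounded : exists2 B : R, 1 <= B &
  cnear z0 (fun z => forall x, root (fpoly z) x -> nrm x <= B).
Proof.
pose M := \sum_(k < p) (nrm (al k.+1 z0) + 1).
exists (1 + M).
  rewrite lerDl; apply: sumr_ge0 => k _; by rewrite addr_ge0// nrm_ge0.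
have : cnear z0 (fun z => forall k, k \in index_enum 'I_p.+1 -> nrm (al k z) <= nrm (al k z0) + 1).
  apply: pnear_all => k _.
  have := cts2_bounded (@cts2_fst _ _ _ 0 (@al_cts k)) => -[d d0 dP].
  by exists d => // w wd; apply: (dP w 0) => //; rewrite subrr nrm0.
apply: cnear_sub => z H x /rootP xr.
rewrite leNgt; apply/negP => xM.
have x1 : 1 <= nrm x.
  apply: ltW; apply: le_lt_trans xM; rewrite lerDl; apply: sumr_ge0 => k _.
  by rewrite addr_ge0// nrm_ge0.
move: xr; rewrite horner_fpoly big_ord_recl al0 mul1r subn0 => /eqP.
rewrite addr_eq0 => /eqP E.
have [p0|p0] := posnP p.
  by move/eqP: E; rewrite p0 in H M xM *; rewrite big_ord0 oppr0 expr0 oner_eq0.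
have : nrm (x ^+ p) <= M * nrm x ^+ p.-1.
  rewrite E nrmN; apply: le_trans (nrm_sum _ _) _; rewrite mulr_suml.
  apply: ler_sum => k _; rewrite nrmM nrmX; apply: ler_pM; rewrite ?nrm_ge0 ?exprn_ge0 ?nrm_ge0//.
    exact: (H (lift ord0 k)).
  by apply: ler_weXn2l => //; rewrite /= /bump; lia.
rewrite nrmX -{1}(prednK p0) exprS ler_pM2r; last by apply: exprn_gt0; exact: lt_le_trans x1.
by move=> h; move: xM; rewrite ltNge (le_trans h)// lerDr.
Qed.

(** New roots come from old ones: at a root y of P_z the value P_z0(y) equals P_z0(y) - P_z(y),
    which is small since y is bounded. It is also a product of distances to the old roots. *)
Lemma roots_near_old (e : R) : (0 < p)%N -> 0 < e ->
  cnear z0 (fun z => forall y, root (fpoly z) y ->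
    exists2 x, root (fpoly z0) x & nrm (y - x) < e).
Proof.
move=> p0 e0; have [B B1 Bn] := roots_bounded.
have ep : 0 < e ^+ p by exact: exprn_gt0.
(* If each of the p + 1 coefficients moves by less than e^p / Q, the value at a root moves by less
   than e^p. *)
pose Q := p.+1%:R * B ^+ p.
have Q0 : 0 < Q by rewrite mulr_gt0 ?ltr0Sn// exprn_gt0//; lra.
have e1 : 0 < e ^+ p / Q by exact: divr_gt0.
have : cnear z0 (fun z => forall k, k \in index_enum 'I_p.+1 -> nrm (al k z - al k z0) < e ^+ p / Q).
  by apply: pnear_all => k _; apply/cnearP; exact: (cvgCP _ _ _).1 (@al_cts k) _ e1.
move=> /(cnear_and Bn); apply: cnear_sub => z [zB H] y yr.
apply: contrapT => nex.
have : e ^+ p <= nrm (fpoly z0).[y].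
  rewrite horner_froots -[X in e ^+ X](size_froots z0); apply: prod_ge_pow; first exact: ltW.
  move=> r; rewrite mem_froots => rr; rewrite leNgt; apply/negP => xe.
  by apply: nex; exists r.
apply/negP; rewrite -ltNge.
have -> : (fpoly z0).[y] = - \sum_(k < p.+1) (al k z - al k z0) * y ^+ (p - k).
  have := rootP yr; rewrite !horner_fpoly => E.
  apply/eqP; rewrite -subr_eq0 opprK -big_split /=; apply/eqP; rewrite -[RHS]E.
  by apply: eq_bigr => k _; ring.
rewrite nrmN; apply: le_lt_trans (nrm_sum _ _) _.
have : \sum_(k < p.+1) nrm ((al k z - al k z0) * y ^+ (p - k)) < \sum_(k < p.+1) (e ^+ p / Q * B ^+ p).
  apply: ltr_sum; first by apply/hasP; exists ord0; rewrite ?mem_index_enum.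
  move=> k _; rewrite nrmM nrmX.
  have B0 : 0 < B ^+ p by apply: exprn_gt0; lra.
  apply: (@le_lt_trans _ _ (nrm (al k z - al k z0) * B ^+ p)).
    apply: ler_wpM2l; first exact: nrm_ge0.
    apply: (@le_trans _ _ (B ^+ (p - k))).
      by apply: lerXn2r; rewrite ?nnegrE ?nrm_ge0//; [lra|exact: zB].
    by apply: ler_weXn2l => //; exact: leq_subr.
  by rewrite ltr_pM2r//; apply: H; exact: mem_index_enum.
rewrite sumr_const card_ord -mulr_natl => /lt_le_trans; apply.
by rewrite mulrCA -/Q divfK// lt0r_neq0.
Qed.

(** Properness of the projection: the fibre is finite and no root escapes, so what holds near each
    point of a fibre holds on all nearby fibres. *)
Lemma fibre_tube (Q : C -> C -> Prop) : (0 < p)%N ->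
  (forall x, root (fpoly z0) x -> cnear2 z0 x (fun z y => root (fpoly z) y -> Q z y)) ->
  cnear z0 (fun z => forall y, root (fpoly z) y -> Q z y).
Proof.
move=> p0 H.
have [d d0 dP] : exists2 d : R, 0 < d & forall x z y, x \in froots z0 ->
    nrm (z - z0) < d -> nrm (y - x) < d -> root (fpoly z) y -> Q z y.
  have {}H x : x \in froots z0 -> cnear2 z0 x (fun z y => root (fpoly z) y -> Q z y).
    by rewrite mem_froots; exact: H.
  elim: (froots z0) H => [|r s IH] H; first by exists 1.
  have [d1 d10 d1P] := H r (mem_head _ _).
  have [d2 d20 d2P] := IH (fun x xs => H x (mem_behead (s := r :: s) xs)).
  exists (Num.min d1 d2); first by rewrite lt_min d10.
  move=> x z y; rewrite inE !lt_min => /predU1P[->|xs] /andP[z1 z2] /andP[y1 y2].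
    exact: d1P.
  exact: d2P xs _ _.
have [d' d'0 d'P] := roots_near_old p0 d0.
exists (Num.min d d'); first by rewrite lt_min d0.
move=> z; rewrite lt_min => /andP[z1 z2] y yr.
have [x xr yx] := d'P z z2 y yr.
by apply: (dP x) => //; rewrite mem_froots.
Qed.

End At.
End SpectralPolynomial.

(** * Fibres near a branch point *)

Section BranchPoints.
Context {R : realType}.
Local Notation C := (Cx R).
Variables (p : nat) (al : nat -> C -> C).
Hypothesis al0 : forall z, al 0%N z = 1.
Hypothesis p0 : (0 < p)%N.
Local Notation P := (fpoly p al).

(** Caratheodory quotients of the coefficients add up to continuous quotients of P and of dP/dx;
    [A z0] is the partial derivative in z. *)
Lemma fpoly_taylor z0 : (forall k, (k <= p)%N -> derivable (al k) z0 1) ->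
  exists A A' : C -> C -> C, [/\ forall x, cts2 A z0 x, forall x, cts2 A' z0 x,
    forall z x, (P z).[x] = (P z0).[x] + (z - z0) * A z x,
    forall z x, (P z)^`().[x] = (P z0)^`().[x] + (z - z0) * A' z x &
    forall x, A z0 x = \sum_(k < p.+1) derive1 (al k) z0 * x ^+ (p - k)].
Proof.
move=> ald.
have H (k : 'I_p.+1) : exists q, [/\ forall z, al k z = al k z0 + (z - z0) * q z, q z0 = derive1 (al k) z0 &
    {for z0, continuous q}].
  by apply: dquot_cts; apply: ald; rewrite -ltnS.
have [q qP] := boolp.choice H.
exists (fun z x => \sum_(k < p.+1) q k z * x ^+ (p - k)).
exists (fun z x => \sum_(k < p.+1) q k z * ((p - k)%:R * x ^+ (p - k).-1)).
split.
- move=> x; apply: cts2_sum => k; apply: (@cts2M _ (fun z _ => q k z) (fun _ y => y ^+ (p - k))).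
    by apply: cts2_fst; case: (qP k).
  exact/(@cts2X _ (fun _ y => y))/cts2_snd.
- move=> x; apply: cts2_sum => k.
  apply: (@cts2M _ (fun z _ => q k z) (fun _ y => (p - k)%:R * y ^+ (p - k).-1)).
    by apply: cts2_fst; case: (qP k).
  apply: (@cts2M _ (fun _ _ => (p - k)%:R) (fun _ y => y ^+ (p - k).-1)); first exact: cts2C.
  exact/(@cts2X _ (fun _ y => y))/cts2_snd.
- move=> z x; rewrite !horner_fpoly mulr_sumr -big_split /=; apply: eq_bigr => k _.
  by have [-> _ _] := qP k; ring.
- move=> z x; rewrite !deriv_fpoly mulr_sumr -big_split /=; apply: eq_bigr => k _.
  by have [-> _ _] := qP k; rewrite -[_ *+ (p - k)]mulr_natl; ring.
- by move=> x; apply: eq_bigr => k _; have [_ -> _] := qP k.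
Qed.

Lemma cts2_horner (F : {poly C}) z0 x : cts2 (fun _ y => F.[y]) z0 x.
Proof.
rewrite (_ : (fun _ y => F.[y]) = fun _ y => \sum_(i < size F) F`_i * y ^+ i); last first.
  by apply/funext => z; apply/funext => y; rewrite horner_coef.
apply: cts2_sum => i; apply: (@cts2M _ (fun _ _ => F`_i) (fun _ y => y ^+ i)).
  exact: cts2C.
exact/(@cts2X _ (fun _ y => y))/cts2_snd.
Qed.

(* Smoothness of the curve: over a branch point the base coordinate z vanishes to
   higher order than the vertical derivative of the equation. *)
Lemma branch_estimate z0 x0 : (forall k, (k <= p)%N -> derivable (al k) z0 1) ->
  root (P z0) x0 ->
  ((P z0)^`().[x0] = 0 -> \sum_(k < p.+1) derive1 (al k) z0 * x0 ^+ (p - k) != 0) ->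
  forall e : R, 0 < e ->
  cnear2 z0 x0 (fun z x => root (P z) x -> nrm (z - z0) <= e * nrm (P z)^`().[x]).
Proof.
move=> ald x0r reg e e0.
have [/eqP P'0|P'0] := boolP ((P z0)^`().[x0] == 0); last first.
  have c0 : 0 < e * (nrm (P z0)^`().[x0] / 2) by rewrite mulr_gt0// divr_gt0// nrm_gt0.
  have h1 : cnear2 z0 x0 (fun z _ => nrm (z - z0) <= e * (nrm (P z0)^`().[x0] / 2)).
    by exists (e * (nrm (P z0)^`().[x0] / 2)) => // w y wd _; exact: ltW.
  have h2 := cts2_away (cts2_dfpoly ald x0) P'0.
  apply: cnear2_sub (cnear2_and h1 h2) => z x [z1 z2] _; apply: le_trans z1 _.
  by apply: ler_wpM2l => //; exact: ltW.
have [A [A' [Ac A'c PE P'E AE]]] := fpoly_taylor ald.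
have A0 : A z0 x0 != 0 by rewrite AE; exact: reg.
(* Write P_z0 = (x - x0)^m u. On the curve (z - z0) A = - (x - x0)^m u, while dP/dx is of order (x -
   x0)^(m-1), so the ratio is O(|x - x0|). *)
have [m [u]] := multiplicity_XsubC (P z0) x0.
rewrite monic_neq0 ?monic_fpoly// implyTb => ux0 Pu.
have m0 : (0 < m)%N.
  rewrite lt0n; apply/eqP => m0; move: ux0; rewrite -[u]mulr1.
  by move: Pu; rewrite m0 expr0 => <-; rewrite x0r.
pose cc x := m%:R * u.[x] + (x - x0) * u^`().[x].
have P'u x : (P z0)^`().[x] = (x - x0) ^+ m.-1 * cc x.
  rewrite Pu derivM deriv_exp derivXsubC mul1r hornerD !hornerM hornerMn !horner_exp hornerXsubC.
  by rewrite /cc -{1}(prednK m0) exprS -mulr_natl; ring.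
have c0 : cc x0 != 0.
  rewrite /cc subrr mul0r addr0 mulf_neq0// pnatr_eq0; last by rewrite -lt0n.
have ccc : cts2 (fun _ x => cc x) z0 x0.
  apply: (@cts2D _ (fun _ x => m%:R * u.[x]) (fun _ x => (x - x0) * u^`().[x])).
    by apply: (@cts2M _ (fun _ _ => m%:R) (fun _ x => u.[x])); [exact: cts2C|exact: cts2_horner].
  apply: (@cts2M _ (fun _ x => x - x0) (fun _ x => u^`().[x])); last exact: cts2_horner.
  by apply: (@cts2D _ (fun _ x => x) (fun _ _ => - x0)); [exact: cts2_snd|exact: cts2C].
have nA := cts2_away (Ac x0) A0.
have nA' := cts2_bounded (A'c x0).
have nu := cts2_bounded (cts2_horner u z0 x0).
have nc := cts2_away ccc c0.
set a0 := nrm (A z0 x0) / 2 in nA; set a' := _ + 1 in nA'; set U := _ + 1 in nu.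
set c := nrm (cc x0) / 2 in nc.
have a00 : 0 < a0 by rewrite divr_gt0// nrm_gt0.
have c00 : 0 < c by rewrite divr_gt0// nrm_gt0.
have a'0 : 0 < a' by rewrite ltr_wpDl// nrm_ge0.
have U0 : 0 < U by rewrite ltr_wpDl// nrm_ge0.
(* The first bound lets the correction (z - z0) A' cost at most half of the main term of dP/dx; the
   second gives the factor [e]. *)
pose dl := Num.min (c * a0 / (2 * U * a')) (e * c * a0 / (2 * U)).
have dl0 : 0 < dl.
  have U20 : 0 < 2 * U by apply: mulr_gt0 U0.
  rewrite lt_min (divr_gt0 (mulr_gt0 c00 a00) (mulr_gt0 U20 a'0)).
  by rewrite (divr_gt0 (mulr_gt0 (mulr_gt0 e0 c00) a00) U20).
have nd : cnear2 z0 x0 (fun _ x => nrm (x - x0) < dl) by exists dl => // w y _.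
apply: cnear2_sub (cnear2_and nd (cnear2_and nA (cnear2_and nA' (cnear2_and nu nc)))).
move=> z x [xd [zA [zA' [zu zc]]]] /rootP xr.
set t := nrm (x - x0) in xd; set h := nrm (z - z0).
have t0 : 0 <= t by exact: nrm_ge0.
have h0 : 0 <= h by exact: nrm_ge0.
have tm0 : 0 <= t ^+ m.-1 by exact: exprn_ge0.
have e1 : h * a0 <= t ^+ m.-1 * t * U.
  apply: (@le_trans _ _ (h * nrm (A z x))); first exact: ler_wpM2l.
  have -> : h * nrm (A z x) = nrm (P z0).[x].
    rewrite -nrmM; move: xr; rewrite PE => /eqP; rewrite addr_eq0 => /eqP ->.
    by rewrite nrmN.
  rewrite Pu hornerM horner_exp hornerXsubC nrmM nrmX -/t -{1}(prednK m0) exprSr.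
  by rewrite [leRHS]mulrC; apply: ler_wpM2r => //; apply: mulr_ge0.
have e2 : t ^+ m.-1 * c - h * a' <= nrm (P z)^`().[x].
  rewrite P'E P'u; have := nrmBD ((x - x0) ^+ m.-1 * cc x + (z - z0) * A' z x) ((z - z0) * A' z x).
  rewrite addrK => H.
  have h1 : t ^+ m.-1 * c <= nrm ((x - x0) ^+ m.-1 * cc x).
    by rewrite nrmM nrmX; apply: ler_wpM2l.
  have h2 : nrm ((z - z0) * A' z x) <= h * a' by rewrite nrmM; apply: ler_wpM2l.
  lra.
move: xd; rewrite lt_min !ltr_pdivlMr ?mulr_gt0// => /andP[x1 x2].
have e3 : h * a' <= t ^+ m.-1 * c / 2.
  rewrite -(ler_pM2r a00).
  have s1 : h * a' * a0 <= t ^+ m.-1 * t * U * a'.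
    have -> : h * a' * a0 = h * a0 * a' by ring.
    by apply: ler_wpM2r => //; exact: ltW.
  apply: le_trans s1 _.
  have -> : t ^+ m.-1 * t * U * a' = t ^+ m.-1 * (t * (U * a')) by ring.
  have -> : t ^+ m.-1 * c / 2 * a0 = t ^+ m.-1 * (c * a0 / 2) by field.
  by apply: ler_wpM2l => //; move: x1; lra.
have e4 : t ^+ m.-1 * c / 2 <= nrm (P z)^`().[x] by lra.
have e5 : h * a0 <= e * (t ^+ m.-1 * c / 2) * a0.
  apply: le_trans e1 _.
  have -> : t ^+ m.-1 * t * U = t ^+ m.-1 * (t * U) by ring.
  have -> : e * (t ^+ m.-1 * c / 2) * a0 = t ^+ m.-1 * (e * c * a0 / 2) by field.
  by apply: ler_wpM2l => //; move: x2; lra.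
have e6 : h <= e * (t ^+ m.-1 * c / 2) by rewrite -(ler_pM2r a00).
by apply: le_trans e6 _; apply: ler_wpM2l => //; exact: ltW.
Qed.

Lemma simple_fibre_punctured z0 : (forall k, (k <= p)%N -> derivable (al k) z0 1) ->
  (forall x, root (P z0) x -> (P z0)^`().[x] = 0 ->
     \sum_(k < p.+1) derive1 (al k) z0 * x ^+ (p - k) != 0) ->
  forall e : R, 0 < e ->
  cnear z0 (fun z => forall x, root (P z) x -> nrm (z - z0) <= e * nrm (P z)^`().[x]).
Proof.
move=> ald reg e e0; apply: (fibre_tube al0 ald p0) => x xr.
exact: branch_estimate (reg x xr) e e0.
Qed.

Lemma pnear_simple_fibre z0 : (forall k, (k <= p)%N -> derivable (al k) z0 1) ->
  (forall x, root (P z0) x -> (P z0)^`().[x] = 0 ->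
     \sum_(k < p.+1) derive1 (al k) z0 * x ^+ (p - k) != 0) ->
  pnear z0 (simple_fibre p al).
Proof.
move=> ald reg; have [d d0 dP] := simple_fibre_punctured ald reg ltr01.
exists d => // z zd zz x xr; apply: contraNneq zz => E.
by rewrite -subr_eq0 -nrm_eq0 eq_le nrm_ge0 andbT; have := dP z zd x xr; rewrite E nrm0 mulr0.
Qed.

Lemma separated (s : seq C) : uniq s -> exists2 d : R, 0 < d &
  forall x y, x \in s -> y \in s -> x != y -> d <= nrm (x - y).
Proof.
elim: s => [_|r s IH /= /andP[rs us]]; first by exists 1.
have [d d0 dP] := IH us.
have [d' d'0 d'P] : exists2 d' : R, 0 < d' & forall y, y \in s -> d' <= nrm (r - y).
  elim: s rs {IH us d d0 dP} => [_|y s IH]; first by exists 1.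
  rewrite inE negb_or => /andP[ry /IH [d d0 dP]].
  exists (Num.min d (nrm (r - y))); first by rewrite lt_min d0 nrm_gt0 subr_eq0.
  move=> y'; rewrite inE ge_min => /predU1P[->|/dP ->//]; by rewrite lexx orbT.
exists (Num.min d d'); first by rewrite lt_min d0.
move=> x y; rewrite !inE ge_min => /predU1P[->|xs] /predU1P[->|ys] xy.
- by rewrite eqxx in xy.
- by rewrite d'P// orbT.
- by rewrite nrmB d'P// orbT.
- by rewrite dP.
Qed.

(** The implicit function theorem for a branch already known to be continuous. With Q the quotient
    of P_z1 by X - r, (rho - r) Q(rho) = - (z - z1) A(z, rho) and Q(r) is nonzero, which is
    Caratheodory's criterion. *)
Lemma simple_root z1 r (rho : C -> C) : (forall k, (k <= p)%N -> derivable (al k) z1 1) ->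
  root (P z1) r -> (P z1)^`().[r] != 0 -> rho z1 = r -> {for z1, continuous rho} ->
  cnear z1 (fun z => root (P z) (rho z)) -> derivable rho z1 1.
Proof.
move=> ald rr P'r rho1 rhoc rhor.
have [A [A' [Ac A'c PE P'E AE]]] := fpoly_taylor ald.
pose Q := quot_root (P z1) r.
have Qr : Q.[r] != 0 by rewrite quot_root_self.
have compc G x : cts2 G z1 x -> rho z1 = x -> {for z1, continuous (fun z => G z (rho z))}.
  move=> Gc E; apply/ctsCP => e e0; have := Gc e e0; rewrite -E => H.
  exact: (@cnear2_curve _ z1 rho (fun w y => nrm (G w y - G z1 (rho z1)) < e) rhoc H).
have Qc : {for z1, continuous (fun z => Q.[rho z])}.
  by apply: (@compc (fun _ y => Q.[y]) r) => //; exact: cts2_horner.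
have Qrho : Q.[rho z1] != 0 by rewrite rho1.
have Arc : {for z1, continuous (fun z => A z (rho z))} by apply: (@compc A r).
have Qic : {for z1, continuous (fun z => (Q.[rho z])^-1)}.
  exact: (@ctsV R (fun z => Q.[rho z]) z1 Qrho Qc).
have gc : {for z1, continuous (fun z => - (A z (rho z) * (Q.[rho z])^-1))}.
  exact: ctsN (ctsM Arc Qic).
apply: cdif_derivable; apply: (der_of_quotient gc).
have Qn : cnear z1 (fun z => Q.[rho z] != 0).
  have q2 : 0 < nrm Q.[r] / 2 by rewrite divr_gt0// nrm_gt0.
  have := (ctsCP _ _).1 Qc _ q2; apply: cnear_sub => z /=; rewrite rho1 => h.
  have t1 : nrm Q.[r] <= nrm Q.[rho z] + nrm (Q.[rho z] - Q.[r]).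
    have := nrmBD Q.[rho z] (Q.[rho z] - Q.[r]).
    by have -> : Q.[rho z] - (Q.[rho z] - Q.[r]) = Q.[r] by ring.
  rewrite -nrm_gt0; move: t1 h q2.
  move: (nrm Q.[r]) (nrm Q.[rho z]) (nrm (Q.[rho z] - Q.[r])) => a b c; lra.
apply: cnear_sub (cnear_and Qn rhor) => z [Qz /rootP zr].
have := PE z (rho z); rewrite zr -[in (P z1).[_]](quot_root_root rr) hornerM hornerXsubC -/Q rho1.
move=> E; apply/eqP; rewrite -subr_eq0; apply/eqP; apply: (mulIf Qz); rewrite mul0r.
have -> : (rho z - (r + (z - z1) * - (A z (rho z) * (Q.[rho z])^-1))) * Q.[rho z] =
   (rho z - r) * Q.[rho z] + (z - z1) * A z (rho z) by field.
by rewrite -E.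
Qed.

(** The discs of radius d / 2 about the p old roots are disjoint and each contains a new root, so by
    counting they contain exactly one each. *)
Lemma simple_fibre_roots z1 : (forall k, (k <= p)%N -> derivable (al k) z1 1) -> simple_fibre p al z1 ->
  exists rho : 'I_p -> C -> C,
    [/\ forall i, derivable (rho i) z1 1, forall i, root (P z1) (rho i z1) &
        cnear z1 (fun z => perm_eq (froots p al z) [seq rho i z | i <- enum 'I_p])].
Proof.
move=> ald gz.
have uz := simple_fibre_uniq al0 gz.
have [d d0 dP] := separated uz.
pose r i := nth 0 (froots p al z1) i.
have szr := size_froots p al0 z1.
have rin (i : 'I_p) : r i \in froots p al z1 by rewrite mem_nth// szr.
have rr (i : 'I_p) : root (P z1) (r i) by rewrite -(mem_froots p al0).
have rij (i j : 'I_p) : i != j -> d <= nrm (r i - r j).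
  move=> ij; apply: dP => //; by rewrite nth_uniq ?szr.
(* The root in the i-th disc; the default value is taken only when there is none, which does not
   happen for z near z1. *)
pose rho (i : 'I_p) z : C := xget (r i) [set y | root (P z) y /\ nrm (y - r i) < d / 2].
have d2 : 0 < d / 2 by lra.
have rho1 (i : 'I_p) : rho i z1 = r i.
  rewrite /rho; case: xgetP => // y _ [yr yd].
  apply/eqP; apply: contraTT yd => yn; rewrite -leNgt.
  have : d <= nrm (y - r i) by apply: dP => //; rewrite (mem_froots p al0).
  lra.
have ex : cnear z1 (fun z => forall i, i \in enum 'I_p -> root (P z) (rho i z) /\ nrm (rho i z - r i) < d / 2).
  apply: pnear_all => i _; apply: cnear_sub (root_near al0 ald p0 (rr i) d2) => z [y yr yd].
  by rewrite /rho; case: xgetP => [y' _ //|/(_ y)]; case.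
have pe : cnear z1 (fun z => perm_eq (froots p al z) [seq rho i z | i <- enum 'I_p]).
  apply: cnear_sub ex => z H.
  have inj : {in enum 'I_p &, injective (fun i : 'I_p => rho i z)}.
    move=> i j ie je E; apply/eqP; apply: contraT => /rij.
    have [_ h1] := H i ie; have [_ h2] := H j je; rewrite -E in h2.
    have := nrmBD (rho i z - r j) (rho i z - r i).
    have -> : rho i z - r j - (rho i z - r i) = r i - r j by ring.
    lra.
  have us : uniq [seq rho i z | i <- enum 'I_p] by rewrite map_inj_in_uniq ?enum_uniq.
  have su : size [seq rho i z | i <- enum 'I_p] = p by rewrite size_map size_enum_ord.
  have sub : {subset [seq rho i z | i <- enum 'I_p] <= froots p al z}.
    by move=> y' /mapP[i ie ->]; rewrite (mem_froots p al0); case: (H i ie).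
  have [ss meq] := uniq_min_size us sub (eq_leq (etrans (size_froots p al0 z) (esym su))).
  rewrite perm_sym; apply: (uniq_perm us _ meq).
  by rewrite -(eq_uniq ss meq).
exists rho; split => //; last by move=> i; rewrite rho1.
move=> i; apply: (simple_root ald (rr i)) => //; first exact: gz.
  apply/ctsCP => e e0.
  have e2 : 0 < Num.min e (d / 2) by rewrite lt_min e0.
  apply: cnear_sub (cnear_and ex (cnear_and pe (root_near al0 ald p0 (rr i) e2))) => z.
  move=> [H [pz [y yr]]]; rewrite lt_min => /andP[ye yd]; rewrite rho1.
  have : y \in [seq rho i z | i <- enum 'I_p] by rewrite -(perm_mem pz) (mem_froots p al0).
  move=> /mapP[j je yE]; have [jr jd] := H j je.
  have [ij|/rij h] := eqVneq i j; last first.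
    have := nrmBD (y - r j) (y - r i); have -> : y - r j - (y - r i) = r i - r j by ring.
    rewrite yE in yd *; lra.
  by rewrite [X in rho X z]ij -yE.
by apply: cnear_sub ex => z /(_ i (mem_enum _ i))[].
Qed.

End BranchPoints.

Lemma der_curve (R : realType) (F : (Cx R * Cx R)%type -> Cx R) (rho : Cx R -> Cx R) (z : Cx R) :
  differentiable F (z, rho z) -> derivable rho z 1 -> derivable (fun w : Cx R => F (w, rho w)) z 1.
Proof.
move=> Fd /derivable1_diffP rd; apply/derivable1_diffP.
have gd : differentiable (fun w : Cx R => (w, rho w)) z.
  exact: (@differentiable_pair (Cx R) _ _ _ id rho z (iffLR (derivable1_diffP _ _) (derId z)) rd).
exact: (@differentiable_comp (Cx R) _ _ _ (fun w : Cx R => (w, rho w)) F z gd Fd).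
Qed.

(** * Division by P with holomorphic coefficients *)

Section LocalDivision.
Context {R : realType}.
Local Notation C := (Cx R).
Variables (p : nat) (al : nat -> C -> C).
Hypothesis al0 : forall z, al 0%N z = 1.
Hypothesis p0 : (0 < p)%N.
Local Notation P := (fpoly p al).

Definition locrep (f : C -> C -> C) (z x : C) :=
  exists2 F : (C * C)%type -> C, \forall y \near (z, x), differentiable F y &
    \forall y \near (z, x), root (P y.1) y.2 -> f y.1 y.2 = F y.

Lemma cnear2_cnear2 z x (Q : C -> C -> Prop) : cnear2 z x Q -> cnear2 z x (fun w y => cnear2 w y Q).
Proof.
move=> [d d0 dQ]; have d2 : 0 < d / 2 by lra.
exists (d / 2) => // w y wd yd; exists (d / 2) => // w' y' wd' yd'; apply: dQ.
  have -> : w' - z = (w' - w) + (w - z) by ring.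
  by apply: le_lt_trans (nrmD _ _) _; lra.
have -> : y' - x = (y' - y) + (y - x) by ring.
by apply: le_lt_trans (nrmD _ _) _; lra.
Qed.

Lemma locrepP f z x : locrep f z x <-> exists2 F : (C * C)%type -> C,
  cnear2 z x (fun w y => differentiable F (w, y)) &
  cnear2 z x (fun w y => root (P w) y -> f w y = F (w, y)).
Proof.
split=> -[F Fd FE]; exists F.
- apply/(@cnear2P _ z x (fun w y => differentiable F (w, y))).
  by apply: filterS Fd => -[].
- apply/(@cnear2P _ z x (fun w y => root (P w) y -> f w y = F (w, y))).
  by apply: filterS FE => -[].
- have := (@cnear2P _ z x (fun w y => differentiable F (w, y))).2 Fd.
  by apply: filterS => -[].
have := (@cnear2P _ z x (fun w y => root (P w) y -> f w y = F (w, y))).2 FE.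
by apply: filterS => -[].
Qed.

Lemma locrep_near f z x : locrep f z x -> cnear2 z x (fun w y => locrep f w y).
Proof.
move=> /locrepP [F /cnear2_cnear2 Fd /cnear2_cnear2 FE].
by apply: cnear2_sub (cnear2_and Fd FE) => w y [? ?]; apply/locrepP; exists F.
Qed.

Lemma locrep_cts f z x : locrep f z x -> root (P z) x -> exists2 F, cts2 F z x &
  cnear2 z x (fun w y => root (P w) y -> f w y = F w y).
Proof.
move=> /locrepP [F Fd FE] xr; exists (fun w y => F (w, y)) => //.
apply/cts2P; rewrite (_ : (fun y : (C * C)%type => F (y.1, y.2)) = F); last by apply/funext => -[].
exact: differentiable_continuous (cnear2_at Fd).
Qed.

Lemma qcoef_fpoly z i r : (i < p)%N ->
  qcoef (P z) i r = \sum_(j < p - i) al (p - (i.+1 + j)) z * r ^+ j.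
Proof.
move=> ip; rewrite /qcoef size_fpoly//=; apply: eq_bigr => j _.
by rewrite coef_fpoly; have := ltn_ord j => h; rewrite (_ : (i.+1 + j <= p)%N) //; lia.
Qed.

(** The i-th coefficient of the interpolation polynomial of f over the fibre, by [coef_lagrange]; a
    total function, meaningful where the fibre is simple. *)
Definition interp (f : C -> C -> C) i z : C :=
  \sum_(r <- froots p al z) f z r / (P z)^`().[r] * qcoef (P z) i r.

(** The list [froots] depends on z in no regular way, but the sum is symmetric and can be rewritten
    along the differentiable branches. *)
Lemma interp_der f i z1 : (forall k, (k <= p)%N -> derivable (al k) z1 1) -> simple_fibre p al z1 ->
  (forall x, root (P z1) x -> locrep f z1 x) -> (i < p)%N -> derivable (interp f i) z1 1.
Proof.
move=> ald gz fl ip.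
have [rho [rhod rhor rhoE]] := simple_fibre_roots al0 p0 ald gz.
pose V z := \sum_(j <- enum 'I_p) f z (rho j z) / (P z)^`().[rho j z] *
   (\sum_(k < p - i) al (p - (i.+1 + k)) z * rho j z ^+ k).
apply: (@der_near _ V).
  apply: cnear_sub rhoE => z pz; rewrite /V /interp [RHS](perm_big _ pz) [RHS]big_map.
  by apply: eq_bigr => j _; rewrite qcoef_fpoly.
apply: der_sum => j.
have [F Fd FE] := (locrepP _ _ _).1 (fl _ (rhor j)).
have froot : cnear z1 (fun z => root (P z) (rho j z)).
  apply: cnear_sub rhoE => z pz; rewrite -(mem_froots p al0) (perm_mem pz).
  by apply: map_f; rewrite mem_enum.
have fE : cnear z1 (fun z => F (z, rho j z) = f z (rho j z)).
  have := @cnear2_curve _ z1 (rho j) (fun w y => root (P w) y -> f w y = F (w, y)) (derivable_cts (rhod j)) FE.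
  by move=> /(cnear_and froot); apply: cnear_sub => z [zr /(_ zr)].
have fd : derivable (fun z => f z (rho j z)) z1 1.
  apply: der_near fE _; apply: der_curve (rhod j); exact: cnear2_at Fd.
have P'd : derivable (fun z => (P z)^`().[rho j z]) z1 1.
  rewrite (_ : (fun z => _) = fun z => \sum_(k < p.+1) al k z * ((p - k)%:R * rho j z ^+ (p - k).-1)).
    apply: der_sum => k; have dk : derivable (al k) z1 1 by apply: ald; rewrite -ltnS.
    have dr : derivable (fun z => rho j z ^+ (p - k).-1) z1 1 := @derX R (rho j) (p - k).-1 z1 (rhod j).
    have dc : derivable (fun=> (p - k)%:R : C) z1 1 := derC _ z1.
    exact: (derM dk (derM dc dr)).
  apply/funext => z; rewrite deriv_fpoly; apply: eq_bigr => k _; by rewrite mulr_natl.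
have P'0 : (P z1)^`().[rho j z1] != 0 by exact: gz.
have P'i := @derV _ (fun z => (P z)^`().[rho j z]) z1 P'0 P'd.
have qd : derivable (fun z => \sum_(k < p - i) al (p - (i.+1 + k)) z * rho j z ^+ k) z1 1.
  apply: der_sum => k.
  have dk : derivable (al (p - (i.+1 + k))%N) z1 1 by apply: ald; exact: leq_subr.
  have dr : derivable (fun z => rho j z ^+ k) z1 1 := @derX R (rho j) k z1 (rhod j).
  exact: (derM dk dr).
exact: derM (derM fd P'i) qd.
Qed.

Lemma fibre_bound (g : C -> C -> C) z0 : (forall k, (k <= p)%N -> derivable (al k) z0 1) ->
  (forall x, root (P z0) x -> exists M : R, cnear2 z0 x (fun z y => root (P z) y -> nrm (g z y) <= M)) ->
  exists2 M : R, 0 <= M & cnear z0 (fun z => forall y, root (P z) y -> nrm (g z y) <= M).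
Proof.
move=> ald H.
have {}H x : exists M : R, 0 <= M /\ (root (P z0) x -> cnear2 z0 x (fun z y => root (P z) y -> nrm (g z y) <= M)).
  have [xr|xr] := boolP (root (P z0) x); last by exists 0.
  have [M MP] := H x xr; exists `|M|; split=> // _.
  by apply: cnear2_sub MP => z y h yr; apply: le_trans (h yr) (ler_norm _).
have [M MP] := boolp.choice H.
exists (\sum_(x <- froots p al z0) M x); first by apply: sumr_ge0 => x _; case: (MP x).
apply: (fibre_tube al0 ald p0) => x xr; have [_ /(_ xr)] := MP x.
apply: cnear2_sub => z y h yr; apply: le_trans (h yr) _.
have xin : x \in froots p al z0 by rewrite (mem_froots p al0).
rewrite (perm_big _ (perm_to_rem xin)) big_cons lerDl; apply: sumr_ge0 => x' _; by case: (MP x').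
Qed.

(** In (z - z0) times [interp], each summand is the small factor (z - z0) / P' times the bounded
    factor f [qcoef], so that [removable] applies although f / P' itself may be unbounded. *)
Theorem local_division f z0 :
  cnear z0 (fun z => forall k, (k <= p)%N -> derivable (al k) z 1) ->
  (forall x, root (P z0) x -> (P z0)^`().[x] = 0 ->
     \sum_(k < p.+1) derive1 (al k) z0 * x ^+ (p - k) != 0) ->
  (forall x, root (P z0) x -> locrep f z0 x) ->
  exists W : nat -> C -> C, (forall i, cnear z0 (fun z => derivable (W i) z 1)) /\
    cnear z0 (fun z => forall x, root (P z) x -> f z x = \sum_(i < p) W i z * x ^+ i).
Proof.
move=> aldn reg fl; have ald := cnear_at aldn.
have pg := pnear_simple_fibre al0 p0 ald reg.
have fln : cnear z0 (fun z => forall x, root (P z) x -> locrep f z x).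
  apply: (fibre_tube al0 ald p0) => x xr; apply: cnear2_sub (locrep_near (fl x xr)) => //.
have Vd i : (i < p)%N -> pnear z0 (fun z => derivable (interp f i) z 1).
  move=> ip; apply: pnear_sub (pnear_and pg (cnear_pnear (cnear_and fln aldn))).
  by move=> z [gz [flz aldz]]; exact: interp_der.
have V0 i : (i < p)%N -> forall e : R, 0 < e -> pnear z0 (fun z => nrm ((z - z0) * interp f i z) <= e).
  move=> ip e e0.
  have [M M0 MP] : exists2 M : R, 0 <= M &
     cnear z0 (fun z => forall y, root (P z) y -> nrm (f z y * qcoef (P z) i y) <= M).
    apply: fibre_bound => // x xr.
    have [F Fc FE] := locrep_cts (fl x xr) xr.
    have qc : cts2 (fun z y => \sum_(j < p - i) al (p - (i.+1 + j)) z * y ^+ j) z0 x.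
      apply: cts2_sum => j; apply: (@cts2M _ (fun z _ => al _ z) (fun _ y => y ^+ j)).
        by apply: cts2_fst; apply: derivable_cts; apply: ald; exact: leq_subr.
      exact/(@cts2X _ (fun _ y => y))/cts2_snd.
    have := cts2_bounded (cts2M Fc qc); set M := _ + 1 => MP.
    exists M; apply: cnear2_sub (cnear2_and FE MP) => z y [zE zM] yr.
    by rewrite zE// qcoef_fpoly.
  (* There are p summands, each at most this constant times [M]; the summand 1 covers M = 0. *)
  have e1 : 0 < e / (p%:R * M + 1) by rewrite divr_gt0// ltr_wpDl// mulr_ge0.
  apply: pnear_sub (pnear_and pg (cnear_pnear (cnear_and MP (simple_fibre_punctured al0 p0 ald reg e1)))).
  move=> z [gz [zM zP']].
  rewrite /interp mulr_sumr; apply: le_trans (nrm_sum _ _) _.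
  have : \sum_(r <- froots p al z) nrm ((z - z0) * (f z r / (P z)^`().[r] * qcoef (P z) i r))
     <= \sum_(r <- froots p al z) (e / (p%:R * M + 1) * M).
    rewrite !big_seq; apply: ler_sum => r; rewrite (mem_froots p al0) => rr.
    have P'r : 0 < nrm (P z)^`().[r] by rewrite nrm_gt0; exact: gz.
    have -> : (z - z0) * (f z r / (P z)^`().[r] * qcoef (P z) i r) =
      ((z - z0) / (P z)^`().[r]) * (f z r * qcoef (P z) i r) by ring.
    rewrite nrmM; apply: ler_pM; rewrite ?nrm_ge0//; last exact: zM.
    by rewrite nrmM nrmV ler_pdivrMr//; exact: zP'.
  move/le_trans; apply.
  rewrite big_const_seq count_predT (size_froots p al0) iter_addr_0.
  have D0 : 0 < p%:R * M + 1 by rewrite ltr_wpDl// mulr_ge0.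
  have -> : (e / (p%:R * M + 1) * M) *+ p = e * (p%:R * M / (p%:R * M + 1)).
    by rewrite -[LHS]mulr_natl; ring.
  by rewrite ler_piMr ?(ltW e0)// ler_pdivrMr// mul1r lerDl.
have Wex i : exists W, (i < p)%N -> cnear z0 (fun z => derivable W z 1) /\ pnear z0 (fun z => W z = interp f i z).
  have [ip|ip] := boolP (i < p)%N; last by exists (fun=> 0).
  by have [W W1 W2] := removable (Vd i ip) (V0 i ip); exists W.
have [W0 WP] := boolp.choice Wex.
exists (fun i => if (i < p)%N then W0 i else fun=> 0); split.
  move=> i; case: ifP => ip; first by case: (WP i ip).
  by exists 1 => // w _; exact: derC.
rewrite (_ : (fun z => _) = fun z => forall x, root (P z) x -> f z x = \sum_(i < p) W0 i z * x ^+ i); last first.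
  apply/funext => z; apply/propext; split=> H x xr; rewrite H//; apply: eq_bigr => i _; by rewrite ltn_ord.
have punct : pnear z0 (fun z => forall x, root (P z) x -> f z x = \sum_(i < p) W0 i z * x ^+ i).
  have Wn : pnear z0 (fun z => forall i, (i < p)%N -> W0 i z = interp f i z).
    have : forall n, (n <= p)%N -> pnear z0 (fun z => forall i, (i < n)%N -> W0 i z = interp f i z).
      elim=> [_|n IH np]; first by exists 1.
      have [_ h] := WP n np; apply: pnear_sub (pnear_and h (IH (ltnW np))) => z [zn zi] i.
      by rewrite ltnS leq_eqVlt => /predU1P[->|/zi].
    by move=> /(_ p (leqnn p)).
  apply: pnear_sub (pnear_and pg Wn) => z [gz zW] x xr.
  have uz := simple_fibre_uniq al0 gz.
  have ar : all (root (P z)) (froots p al z) by apply/allP => r; rewrite (mem_froots p al0).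
  have xin : x \in froots p al z by rewrite (mem_froots p al0).
  have sl : (size (lagrange (P z) (froots p al z) (f z)) <= p)%N.
    by have := size_lagrange (P z) (froots p al z) (f z); rewrite (size_fpoly p al0).
  rewrite -(horner_lagrange (f z) uz ar (gz x xr) xin) (horner_coef_wide _ sl).
  apply: eq_bigr => i _; rewrite zW// coef_lagrange// (size_fpoly p al0)//.
(* Over z0 itself interpolation fails. The equality at (z0, x) is the limit of the equalities at
   points (z, y) of the curve tending to it, which [root_near] supplies. *)
apply: pnear_cnear => // x xr.
have [F Fc FE] := locrep_cts (fl x xr) xr.
have Wc (i : 'I_p) : {for z0, continuous (W0 i)}.
  by apply: derivable_cts; have [h _] := WP i (ltn_ord i); exact: cnear_at h.
have Sc : cts2 (fun z y => \sum_(i < p) W0 i z * y ^+ i) z0 x.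
  apply: cts2_sum => j; apply: (@cts2M _ (fun z _ => W0 j z) (fun _ y => y ^+ j)).
    exact/cts2_fst/Wc.
  exact/(@cts2X _ (fun _ y => y))/cts2_snd.
rewrite (cnear2_at FE xr).
apply/eqP; rewrite -subr_eq0 -nrm_eq0; apply/eqP/le_anti; rewrite nrm_ge0 andbT.
apply/ler_addgt0Pl => e e0; rewrite addr0.
have e2 : 0 < e / 2 by lra.
have [d1 d10 d1P] := cnear2_and FE (cnear2_and (Fc _ e2) (Sc _ e2)).
have [d2 d20 d2P] := punct.
have [d3 d30 d3P] := root_near al0 ald p0 xr d10.
pose m := Num.min d1 (Num.min d2 d3).
have m0 : 0 < m by rewrite !lt_min d10 d20.
pose z := z0 + ((m / 2)%:C)%C.
have nz : nrm (z - z0) = m / 2 by rewrite /z addrC addKr nrm_real ger0_norm//; lra.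
have : m / 2 < m by lra.
rewrite {2}/m !lt_min -nz => /and3P[z1 z2 z3].
have zz : z != z0 by rewrite -subr_eq0 -nrm_gt0 nz; lra.
have [y yr yx] := d3P z z3.
have [E1 [E2 E3]] := d1P z y z1 yx.
have E4 := d2P z z2 zz y yr; rewrite E1// in E4.
have -> : F z0 x - \sum_(i < p) W0 i z0 * x ^+ i =
  (\sum_(i < p) W0 i z * y ^+ i - \sum_(i < p) W0 i z0 * x ^+ i) - (F z y - F z0 x) by rewrite E4; ring.
by apply: le_trans (nrmBD _ _) _; lra.
Qed.

End LocalDivision.

(** * Riemann surfaces *)

Lemma ball_open_C (R : realType) (z : Cx R) (d : R) : open [set w : Cx R | nrm (w - z) < d].
Proof.
rewrite openE => w /= wd; apply/cnearP; exists (d - nrm (w - z)); first by rewrite subr_gt0.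
move=> t tw /=; have -> : t - z = (t - w) + (w - z) by ring.
by apply: le_lt_trans (nrmD _ _) _; rewrite -ltrBrDr.
Qed.

Section Surface.
Context {R : realType} {S : riemann_surface R}.
Local Notation C := (Cx R).
Implicit Types (c d : chart S) (x y : S) (f g : S -> C).

Lemma nbhs_openP x (Q : S -> Prop) : (\forall y \near x, Q y) <->
  exists O : set S, [/\ open O, O x & forall y, O y -> Q y].
Proof.
have -> : (\forall y \near x, Q y) = nbhs x Q by [].
rewrite nbhsE; split=> [[A [Ao Ax] AQ]|[A [Ao Ax AQ]]]; first by exists A.
by exists A.
Qed.

Lemma nbhs_open (A : set S) x : open A -> A x -> \forall y \near x, A y.
Proof. by move=> Ao Ax; apply/nbhs_openP; exists A. Qed.

Lemma chart_nbhs c x (Q : S -> Prop) : dom c x -> (\forall y \near x, Q y) ->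
  cnear (coord c x) (fun z => [/\ dom c (icoord c z), coord c (icoord c z) = z & Q (icoord c z)]).
Proof.
move=> cx /nbhs_openP[A [Ao Ax AQ]].
have o1 : open (dom c `&` A) by apply: openI => //; exact: dom_open.
have o2 : open (coord c @` (dom c `&` A)) by apply: coord_open => //; exact: subIsetl.
have : nbhs (coord c x) (coord c @` (dom c `&` A)).
  by apply: open_nbhs_nbhs; split => //; exists x.
move/cnearP; apply: cnear_sub => z [y [cy Ay] <-].
by rewrite coordK//; split => //; exact: AQ.
Qed.

Lemma nbhs_chart c x (Q : C -> Prop) : dom c x -> cnear (coord c x) Q ->
  \forall y \near x, dom c y /\ Q (coord c y).
Proof.
move=> cx [d d0 dQ]; apply/nbhs_openP.
exists (dom c `&` coord c @^-1` [set w | nrm (w - coord c x) < d]); split.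
- by apply: coord_continuous; exact: ball_open_C.
- by split => //=; rewrite subrr nrm0.
- by move=> y [cy yd]; split => //; exact: dQ.
Qed.

Lemma coord_inj c x y : dom c x -> dom c y -> coord c x = coord c y -> x = y.
Proof. by move=> cx cy E; rewrite -(coordK cx) E coordK. Qed.

(** Differentiability at the single point x, in every chart around it; holomorphy near x has to be
    expressed by a [near] statement. *)
Definition hol f x := forall c, dom c x -> derivable (f \o icoord c : C -> C) (coord c x) 1.

Lemma transition_near c d x : dom c x -> dom d x ->
  cnear (coord c x) (fun z => icoord d (coord d (icoord c z)) = icoord c z).
Proof.
move=> cx dx; have := chart_nbhs cx (nbhs_open (dom_open d) dx).
by apply: cnear_sub => z [_ _ dz]; rewrite coordK.
Qed.

Lemma hol_chart c f x : dom c x -> derivable (f \o icoord c : C -> C) (coord c x) 1 -> hol f x.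
Proof.
move=> cx fd d dx.
have td : derivable (coord c \o icoord d : C -> C) (coord d x) 1 by exact: transition_holomorphic.
have E : (coord c \o icoord d) (coord d x) = coord c x by rewrite /= coordK.
have fd' : derivable (f \o icoord c : C -> C) ((coord c \o icoord d) (coord d x)) 1 by rewrite E.
have := @der_comp R (coord c \o icoord d) (f \o icoord c) (coord d x) td fd'.
by apply: der_near; apply: cnear_sub (transition_near dx cx) => z /= ->.
Qed.

Definition scts f x := forall e : R, 0 < e -> \forall y \near x, nrm (f y - f x) < e.

Lemma scts_chart c f x : dom c x -> scts f x -> {for coord c x, continuous (f \o icoord c : C -> C)}.
Proof.
move=> cx fc; apply/ctsCP => e e0; have := chart_nbhs cx (fc e e0).
by apply: cnear_sub => z [_ _ h] /=; rewrite coordK.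
Qed.

Lemma chart_scts c f x : dom c x -> {for coord c x, continuous (f \o icoord c : C -> C)} -> scts f x.
Proof.
move=> cx /ctsCP fc e e0; have := nbhs_chart cx (fc e e0).
by apply: filterS => y [cy] /=; rewrite !coordK.
Qed.

Lemma hol_scts f x : hol f x -> scts f x.
Proof.
move=> fh; have [c cx] := dom_cover x.
by apply: (chart_scts cx); apply: derivable_cts; exact: fh.
Qed.

(** A surface has no isolated points. Through this lemma identities pass to branch points and to
    D. *)
Lemma scts_eq_limit f g x : scts f x -> scts g x ->
  (\forall y \near x, y <> x -> f y = g y) -> f x = g x.
Proof.
move=> fc gc H; have [c cx] := dom_cover x.
have := eq_at_limit (scts_chart cx fc) (scts_chart cx gc).
rewrite /= coordK//; apply.
have := chart_nbhs cx H => -[d d0 dP]; exists d => // z zd zx.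
have [_ zE h] := dP z zd; apply: h => E; move: zx; by rewrite -zE E eqxx.
Qed.

Lemma hol_near f g x : (\forall y \near x, f y = g y) -> hol f x -> hol g x.
Proof.
move=> fg fh c cx; apply: der_near (fh c cx).
by apply: cnear_sub (chart_nbhs cx fg) => z [].
Qed.

Lemma holC (k : C) x : hol (fun=> k) x.
Proof. by move=> c cx; exact: derC. Qed.
Lemma holD f g x : hol f x -> hol g x -> hol (fun y => f y + g y) x.
Proof. by move=> fh gh c cx; exact: derD (fh c cx) (gh c cx). Qed.
Lemma holN f x : hol f x -> hol (fun y => - f y) x.
Proof. by move=> fh c cx; exact: derN (fh c cx). Qed.
Lemma holM f g x : hol f x -> hol g x -> hol (fun y => f y * g y) x.
Proof. by move=> fh gh c cx; exact: derM (fh c cx) (gh c cx). Qed.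
Lemma holV f x : f x != 0 -> hol f x -> hol (fun y => (f y)^-1) x.
Proof.
move=> fx fh c cx; apply: (@derV R (f \o icoord c) (coord c x) _ (fh c cx)).
by rewrite /= coordK.
Qed.
Lemma hol_coord c x : dom c x -> hol (coord c) x.
Proof. by move=> cx d dx; exact: transition_holomorphic. Qed.
Lemma hol_sum (I : Type) (s : seq I) (F : I -> S -> C) x :
  (forall i, hol (F i) x) -> hol (fun y => \sum_(i <- s) F i y) x.
Proof.
move=> Fh c cx.
exact: (@der_sum R I s (fun i => F i \o icoord c) (coord c x) (fun i => Fh i c cx)).
Qed.

Lemma sctsC (k : C) x : scts (fun=> k) x.
Proof. exact/hol_scts/holC. Qed.
Lemma sctsM f g x : scts f x -> scts g x -> scts (fun y => f y * g y) x.
Proof.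
move=> fc gc; have [c cx] := dom_cover x; apply: (chart_scts cx).
exact: ctsM (scts_chart cx fc) (scts_chart cx gc).
Qed.
Lemma sctsV f x : f x != 0 -> scts f x -> scts (fun y => (f y)^-1) x.
Proof.
move=> fx fc; have [c cx] := dom_cover x; apply: (chart_scts cx).
apply: (@ctsV R (f \o icoord c) (coord c x) _ (scts_chart cx fc)).
by rewrite /= coordK.
Qed.
Lemma sctsX f n x : scts f x -> scts (fun y => f y ^+ n) x.
Proof.
move=> fc; elim: n => [|n IH]; first exact: sctsC 1 x.
have -> : (fun y => f y ^+ n.+1) = (fun y => f y * f y ^+ n) by apply/funext => y; rewrite exprS.
exact: sctsM fc IH.
Qed.
Lemma scts_exprz f (m : int) x : f x != 0 -> scts f x -> scts (fun y => f y ^ m) x.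
Proof.
move=> fx fc; case: m => n; first exact: sctsX.
apply: (@sctsV (fun y => f y ^+ n.+1)); first by rewrite expf_neq0.
exact: sctsX.
Qed.
Lemma scts_neq0 f x : scts f x -> f x != 0 -> \forall y \near x, f y != 0.
Proof.
move=> fc; rewrite -nrm_gt0 => f0; apply: filterS (fc _ f0) => y.
by apply: contraTneq => ->; rewrite sub0r nrmN ltxx.
Qed.

(** [dquot_holo] in a chart. It serves both to factor simple zeros and to divide a section vanishing
    at x by the coordinate. *)
Lemma coord_quotient c f x : dom c x -> (\forall y \near x, hol f y) ->
  exists q, [/\ \forall y \near x, hol q y,
    \forall y \near x, f y = f x + (coord c y - coord c x) * q y &
    q x = derive1 (f \o icoord c : C -> C) (coord c x)].
Proof.
move=> cx fh.
have fd : cnear (coord c x) (fun z => derivable (f \o icoord c : C -> C) z 1).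
  apply: cnear_sub (chart_nbhs cx fh) => z [cz zE zh].
  by have := zh c cz; rewrite zE.
have [q [q1 q2 q3]] := dquot_holo fd.
exists (q \o coord c); split; last exact: q2.
  have H := nbhs_chart cx q3.
  apply: filterS H => y [cy yd]; apply: (hol_chart cy).
  apply: der_near yd; apply: cnear_sub (chart_nbhs cy (filterT)) => z [_ zE _].
  by rewrite /= zE.
apply: filterS (nbhs_open (dom_open c) cx) => y cy.
by have := q1 (coord c y); rewrite /= !coordK.
Qed.

Lemma holomorphic_onP (U : set S) f : holomorphic_on U f <-> forall x, U x -> hol f x.
Proof. by split=> H x; [move=> Ux c cx; exact: H|move=> y Uy; exact: H]. Qed.

End Surface.

(** * Transition functions of the canonical bundle *)

Section Canonical.
Context {R : realType} {S : riemann_surface R}.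
Local Notation C := (Cx R).
Implicit Types (c d e : chart S) (x y : S).

(** The derivative dz_c / dz_d; sections of K^m transform by its m-th power, xi by its square. *)
Definition kap c d x : C := lb_tr (l := canonical S) c d x.

Lemma kap_cdif c d x : dom c x -> dom d x ->
  cdif (coord c \o icoord d) (coord d x) (kap c d x).
Proof. by move=> cx dx; apply: derivable_cdif; exact: transition_holomorphic. Qed.

Lemma kap_comp c d e x : dom c x -> dom d x -> dom e x -> kap c d x * kap d e x = kap c e x.
Proof.
move=> cx dx ex.
have k1 : cdif (coord c \o icoord d : C -> C) ((coord d \o icoord e) (coord e x)) (kap c d x).
  by rewrite /= (coordK ex); exact: kap_cdif.
have k2 := cdif_comp (kap_cdif dx ex) k1.
apply: cdif_uniq k2 _; apply: (cdif_near _ (kap_cdif cx ex)).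
by apply: cnear_sub (transition_near ex dx) => z /= ->.
Qed.

Lemma kap_self c x : dom c x -> kap c c x = 1.
Proof.
move=> cx; apply: cdif_uniq (kap_cdif cx cx) _.
apply: (@cdif_near _ id).
  by apply: cnear_sub (chart_nbhs cx filterT) => z [_ /= ->].
by move=> e e0; exists 1 => // w _; rewrite mul1r subrr nrm0 mulr_ge0 ?nrm_ge0// ltW.
Qed.

Lemma kap_neq0 c d x : dom c x -> dom d x -> kap c d x != 0.
Proof.
move=> cx dx; apply/eqP => E; have := kap_comp cx dx cx.
by rewrite kap_self// E mul0r => /esym/eqP; rewrite oner_eq0.
Qed.

Lemma kap_scts c d x : dom c x -> dom d x -> scts (kap c d) x.
Proof.
move=> cx dx; apply: (chart_scts dx).
have H : cnear (coord d x) (fun z => derivable (coord c \o icoord d : C -> C) z 1).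
  apply: cnear_sub (chart_nbhs dx (nbhs_open (dom_open c) cx)) => z [dz zE cz].
  by rewrite -zE; exact: transition_holomorphic.
have := derive1_continuous H => /ctsCP K; apply/ctsCP => e e0.
have H2 := cnear_and (K e e0) (@chart_nbhs _ _ d x (fun=> True) dx (@filterT _ _ (nbhs_filter x))).
apply: cnear_sub H2 => z [h [_ zE _]].
by rewrite /kap /= /canonical /= zE coordK.
Qed.

End Canonical.

(** * Sections of line bundles and extension across isolated points *)

Section LineBundles.
Context {R : realType} {S : riemann_surface R}.
Local Notation C := (Cx R).

Lemma sec_hol (L : line_bundle S) U (s : lb_family L) (i : lb_idx L) (x : S) :
  sections L U s -> U x -> lb_dom i x -> hol (s i) x.
Proof. by move=> [sh _ _] Ux ix c cx; exact: (sh i c x). Qed.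

Lemma sec_tr (L : line_bundle S) U (s : lb_family L) (i j : lb_idx L) (x : S) :
  sections L U s -> U x -> lb_dom i x -> lb_dom j x -> s j x = s i x * lb_tr i j x.
Proof. by move=> [_ st _]; exact: st. Qed.

Lemma sec_out (L : line_bundle S) U (s : lb_family L) (i : lb_idx L) (x : S) :
  sections L U s -> ~ (U x /\ lb_dom i x) -> s i x = 0.
Proof. by move=> [_ _]; exact. Qed.

Lemma sectionsI (L : line_bundle S) (U : set S) (s : lb_family L) :
  (forall i x, U x -> lb_dom i x -> hol (s i) x) ->
  (forall i j x, U x -> lb_dom i x -> lb_dom j x -> s j x = s i x * lb_tr i j x) ->
  (forall i x, ~ (U x /\ lb_dom i x) -> s i x = 0) -> sections L U s.
Proof. by move=> h1 h2 h3; split => // i c x [Ux ix] cx; exact: (h1 i x Ux ix c cx). Qed.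

(** At a point of D the value is taken from a local holomorphic extension, in each trivialisation
    separately. The values are compatible by continuity of the transition functions, as D is
    discrete. *)
Lemma section_extension (L : line_bundle S) (U D : set S) (s : lb_family L) :
  open U -> (forall i : lb_idx L, open (lb_dom i)) ->
  (forall (i j : lb_idx L) x, lb_dom i x -> lb_dom j x -> scts (lb_tr i j) x) ->
  (forall x, \forall y \near x, y <> x -> ~ D y) ->
  sections L (U `\` D) s ->
  (forall x (i : lb_idx L), U x -> D x -> lb_dom i x -> exists2 f : S -> C,
     \forall y \near x, hol f y & \forall y \near x, y <> x -> s i y = f y) ->
  exists2 s', sections L U s' & forall i y, ~ D y -> s' i y = s i y.
Proof.
move=> Uo Lo Lc Di ss ext.
have ext' (q : S * lb_idx L) : exists f : S -> C, U q.1 -> D q.1 -> lb_dom q.2 q.1 ->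
    (\forall y \near q.1, hol f y) /\ (\forall y \near q.1, y <> q.1 -> s q.2 y = f y).
  have [[Ux [Dx ix]]|H] := pselect (U q.1 /\ D q.1 /\ lb_dom q.2 q.1).
    by have [f f1 f2] := ext _ _ Ux Dx ix; exists f.
  by exists (fun=> 0) => ? ? ?; case: H.
have [F FP] := boolp.choice ext'.
pose s' (i : lb_idx L) (y : S) : C :=
  if `[< U y /\ D y /\ lb_dom i y >] then F (y, i) y else s i y.
have s'D i y : ~ D y -> s' i y = s i y.
  by move=> Dy; rewrite /s'; case: asboolP => // -[_ []].
have near_s' x i : U x -> D x -> lb_dom i x -> \forall y \near x, s' i y = F (x, i) y.
  move=> Ux Dx ix; have [_ h] := FP (x, i) Ux Dx ix.
  apply: filterS2 h (Di x) => y h1 h2; have [->|yx] := pselect (y = x).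
    by rewrite /s'; case: asboolP => // -[].
  by rewrite s'D; [exact: h1|exact: h2].
have hol_s' i x : U x -> lb_dom i x -> hol (s' i) x.
  move=> Ux ix; have [Dx|Dx] := pselect (D x).
    have [h _] := FP (x, i) Ux Dx ix.
    apply: (@hol_near _ _ (F (x, i))); last exact: nbhs_singleton h.
    by apply: filterS (near_s' x i Ux Dx ix) => y ->.
  apply: (@hol_near _ _ (s i)); last by apply: (sec_hol ss _ ix); split.
  have Dn : \forall y \near x, ~ D y.
    by apply: filterS (Di x) => y H; have [->|/H] := pselect (y = x).
  by apply: filterS Dn => y Dy; rewrite s'D.
exists s' => //; apply: sectionsI => //.
  move=> i j x Ux ix jx; have [Dx|Dx] := pselect (D x); last first.
    by rewrite !s'D//; apply: (sec_tr ss _ ix jx); split.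
  apply: (@scts_eq_limit _ _ (s' j) (fun y => s' i y * lb_tr i j y)).
  - by apply: hol_scts; exact: hol_s'.
  - by apply: sctsM; [apply: hol_scts; exact: hol_s'|exact: Lc].
  apply: filterS2 (Di x) (nbhs_open (openI Uo (openI (Lo i) (Lo j))) (conj Ux (conj ix jx))).
  move=> y H [Uy [iy jy]] yx; have Dy := H yx.
  by rewrite !s'D//; apply: (sec_tr ss).
move=> i x nU; rewrite /s'; case: asboolP => [[Ux [_ ix]]|_]; first by case: nU.
by apply: (sec_out ss) => -[[Ux _] ix]; case: nU.
Qed.

End LineBundles.

(** * The bundle W *)

Section Spectral.
Context {R : realType} {S : riemann_surface R}.
Local Notation C := (Cx R).
Variables (p : nat) (a : nat -> K_family S).
Hypothesis p0 : (0 < p)%N.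
Hypothesis aS : forall k, (1 <= k <= p)%N -> sections (Kpow S (2 * k)%:Z) setT (a k).
Hypothesis areg : regular p a.
Implicit Types (c d : chart S) (x y : S).

Definition al c k (z : C) : C := acoef a k c (icoord c z).

Lemma al0 c z : al c 0 z = 1. Proof. by []. Qed.

Lemma spolyE c z : spoly p a c (icoord c z) = fpoly p (al c) z.
Proof. by []. Qed.

Lemma spolyE' c x : dom c x -> spoly p a c x = fpoly p (al c) (coord c x).
Proof. by move=> cx; rewrite -spolyE coordK. Qed.

Lemma size_spoly c x : size (spoly p a c x) = p.+1.
Proof. exact: (@size_fpoly R p (fun k _ => acoef a k c x) (fun=> erefl) 0). Qed.
Lemma monic_spoly c x : spoly p a c x \is monic.
Proof. exact: (@monic_fpoly R p (fun k _ => acoef a k c x) (fun=> erefl) 0). Qed.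
Lemma coef_spoly c x i : (spoly p a c x)`_i = if (i <= p)%N then acoef a (p - i) c x else 0.
Proof. exact: (@coef_fpoly R p (fun k _ => acoef a k c x) 0). Qed.
Lemma horner_spoly c x (t : C) : (spoly p a c x).[t] = \sum_(k < p.+1) acoef a k c x * t ^+ (p - k).
Proof. exact: (@horner_fpoly R p (fun k _ => acoef a k c x) 0). Qed.

Lemma acoef_hol k c x : (k <= p)%N -> dom c x -> hol (acoef a k c) x.
Proof.
case: k => [|k] kp cx; first exact: holC.
by apply: (sec_hol (aS (k := k.+1) kp) _ cx).
Qed.

Lemma acoef_tr k c d x : (k <= p)%N -> dom c x -> dom d x ->
  acoef a k d x = acoef a k c x * kap c d x ^+ (2 * k).
Proof.
case: k => [|k] kp cx dx; first by rewrite muln0 expr0 mulr1.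
exact: (@sec_tr _ _ (Kpow S (2 * k.+1)%:Z) setT (a k.+1) c d x (aS (k := k.+1) kp) I cx dx).
Qed.

(** All terms a_k xi^(p-k) are homogeneous of weight K^(2p). *)
Lemma horner_spoly_tr c d x (t : C) : dom c x -> dom d x ->
  (spoly p a d x).[t * kap c d x ^+ 2] = (spoly p a c x).[t] * kap c d x ^+ (2 * p).
Proof.
move=> cx dx; rewrite !horner_spoly mulr_suml; apply: eq_bigr => k _.
have kp : (k <= p)%N by rewrite -ltnS.
rewrite (acoef_tr kp cx dx) exprMn -exprM -!mulrA; congr (_ * _).
by rewrite mulrCA -exprD -mulnDr subnKC.
Qed.

Lemma root_tr c d x (t : C) : dom c x -> dom d x ->
  root (spoly p a d x) (t * kap c d x ^+ 2) = root (spoly p a c x) t.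
Proof.
move=> cx dx; rewrite !rootE horner_spoly_tr// mulf_eq0 expf_eq0.
by rewrite (negPf (kap_neq0 cx dx)) andbF orbF.
Qed.

Lemma al_der c x : dom c x ->
  cnear (coord c x) (fun z => forall k, (k <= p)%N -> derivable (al c k) z 1).
Proof.
move=> cx; apply: cnear_sub (chart_nbhs cx (nbhs_open (dom_open c) cx)) => z [cz zE _] k kp.
by have := acoef_hol kp cz cz; rewrite zE.
Qed.

(** Smoothness is assumed for the curve in eta but used for its quotient in xi = eta^2. The
    derivative in eta is 2 eta P'(eta^2), so a singular point of the quotient lifts, by any square
    root of xi, to a singular point. *)
Lemma reg_at c x : dom c x -> forall t, root (fpoly p (al c) (coord c x)) t ->
  (fpoly p (al c) (coord c x))^`().[t] = 0 ->
  \sum_(k < p.+1) derive1 (al c k) (coord c x) * t ^+ (p - k) != 0.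
Proof.
move=> cx t tr t'0; apply/eqP => E.
have [areg1 _] := areg.
pose eta : C := sqrtC t; have eta2 : eta ^+ 2 = t by exact: sqrtCK.
have hc (P : {poly C}) : (P \Po 'X^2).[eta] = P.[t] by rewrite horner_comp hornerXn eta2.
apply: (areg1 c x eta cx); first by rewrite rootE hc spolyE' //; exact: tr.
split.
  by rewrite deriv_comp hornerM horner_comp hornerXn eta2 spolyE'// t'0 mul0r.
have ald := cnear_at (al_der cx).
have [A [A' [Ac _ PE _ AE]]] := fpoly_taylor ald.
rewrite -E -AE; apply: cdif_derive1.
have Atc : {for coord c x, continuous (fun z => A z t)}.
  apply/ctsCP => e e0; have [d d0 dP] := Ac t e e0; exists d => // w wd.
  by apply: dP => //; rewrite subrr nrm0.
apply: (der_of_quotient Atc); exists 1 => // w _.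
by rewrite !hc !spolyE PE.
Qed.

Lemma simple_fibre_spoly c x : dom c x -> \forall y \near x, y <> x -> simple_fibre p (al c) (coord c y).
Proof.
move=> cx; have H := pnear_simple_fibre (al0 c) p0 (cnear_at (al_der cx)) (reg_at cx).
have [d d0 dP] := H.
have H' : cnear (coord c x) (fun z => z != coord c x -> simple_fibre p (al c) z).
  by exists d => // w; exact: dP.
apply: filterS (nbhs_chart cx H') => y [cy h] yx; apply: h.
by apply/eqP => E; apply: yx; exact: coord_inj E.
Qed.

Lemma simple_fibre_deriv c y : dom c y -> simple_fibre p (al c) (coord c y) ->
  forall t, root (spoly p a c y) t -> (spoly p a c y)^`().[t] != 0.
Proof. by move=> cy g t; rewrite spolyE'//; exact: g. Qed.

Lemma deriv_simple_fibre c y : dom c y ->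
  (forall t, root (spoly p a c y) t -> (spoly p a c y)^`().[t] != 0) -> simple_fibre p (al c) (coord c y).
Proof. by move=> cy g t; rewrite -spolyE'//; exact: g. Qed.

Lemma coef_uniq_simple c y (W W' : nat -> C) : dom c y -> simple_fibre p (al c) (coord c y) ->
  (forall t, root (spoly p a c y) t -> \sum_(i < p) W i * t ^+ i = \sum_(i < p) W' i * t ^+ i) ->
  forall i, (i < p)%N -> W i = W' i.
Proof.
move=> cy g E.
have hp (V : nat -> C) t : (\poly_(i < p) V i).[t] = \sum_(i < p) V i * t ^+ i.
  by rewrite horner_poly.
have : \poly_(i < p) W i = \poly_(i < p) W' i.
  apply: (@poly_eq_on _ _ _ (froots p (al c) (coord c y))).
  - exact: (simple_fibre_uniq (al0 c) g).
  - by rewrite (size_froots p (al0 c)) size_poly.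
  - by rewrite (size_froots p (al0 c)) size_poly.
  by move=> t; rewrite (mem_froots p (al0 c)) -spolyE'// => tr; rewrite !hp E.
by move=> H i ip; have := congr1 (fun F : {poly C} => F`_i) H; rewrite !coef_poly ip.
Qed.

(** On a fibre with fewer than p points the values do not determine the coefficients; continuity
    from the neighbouring simple fibres does. *)
Lemma coef_uniq c x (W W' : nat -> S -> C) : dom c x ->
  (forall i, (i < p)%N -> scts (W i) x) -> (forall i, (i < p)%N -> scts (W' i) x) ->
  (\forall y \near x, forall t, root (spoly p a c y) t ->
     \sum_(i < p) W i y * t ^+ i = \sum_(i < p) W' i y * t ^+ i) ->
  forall i, (i < p)%N -> W i x = W' i x.
Proof.
move=> cx Wc W'c E i ip; apply: scts_eq_limit; [exact: Wc|exact: W'c|].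
have gn := simple_fibre_spoly cx; have cn := nbhs_open (dom_open c) cx.
apply: filterS3 gn cn E => y h1 h2 h3 yx.
exact: (@coef_uniq_simple c y (W^~ y) (W'^~ y) h2 (h1 yx) h3).
Qed.

End Spectral.

Section DifferentiableFamily.
Context {R : realType}.
Local Notation C := (Cx R).

Lemma dfst (y : (C * C)%type) : differentiable (fst : (C * C)%type -> C) y.
Proof. by apply: linear_differentiable => z; exact: cvg_fst. Qed.
Lemma dsnd (y : (C * C)%type) : differentiable (snd : (C * C)%type -> C) y.
Proof. by apply: linear_differentiable => z; exact: cvg_snd. Qed.

Lemma diff_poly_family (n : nat) (g : 'I_n -> C -> C) (y : (C * C)%type) :
  (forall i, derivable (g i) y.1 1) ->
  differentiable (fun y : (C * C)%type => \sum_(i < n) g i y.1 * y.2 ^+ i) y.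
Proof.
move=> gd.
have H (i : 'I_n) : differentiable (fun y : (C * C)%type => g i y.1 * y.2 ^+ i) y.
  have d1 : differentiable (fun y : (C * C)%type => g i y.1) y.
    apply: (@differentiable_comp C (C * C)%type C C fst (g i) y (dfst y)).
    exact/derivable1_diffP.
  have d2 : differentiable (fun y : (C * C)%type => y.2 ^+ i) y.
    elim: (i : nat) => [|k IH].
      exact: (@differentiable_cst C (C * C)%type C 1 y).
    have -> : (fun y : (C * C)%type => y.2 ^+ k.+1) = (fun y => y.2 * y.2 ^+ k).
      by apply/funext => z; rewrite exprS.
    exact: (@differentiableM C (C * C)%type snd (fun y => y.2 ^+ k) y (dsnd y) IH).
  exact: (@differentiableM C (C * C)%type (fun y => g i y.1) (fun y => y.2 ^+ i) y d1 d2).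
have := @differentiable_sum C (C * C)%type C n (fun i y => g i y.1 * y.2 ^+ i) y H.
by rewrite (_ : \sum_(i < n) _ = fun y : (C * C)%type => \sum_(i < n) g i y.1 * y.2 ^+ i)//;
  apply/funext => z; rewrite fct_sumE.
Qed.

End DifferentiableFamily.

(** * The map phi from coefficients to functions on the curve *)

Section Phi.
Context {R : realType} {S : riemann_surface R}.
Local Notation C := (Cx R).
Variables (p : nat) (a : nat -> K_family S).
Hypothesis p0 : (0 < p)%N.
Hypothesis aS : forall k, (1 <= k <= p)%N -> sections (Kpow S (2 * k)%:Z) setT (a k).
Hypothesis areg : regular p a.
Implicit Types (c d : chart S) (x y : S) (w : nat -> K_family S).

Lemma Kpow_tr (m : int) U (s : K_family S) c d x : sections (Kpow S m) U s ->
  U x -> dom c x -> dom d x -> s d x = s c x * kap c d x ^ m.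
Proof. by move=> sS Ux cx dx; exact: (@sec_tr _ _ (Kpow S m) U s c d x sS Ux cx dx). Qed.

Lemma Kpow_hol (m : int) U (s : K_family S) c x : sections (Kpow S m) U s ->
  U x -> dom c x -> hol (s c) x.
Proof. by move=> sS Ux cx; exact: (@sec_hol _ _ (Kpow S m) U s c x sS Ux cx). Qed.

Lemma Kpow_out (m : int) U (s : K_family S) c x : sections (Kpow S m) U s ->
  ~ (U x /\ dom c x) -> s c x = 0.
Proof. by move=> sS; exact: (@sec_out _ _ (Kpow S m) U s c x sS). Qed.

Lemma KpowI (m : int) U (s : K_family S) :
  (forall c x, U x -> dom c x -> hol (s c) x) ->
  (forall c d x, U x -> dom c x -> dom d x -> s d x = s c x * kap c d x ^ m) ->
  (forall c x, ~ (U x /\ dom c x) -> s c x = 0) -> sections (Kpow S m) U s.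
Proof. by move=> h1 h2 h3; apply: (@sectionsI _ _ (Kpow S m)). Qed.

(** Slots are numbered from 1 and powers from 0, hence [i.+1]. The value 0 off the curve is the
    normalisation of [curve_sections]. *)
Definition phi w : curve_family S := fun c x t =>
  if root (spoly p a c x) t then \sum_(i < p) w i.+1 c x * t ^+ i else 0.

Lemma phiE w c x t : root (spoly p a c x) t -> phi w c x t = \sum_(i < p) w i.+1 c x * t ^+ i.
Proof. by rewrite /phi => ->. Qed.

Lemma Ksum_sec (r : nat) (m : int) U w i : K_sum_sections r m U w -> (i < r)%N ->
  sections (Kpow S (m - (2 * i.+1)%:Z)) U (w i.+1).
Proof. by move=> [h _] ir; exact: h. Qed.

(** Weights: slot i + 1 holds a section of K^(m - 2i), and xi^i is a section of K^(2i). *)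
Lemma kap_exp2 c d x (m : int) (i : nat) : kap c d x != 0 ->
  kap c d x ^ (m + 2 - (2 * i.+1)%:Z) * (kap c d x ^+ 2) ^+ i = kap c d x ^ m.
Proof.
move=> k0; rewrite -exprM exprnP -expfzDr//; congr (_ ^ _).
by lia.
Qed.

Lemma phi_in (m : int) U w : open U -> K_sum_sections p (m + 2) U w ->
  curve_sections p a m U (phi w).
Proof.
move=> Uo wS; split.
- move=> c x t Ux cx tr.
  have wn : cnear (coord c x) (fun z => forall i : 'I_p, derivable (w i.+1 c \o icoord c : C -> C) z 1).
    have Un : \forall y \near x, U y by exact: nbhs_open.
    apply: cnear_sub (chart_nbhs cx Un) => z [cz zE Uz] i.
    by have := Kpow_hol (Ksum_sec wS (ltn_ord i)) Uz cz cz; rewrite zE.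
  exists (fun y : (C * C)%type => \sum_(i < p) (w i.+1 c \o icoord c) y.1 * y.2 ^+ i).
    have := (@cnear2P _ (coord c x) t (fun z _ => forall i : 'I_p, derivable (w i.+1 c \o icoord c : C -> C) z 1)).2 (cnear_cnear2 _ wn).
    by apply: filterS => y yd; exact: (@diff_poly_family R p (fun i => w i.+1 c \o icoord c)).
  by apply: filterE => y yr; rewrite phiE.
- move=> c d x t Ux cx dx tr k.
  have k0 : kap c d x != 0 by exact: kap_neq0.
  rewrite phiE; last by rewrite (root_tr aS).
  rewrite phiE// mulr_suml; apply: eq_bigr => i _.
  rewrite (Kpow_tr (Ksum_sec wS (ltn_ord i)) Ux cx dx) exprMn.
  by rewrite mulrCA -!mulrA mulrA -/(kap c d x) mulrCA [t ^+ i * _]mulrC mulrA mulrA -(kap_exp2 m i k0); ring.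
move=> c x t H; rewrite /phi; case: ifP => // tr; apply: big1 => i _.
rewrite (Kpow_out (Ksum_sec wS (ltn_ord i))) ?mul0r// => -[Ux cx].
exact: H.
Qed.

Lemma phi_inj_at (U : set S) (m m' : int) w w' c x : open U ->
  K_sum_sections p m U w -> K_sum_sections p m' U w' -> U x -> dom c x ->
  (forall y, U y -> dom c y -> forall t, root (spoly p a c y) t -> phi w c y t = phi w' c y t) ->
  forall i, (i < p)%N -> w i.+1 c x = w' i.+1 c x.
Proof.
move=> Uo wS w'S Ux cx E.
apply: (@coef_uniq _ _ p a p0 aS areg c x (fun i => w i.+1 c) (fun i => w' i.+1 c) cx).
- by move=> i ip; apply: hol_scts; exact: Kpow_hol (Ksum_sec wS ip) Ux cx.
- by move=> i ip; apply: hol_scts; exact: Kpow_hol (Ksum_sec w'S ip) Ux cx.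
apply: filterS2 (nbhs_open Uo Ux) (nbhs_open (dom_open c) cx) => y Uy cy t tr.
by have := E y Uy cy t tr; rewrite !phiE.
Qed.

Lemma Ksum_ext (r : nat) (m m' : int) U w w' : K_sum_sections r m U w -> K_sum_sections r m' U w' ->
  (forall c x i, U x -> dom c x -> (i < r)%N -> w i.+1 c x = w' i.+1 c x) -> w = w'.
Proof.
move=> wS w'S E; apply/funext => i; have [ir|ir] := boolP (1 <= i <= r)%N; last first.
  by rewrite (wS.2 i ir) (w'S.2 i ir).
case: i ir => [|i] // ir; apply/funext => c; apply/funext => x.
have [[Ux cx]|H] := pselect (U x /\ dom c x); first exact: E.
by rewrite (Kpow_out (Ksum_sec wS ir) H) (Kpow_out (Ksum_sec w'S ir) H).
Qed.

Lemma phi_inj (m : int) U w w' : open U -> K_sum_sections p m U w -> K_sum_sections p m U w' ->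
  phi w = phi w' -> w = w'.
Proof.
move=> Uo wS w'S E; apply: (Ksum_ext wS w'S) => c x i Ux cx ip.
by apply: (phi_inj_at Uo wS w'S Ux cx) ip => y Uy cy t tr; rewrite E.
Qed.

(** [local_division] gives coefficients near each point, and [coef_uniq] glues them. *)
Lemma phi_surj (m : int) U f : open U -> curve_sections p a m U f ->
  exists2 w, K_sum_sections p (m + 2) U w & phi w = f.
Proof.
move=> Uo [frep ftr fout].
have loc c x : U x -> dom c x -> exists W : nat -> S -> C,
    (forall i, \forall y \near x, hol (W i) y) /\
    \forall y \near x, forall t, root (spoly p a c y) t -> f c y t = \sum_(i < p) W i y * t ^+ i.
  move=> Ux cx.
  have lr t : root (fpoly p (al a c) (coord c x)) t ->
      locrep p (al a c) (fun z => f c (icoord c z)) (coord c x) t.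
    rewrite -spolyE' // => tr; have [G G1 G2] := frep c x t Ux cx tr; by exists G.
  have [W [Wd WE]] := local_division (al0 a c) p0 (al_der aS cx) (reg_at aS areg cx) lr.
  exists (fun i => W i \o coord c); split.
    move=> i; apply: filterS (nbhs_chart cx (Wd i)) => y [cy yd]; apply: (hol_chart cy).
    apply: der_near yd; apply: cnear_sub (chart_nbhs cy (nbhs_open (dom_open c) cy)) => z [_ zE _].
    by rewrite /= zE.
  apply: filterS (nbhs_chart cx WE) => y [cy yE] t tr.
  by have := yE t; rewrite -spolyE'// coordK// => /(_ tr).
have ex (q : chart S * S) : exists W : nat -> S -> C, U q.2 -> dom q.1 q.2 ->
    (forall i, \forall y \near q.2, hol (W i) y) /\
    \forall y \near q.2, forall t, root (spoly p a q.1 y) t -> f q.1 y t = \sum_(i < p) W i y * t ^+ i.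
  have [[Ux cx]|H] := pselect (U q.2 /\ dom q.1 q.2).
    by have [W ?] := loc _ _ Ux cx; exists W.
  by exists (fun _ _ => 0) => ? ?; case: H.
have [W WP] := boolp.choice ex.
(* The value at x comes from the expansion chosen at x itself. That [w] agrees near x with this one
   expansion, and so is holomorphic, is the uniqueness argument that follows. *)
pose w i c x : C := if `[< [/\ (1 <= i <= p)%N, U x & dom c x] >] then W (c, x) i.-1 x else 0.
have wW i c x : (i < p)%N -> U x -> dom c x -> \forall y \near x, w i.+1 c y = W (c, x) i y.
  move=> ip Ux cx; have [Wh WE] := WP (c, x) Ux cx.
  have Wh' : \forall y \near x, forall i, (i < p)%N -> hol (W (c, x) i) y.
    have : forall n, \forall y \near x, forall i, (i < n)%N -> hol (W (c, x) i) y.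
      elim=> [|n IH]; first exact: filterE.
      apply: filterS2 (Wh n) IH => y h1 h2 j.
      by rewrite ltnS leq_eqVlt => /predU1P[->|/h2].
    exact.
  have WE' := near_join WE.
  apply: filterS3 (filterI WE' Wh') (nbhs_open Uo Ux) (nbhs_open (dom_open c) cx) => y [yE yh] Uy cy.
  rewrite /w; case: asboolP => [_|H]; last by case: H; split.
  have [Wyh WyE] := WP (c, y) Uy cy.
  apply: (@coef_uniq _ _ p a p0 aS areg c y (fun i => W (c, y) i) (fun i => W (c, x) i) cy) ip.
  - by move=> j jp; apply: hol_scts; exact: nbhs_singleton (Wyh j).
  - by move=> j jp; apply: hol_scts; exact: yh.
  by apply: filterS2 yE WyE => z h1 h2 t tr; rewrite -h1// -h2.
have wh i c x : (i < p)%N -> U x -> dom c x -> hol (w i.+1 c) x.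
  move=> ip Ux cx; apply: (@hol_near _ _ (W (c, x) i)).
    by apply: filterS (wW i c x ip Ux cx) => y ->.
  by have [Wh _] := WP (c, x) Ux cx; exact: nbhs_singleton (Wh i).
have wf c x t : U x -> dom c x -> root (spoly p a c x) t -> f c x t = \sum_(i < p) w i.+1 c x * t ^+ i.
  move=> Ux cx tr; have [_ WE] := WP (c, x) Ux cx.
  rewrite (nbhs_singleton WE)//; apply: eq_bigr => i _.
  by rewrite (nbhs_singleton (wW i c x (ltn_ord i) Ux cx)).
have wtr i c d x : (i < p)%N -> U x -> dom c x -> dom d x ->
    w i.+1 d x = w i.+1 c x * kap c d x ^ (m + 2 - (2 * i.+1)%:Z).
  move=> ip Ux cx dx.
  have k0 : kap c d x != 0 by exact: kap_neq0.
  (* The expansions of f in the charts c and d, both written in the fibre coordinate of c, have the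
     same coefficients. *)
  have E : w i.+1 d x * kap c d x ^+ (2 * i) = w i.+1 c x * kap c d x ^ m.
    apply: (@coef_uniq _ _ p a p0 aS areg c x (fun i y => w i.+1 d y * kap c d y ^+ (2 * i))
      (fun i y => w i.+1 c y * kap c d y ^ m) cx) ip.
    - move=> j jp; apply: (@sctsM _ _ (w j.+1 d)); first exact/hol_scts/wh.
      by apply: sctsX; exact: kap_scts.
    - move=> j jp; apply: (@sctsM _ _ (w j.+1 c)); first exact/hol_scts/wh.
      by apply: scts_exprz => //; exact: kap_scts.
    apply: filterS3 (nbhs_open Uo Ux) (nbhs_open (dom_open c) cx) (nbhs_open (dom_open d) dx).
    move=> y Uy cy dy t tr.
    have E : f d y (t * kap c d y ^+ 2) = f c y t * kap c d y ^ m := ftr c d y t Uy cy dy tr.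
    have rt : root (spoly p a d y) (t * kap c d y ^+ 2) by rewrite (root_tr aS).
    rewrite (wf d y _ Uy dy rt) (wf c y _ Uy cy tr) mulr_suml in E.
    have -> : \sum_(j < p) w j.+1 c y * kap c d y ^ m * t ^+ j = \sum_(j < p) w j.+1 c y * t ^+ j * kap c d y ^ m.
      by apply: eq_bigr => j _; rewrite mulrAC.
    by rewrite -E; apply: eq_bigr => j _; rewrite exprMn -exprM mulrA mulrAC.
  apply: (mulIf (expf_neq0 (2 * i) k0)); rewrite E -mulrA; congr (_ * _).
  by rewrite -(kap_exp2 m i k0) exprM.
exists w.
  split=> [[|i] // ip|i ip]; last first.
    by apply/funext => c; apply/funext => x; rewrite /w; case: asboolP => // -[ip']; rewrite ip' in ip.
  apply: KpowI.
  - by move=> c x Ux cx; exact: wh.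
  - by move=> c d x Ux cx dx; exact: wtr.
  by move=> c x H; rewrite /w; case: asboolP => // -[_ Ux cx]; case: H.
apply/funext => c; apply/funext => x; apply/funext => t.
have [[Ux cx tr]|H] := pselect [/\ U x, dom c x & root (spoly p a c x) t].
  by rewrite phiE// (wf c).
rewrite fout// /phi; case: ifP => // tr; apply: big1 => i _.
by rewrite /w; case: asboolP => [[_ Ux cx]|_]; [case: H|rewrite mul0r].
Qed.

Lemma phiD w w' : phi (w + w') = phi w + phi w'.
Proof.
apply/funext => c; apply/funext => x; apply/funext => t; rewrite /phi /=.
have -> : (phi w + phi w') c x t = phi w c x t + phi w' c x t by [].
rewrite /phi; case: ifP => _; last by rewrite addr0.
by rewrite -big_split /=; apply: eq_bigr => i _; rewrite -mulrDl.
Qed.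

Lemma phi_cut (U : set S) w : phi (fun i => cut U (w i)) = cut U (phi w).
Proof.
apply/funext => c; apply/funext => x; apply/funext => t.
rewrite /phi /cut /patch; case: (x \in U) => //=.
transitivity (0 : C) => //; case: ifP => // _; apply: big1 => i _; exact: mul0r.
Qed.

Lemma phi_act (k : K_family S) w : phi (fun i c x => k c x * w i c x) = mul_curve k (phi w).
Proof.
apply/funext => c; apply/funext => x; apply/funext => t.
rewrite /phi /mul_curve; case: ifP => _; last by rewrite mulr0.
by rewrite mulr_sumr; apply: eq_bigr => i _; rewrite mulrA.
Qed.

End Phi.

(** * Residue pairings and the form Q_W *)

Section Forms.
Context {R : realType} {S : riemann_surface R}.
Local Notation C := (Cx R).
Variables (p : nat) (a : nat -> K_family S).
Hypothesis p0 : (0 < p)%N.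
Hypothesis aS : forall k, (1 <= k <= p)%N -> sections (Kpow S (2 * k)%:Z) setT (a k).
Hypothesis areg : regular p a.
Implicit Types (c d : chart S) (x y : S) (w : nat -> K_family S).

Lemma hsymE u c x : hsym p a u c x = resid (spoly p a c x) 'X^(u + p.-1).
Proof.
rewrite /hsym; case: closed_field_poly_normal => rs /= E.
have {}E : spoly p a c x = \prod_(r <- rs) ('X - r%:P).
  by rewrite {1}E (monicP (monic_spoly p a c x)) scale1r.
have sz : size rs = p.
  by have := size_spoly p a c x; rewrite E size_prod_XsubC => -[].
have H := @csym_fromE _ p rs sz u 0 (leq0n p).
rewrite subn0 /tailprod drop0 -E addn_gt0 p0 orbT in H.
rewrite (_ : (u + p.-1)%N = (u + p).-1); last by lia.
rewrite H//; apply: eq_bigl => t; rewrite (_ : all _ t = true) ?andbT//.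
by apply/allP.
Qed.

Lemma resid_spolyXn k c x :
  resid (spoly p a c x) 'X^k = if (k < p.-1)%N then 0 else hsym p a (k - p.-1) c x.
Proof.
case: ltnP => kp; first by apply: residXn_small; rewrite (size_spoly p a c x).
by rewrite hsymE subnK.
Qed.

Definition wpoly (r : nat) w c x : {poly C} := \sum_(i < r) w i.+1 c x *: 'X^i.

Lemma horner_wpoly r w c x (t : C) : (wpoly r w c x).[t] = \sum_(i < r) w i.+1 c x * t ^+ i.
Proof. by rewrite horner_sum; apply: eq_bigr => i _; rewrite hornerZ hornerXn. Qed.

Lemma resid_wpoly r e w w' c x : resid (spoly p a c x) ('X^e * wpoly r w c x * wpoly r w' c x) =
  \sum_(i < r) \sum_(j < r) w i.+1 c x * w' j.+1 c x * resid (spoly p a c x) 'X^(i + j + e).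
Proof.
rewrite /wpoly -mulrA mulr_suml mulr_sumr resid_sum; apply: eq_bigr => i _.
rewrite !mulr_sumr resid_sum; apply: eq_bigr => j _.
rewrite -residZ -scalerAl -!scalerAr scalerA -!exprD.
by congr (resid _ (_ *: 'X^_)); lia.
Qed.

(** A Hankel matrix is the residue pairing in the basis of powers of xi, twisted by xi^e: e = 0
    gives Q_W, and e = 1 the form on W_0. *)
Lemma hankelE r m e w w' c x : (m + e = p.+1)%N ->
  hankel p a r m w w' c x = resid (spoly p a c x) ('X^e * wpoly r w c x * wpoly r w' c x).
Proof.
move=> me; rewrite resid_wpoly /hankel big_add1 big_mkord; apply: eq_bigr => i _.
rewrite big_add1 big_mkord; apply: eq_bigr => j _; rewrite resid_spolyXn.
have -> : (i.+1 + j.+1 < m)%N = (i + j + e < p.-1)%N by lia.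
case: ltnP => h; first by rewrite mulr0.
have -> : (i.+1 + j.+1 - m = i + j + e - p.-1)%N by lia.
by rewrite [RHS]mulrC mulrA.
Qed.

(** The recursion from reducing X^k modulo P stays within polynomials in the a_i, so the roots need
    no holomorphic choice. *)
Lemma residXn_hol k c x : dom c x -> hol (fun y => resid (spoly p a c y) 'X^k) x.
Proof.
elim/ltn_ind: k c x => k IH c x cx.
have [kp|kp] := ltnP k p.-1.
  rewrite (_ : (fun y => _) = fun=> 0); first exact: holC.
  by apply/funext => y; rewrite resid_spolyXn kp.
have [kp'|kp'] := ltnP k p.
  rewrite (_ : (fun y => _) = fun=> 1); first exact: holC.
  apply/funext => y; have -> : k = p.-1 by lia.
  rewrite resid_small; first by rewrite coefXn (size_spoly p a c y) /= eqxx.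
  by rewrite size_polyXn (size_spoly p a c y); lia.
rewrite (_ : (fun y => _) = fun y => \sum_(i < p) (-1) * (acoef a (p - i) c y * resid (spoly p a c y) 'X^(k - p + i))).
  apply: hol_sum => i; apply: (@holM _ _ (fun=> -1)); first exact: holC.
  apply: holM; first by apply: (acoef_hol aS) => //; exact: leq_subr.
  by apply: IH => //; have := ltn_ord i; lia.
apply/funext => y.
have PE : spoly p a c y = 'X^p + \sum_(i < p) acoef a (p - i) c y *: 'X^i.
  apply/polyP => i; rewrite (coef_spoly p a) coefD coefXn coef_sum.
  have [ip|ip|->] := ltngtP i p.
  - rewrite add0r (bigD1 (Ordinal ip)) //= big1 ?addr0 ?coefZ ?coefXn ?eqxx ?mulr1// => j ji.
    rewrite coefZ coefXn; case: eqP => [ij|]; last by rewrite mulr0.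
    by case/eqP: ji; exact: val_inj.
  - rewrite add0r big1// => j _; rewrite coefZ coefXn; case: eqP => [ij|]; last by rewrite mulr0.
    by have := ltn_ord j; lia.
  rewrite subnn big1 ?addr0// => j _; rewrite coefZ coefXn; case: eqP => [ij|]; last by rewrite mulr0.
  by have := ltn_ord j; lia.
have := resid_mul (spoly p a c y) 'X^(k - p).
rewrite {2}PE mulrDl -exprD subnKC// residD => /eqP; rewrite addr_eq0 => /eqP ->.
rewrite mulr_suml resid_sum -sumrN; apply: eq_bigr => i _.
by rewrite -scalerAl residZ -exprD [(i + _)%N]addnC mulN1r.
Qed.

Lemma resid_wpoly_hol r e w w' c x : dom c x ->
  (forall i, (i < r)%N -> hol (w i.+1 c) x) -> (forall i, (i < r)%N -> hol (w' i.+1 c) x) ->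
  hol (fun y => resid (spoly p a c y) ('X^e * wpoly r w c y * wpoly r w' c y)) x.
Proof.
move=> cx wh w'h.
rewrite (_ : (fun y => _) = fun y => \sum_(i < r) \sum_(j < r)
   w i.+1 c y * w' j.+1 c y * resid (spoly p a c y) 'X^(i + j + e)); last first.
  by apply/funext => y; exact: resid_wpoly.
apply: hol_sum => i; apply: hol_sum => j.
apply: (@holM _ _ (fun y => w i.+1 c y * w' j.+1 c y)); last exact: residXn_hol.
by apply: holM; [exact: wh|exact: w'h].
Qed.

Lemma fibre_sum c x (F : {poly C}) : dom c x -> simple_fibre p (al a c) (coord c x) ->
  \sum_(t \in [set t : C | root (spoly p a c x) t]) F.[t] / (spoly p a c x)^`().[t] =
  resid (spoly p a c x) F.
Proof.
move=> cx g; pose rs := froots p (al a c) (coord c x).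
have us : uniq rs := simple_fibre_uniq (al0 a c) g.
have sE : [set t : C | root (spoly p a c x) t] = [set` rs].
  by apply/seteqP; split => t /=; rewrite /rs (mem_froots p (al0 a c)) spolyE'.
rewrite sE -fsbig_seq//.
have szr : size rs = p by rewrite /rs (size_froots p (al0 a c)).
have rr t : t \in rs -> root (spoly p a c x) t by rewrite /rs (mem_froots p (al0 a c)) spolyE'.
have h1 : all (root (spoly p a c x)) rs by apply/allP.
have h2 : size (spoly p a c x) = (size rs).+1 by rewrite (size_spoly p a c x) szr.
have h3 : (0 < size rs)%N by rewrite szr.
rewrite (residE F (monic_spoly p a c x) us h1 h2 h3)// => t /rr.
exact: simple_fibre_deriv.
Qed.

(** [curve_form] prescribes q over simple fibres only and requires holomorphy elsewhere. The residue
    of any polynomial lift G of f f' is that extension, also over branch points. *)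
Lemma curve_formP (U : set S) (f f' : curve_family S) (G : chart S -> S -> {poly C}) q :
  open U ->
  (forall c x t, U x -> dom c x -> root (spoly p a c x) t -> f c x t * f' c x t = (G c x).[t]) ->
  (forall c x, U x -> dom c x -> hol (fun y => resid (spoly p a c y) (G c y)) x) ->
  curve_form p a U f f' q <-> forall c x, U x -> dom c x -> q x = resid (spoly p a c x) (G c x).
Proof.
move=> Uo fG Gh.
have sumE c x : U x -> dom c x -> simple_fibre p (al a c) (coord c x) ->
   \sum_(xi \in [set xi : C | root (spoly p a c x) xi])
            f c x xi * f' c x xi / (spoly p a c x)^`().[xi] = resid (spoly p a c x) (G c x).
  move=> Ux cx g; rewrite -fibre_sum//; apply: eq_fsbigr => t; rewrite inE /= => tr.
  by rewrite fG.
split.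
  move=> [/holomorphic_onP qh qE] c x Ux cx.
  apply: (@scts_eq_limit _ _ q (fun y => resid (spoly p a c y) (G c y))).
  - by apply: hol_scts; exact: qh.
  - by apply: hol_scts; exact: Gh.
  apply: filterS3 (nbhs_open Uo Ux) (nbhs_open (dom_open c) cx) (simple_fibre_spoly p0 aS areg cx).
  move=> y Uy cy gy yx; rewrite (qE c y Uy cy); first exact: sumE Uy cy (gy yx).
  by apply: simple_fibre_deriv => //; exact: gy.
move=> qE; split.
  apply/holomorphic_onP => x Ux; have [c cx] := dom_cover x.
  apply: hol_near (Gh c x Ux cx).
  by apply: filterS2 (nbhs_open Uo Ux) (nbhs_open (dom_open c) cx) => y Uy cy; rewrite (qE c).
move=> c x Ux cx g; rewrite (qE c x Ux cx) sumE//; exact: deriv_simple_fibre.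
Qed.

Lemma phi_wpoly w c x (t : C) : root (spoly p a c x) t -> phi p a w c x t = (wpoly p w c x).[t].
Proof. by move=> tr; rewrite phiE// horner_wpoly. Qed.

Lemma QW_iso (m m' : int) U w w' q : open U -> K_sum_sections p m U w -> K_sum_sections p m' U w' ->
  (forall c x, U x -> dom c x -> q x = hankel p a p p.+1 w w' c x) <->
  curve_form p a U (phi p a w) (phi p a w') q.
Proof.
move=> Uo wS w'S.
have := @curve_formP U (phi p a w) (phi p a w') (fun c x => 'X^0 * wpoly p w c x * wpoly p w' c x) q Uo.
case.
- by move=> c x t Ux cx tr; rewrite !phi_wpoly// expr0 mul1r hornerM.
- move=> c x Ux cx; apply: resid_wpoly_hol => // i ip.
    exact: Kpow_hol (Ksum_sec wS ip) Ux cx.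
  exact: Kpow_hol (Ksum_sec w'S ip) Ux cx.
move=> h1 h2; split=> H.
  by apply: h2 => c x Ux cx; rewrite (H c x Ux cx) (@hankelE _ _ 0) ?addn0.
by move=> c x Ux cx; rewrite (h1 H c x Ux cx) (@hankelE _ _ 0) ?addn0.
Qed.

End Forms.

(** * The bundle V *)

Section Bundles.
Context {R : realType} {S : riemann_surface R}.
Local Notation C := (Cx R).

Lemma Kpow_tr_scts (m : int) (c d : chart S) (x : S) : dom c x -> dom d x ->
  scts (lb_tr (l := Kpow S m) c d) x.
Proof.
move=> cx dx; apply: (@scts_exprz _ _ (kap c d)); first exact: kap_neq0.
exact: kap_scts.
Qed.

Variable N : line_bundle S.
Hypothesis NB : is_line_bundle N.

Lemma N_tr_hol (i j : lb_idx N) x : lb_dom i x -> lb_dom j x -> hol (lb_tr i j) x.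
Proof. by case: NB => _ _ h _ _ ix jx c cx; exact: (h i j c x). Qed.

Lemma N_tr_neq0 (i j : lb_idx N) x : lb_dom i x -> lb_dom j x -> lb_tr i j x != 0.
Proof. by case: NB => _ _ _ h _; exact: h. Qed.

Lemma N_open (i : lb_idx N) : open (lb_dom i).
Proof. by case: NB. Qed.

Lemma N_cover x : exists i : lb_idx N, lb_dom i x.
Proof. by case: NB. Qed.

Definition KN (m e : int) : line_bundle S := lb_tensor (Kpow S m) (lb_pow N e).

Lemma KN_tr_scts (m e : int) (i j : lb_idx (KN m e)) x : lb_dom i x -> lb_dom j x ->
  scts (lb_tr i j) x.
Proof.
case: i j => [c i] [d j] [cx ix] [dx jx].
have h1 : scts (fun y => lb_tr (l := N) i j y ^ e) x.
  apply: (@scts_exprz _ _ (lb_tr (l := N) i j)); first exact: (N_tr_neq0 ix jx).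
  by apply: hol_scts; exact: (N_tr_hol ix jx).
exact: (@sctsM _ _ (lb_tr (l := Kpow S m) c d) _ x (Kpow_tr_scts m cx dx) h1).
Qed.

(** Lets [KN_tr_scts] serve B as well as its dual. *)
Lemma tensor_KN (m : int) : lb_tensor (Kpow S m) N = KN m 1.
Proof.
rewrite /KN /lb_tensor /lb_pow /=; congr LineBundle.
Qed.

End Bundles.

Section Divisor.
Context {R : realType} {S : riemann_surface R}.
Local Notation C := (Cx R).
Variables (L : line_bundle S) (s : lb_family L) (A : set S).
Hypothesis sA : section_with_divisor s A.
Hypothesis Ltr : forall (i j : lb_idx L) x, lb_dom i x -> lb_dom j x -> lb_tr i j x != 0.
Hypothesis Lop : forall i : lb_idx L, open (lb_dom i).

Lemma div_sec : sections L setT s. Proof. by case: sA. Qed.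

Lemma div_hol (i : lb_idx L) x : lb_dom i x -> hol (s i) x.
Proof. exact: (sec_hol div_sec I). Qed.

Lemma div_hol_near (i : lb_idx L) x : lb_dom i x -> \forall y \near x, hol (s i) y.
Proof. by move=> ix; apply: filterS (nbhs_open (Lop i) ix) => y; exact: div_hol. Qed.

Lemma div_eq0 (i : lb_idx L) x : lb_dom i x -> s i x = 0 <-> A x.
Proof.
move=> ix; case: (sA) => ss zl _; rewrite -zl; split=> [si0 j jx|]; last exact.
by rewrite (sec_tr ss I ix jx) si0 mul0r.
Qed.

(** The quotient by the coordinate takes at x the value of the derivative, which is nonzero because
    the zero is simple. *)
Lemma div_factor (c : chart S) (i : lb_idx L) x : A x -> dom c x -> lb_dom i x ->
  exists2 q : S -> C, (\forall y \near x, hol q y /\ q y != 0) &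
    \forall y \near x, s i y = (coord c y - coord c x) * q y.
Proof.
move=> Ax cx ix; have [q [qh qE qx]] := coord_quotient cx (div_hol_near ix).
have s0 : s i x = 0 by apply/(div_eq0 ix).
have q0 : q x != 0 by rewrite qx; case: sA => _ _; apply.
exists q; last by apply: filterS qE => y ->; rewrite s0 add0r.
by apply: (filterI qh); apply: scts_neq0 => //; apply: hol_scts; exact: nbhs_singleton qh.
Qed.

End Divisor.

Lemma open_near (T : topologicalType) (A : set T) : (forall x, A x -> \forall y \near x, A y) -> open A.
Proof. by move=> H; rewrite openE => x /H. Qed.

(** * Multiplication by xi on coefficients *)

Section Companion.
Context {R : realType} {S : riemann_surface R}.
Local Notation C := (Cx R).
Variables (p : nat) (a : nat -> K_family S).
Hypothesis p0 : (0 < p)%N.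
Hypothesis aS : forall k, (1 <= k <= p)%N -> sections (Kpow S (2 * k)%:Z) setT (a k).
Implicit Types (c d : chart S) (x y : S) (w : nat -> K_family S).

(* The matrix of multiplication by xi in the basis 1, xi, ..., xi^(p-1), applied to w. *)
Definition mul_xi w (k : nat) : K_family S := fun c x =>
  if (1 <= k <= p)%N then
    (if k == 1%N then 0 else w k.-1 c x) - w p c x * acoef a (p - k).+1 c x
  else 0.

Lemma spoly_split c y :
  spoly p a c y = 'X^p + \sum_(i < p) acoef a (p - i) c y *: 'X^i.
Proof.
apply/polyP => i; rewrite (coef_spoly p a) coefD coefXn coef_sum.
have [ip|ip|->] := ltngtP i p.
- rewrite add0r (bigD1 (Ordinal ip)) //= big1 ?addr0 ?coefZ ?coefXn ?eqxx ?mulr1// => j ji.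
  rewrite coefZ coefXn; case: eqP => [ij|]; last by rewrite mulr0.
  by case/eqP: ji; exact: val_inj.
- rewrite add0r big1// => j _; rewrite coefZ coefXn; case: eqP => [ij|]; last by rewrite mulr0.
  by have := ltn_ord j; lia.
rewrite subnn big1 ?addr0// => j _; rewrite coefZ coefXn; case: eqP => [ij|]; last by rewrite mulr0.
by have := ltn_ord j; lia.
Qed.

Lemma root_pow c y (t : C) : root (spoly p a c y) t ->
  t ^+ p = - \sum_(i < p) acoef a (p - i) c y * t ^+ i.
Proof.
move=> /rootP; rewrite spoly_split hornerD hornerXn horner_sum => /eqP.
rewrite addr_eq0 => /eqP ->; congr (- _); apply: eq_bigr => i _.
by rewrite hornerZ hornerXn.
Qed.

Lemma mul_xiE w c x (t : C) : root (spoly p a c x) t ->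
  t * \sum_(i < p) w i.+1 c x * t ^+ i = \sum_(i < p) mul_xi w i.+1 c x * t ^+ i.
Proof.
move=> tr.
have gE (i : 'I_p) : mul_xi w i.+1 c x * t ^+ i =
    (if (i == 0 :> nat) then 0 else w i c x * t ^+ i) - w p c x * (acoef a (p - i) c x * t ^+ i).
  have ip := ltn_ord i; rewrite /mul_xi ltnS leq0n ip /= eqSS subnSK//.
  by case: eqP => _; ring.
rewrite (eq_bigr _ (fun i _ => gE i)) sumrB -mulr_sumr.
have -> : \sum_(i < p) acoef a (p - i) c x * t ^+ i = - t ^+ p by rewrite (root_pow tr) opprK.
rewrite mulrN opprK mulr_sumr.
case: p p0 => // p' _; rewrite big_ord_recr [in RHS]big_ord_recl /= add0r exprS; congr (_ + _); last by ring.
by apply: eq_bigr => i _; rewrite /bump /= add1n exprS; ring.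
Qed.

Lemma mul_xi_sec (M : int) U w : K_sum_sections p M U w -> K_sum_sections p (M + 2) U (mul_xi w).
Proof.
move=> wS; split=> k kp; last first.
  by apply/funext => c; apply/funext => x; rewrite /mul_xi (negPf kp).
have pp : (1 <= p <= p)%N by rewrite p0 leqnn.
have kp' : ((p - k).+1 <= p)%N by lia.
have k1 : k != 1%N -> (1 <= k.-1 <= p)%N by lia.
apply: KpowI.
- move=> c x Ux cx.
  have h2 : hol (fun y => - (w p c y * acoef a (p - k).+1 c y)) x.
    apply: holN; apply: holM; first exact: (Kpow_hol (wS.1 p pp) Ux cx).
    exact: (acoef_hol aS kp' cx).
  rewrite (_ : mul_xi w k c = fun y => (if k == 1%N then 0 else w k.-1 c y) + - (w p c y * acoef a (p - k).+1 c y)); last first.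
    by apply/funext => y; rewrite /mul_xi kp.
  have h1 : hol (fun y => if k == 1%N then 0 else w k.-1 c y) x.
    case: eqVneq => [_|k1']; first exact: (@holC R S 0 x).
    exact: (Kpow_hol (wS.1 _ (k1 k1')) Ux cx).
  exact: (holD h1 h2).
- move=> c d x Ux cx dx; have k0 : kap c d x != 0 by exact: kap_neq0.
  rewrite /mul_xi kp mulrBl; congr (_ - _).
    case: ifP => [_|/negbT k1']; first by rewrite mul0r.
    rewrite (Kpow_tr (wS.1 _ (k1 k1')) Ux cx dx); congr (_ * _ ^ _).
    by move: (k1 k1'); lia.
  rewrite (Kpow_tr (wS.1 p pp) Ux cx dx) (acoef_tr aS kp' cx dx) exprnP mulrACA -expfzDr//.
  by congr (_ * _ ^ _); lia.
move=> c x H; rewrite /mul_xi kp (Kpow_out (wS.1 p pp) H) mul0r subr0.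
by case: ifP => // /negbT k1'; exact: Kpow_out (wS.1 _ (k1 k1')) H.
Qed.

Lemma phi_mul_xi w : phi p a (mul_xi w) = beta_F (phi p a w).
Proof.
apply/funext => c; apply/funext => x; apply/funext => t.
rewrite /beta_F /phi; case: ifP => [tr|]; last by rewrite mulr0.
by rewrite mul_xiE.
Qed.

End Companion.

Section CyclicResidue.
Context {R : realType} {S : riemann_surface R}.
Local Notation C := (Cx R).
Variables (p : nat) (a : nat -> K_family S).
Hypothesis p0 : (0 < p)%N.
Implicit Types (c : chart S) (x : S) (v w : nat -> K_family S) (t : C).

Lemma size_wpoly r w c x : (size (wpoly r w c x) <= r)%N.
Proof.
apply: (leq_trans (size_sum _ _ _)); apply/bigmax_leqP => i _.
by apply: (leq_trans (size_scale_leq _ _)); rewrite size_polyXn.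
Qed.

(* With E = xi^(p-1) + a_1 xi^(p-2) + ... + a_(p-1), one has xi E = - a_p on the curve,
   and the residue functional kills V, V' and takes the value 1 on E. *)
Lemma resid_cyclic v v' w w' t t' c x : v p c x = 0 -> v' p c x = 0 ->
  (forall i, (i < p)%N -> w i.+1 c x = v i.+1 c x + t * acoef a (p - i.+1) c x) ->
  (forall i, (i < p)%N -> w' i.+1 c x = v' i.+1 c x + t' * acoef a (p - i.+1) c x) ->
  resid (spoly p a c x) ('X^1 * wpoly p w c x * wpoly p w' c x) =
  hankel p a p.-1 p v v' c x - acoef a p c x * t * t'.
Proof.
move=> vp vp' wE wE'; set P := spoly p a c x.
pose E : {poly C} := \sum_(i < p) acoef a (p - i.+1) c x *: 'X^i.
have VE (u : nat -> K_family S) : u p c x = 0 -> wpoly p u c x = wpoly p.-1 u c x.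
  by move=> up; rewrite /wpoly; case: p p0 up => // q _ up; rewrite big_ord_recr /= up scale0r addr0.
have FE (u z : nat -> K_family S) (s : C) : z p c x = 0 ->
    (forall i, (i < p)%N -> u i.+1 c x = z i.+1 c x + s * acoef a (p - i.+1) c x) ->
    wpoly p u c x = wpoly p.-1 z c x + s *: E.
  move=> zp uE; rewrite -VE// /E /wpoly scaler_sumr -big_split; apply: eq_bigr => i _ /=.
  by rewrite uE// scalerDl scalerA.
have XE : 'X * E = P - (acoef a p c x)%:P.
  rewrite /P spoly_split /E; case: p p0 => // q _.
  rewrite mulr_sumr big_ord_recr [in RHS]big_ord_recl /= subn0 subnn expr0 alg_polyC.
  rewrite -scalerAr -exprS /acoef /= scale1r.
  have -> : \sum_(i < q) 'X * ((if (q.+1 - i.+1 == 0)%N then (fun=> (fun=> 1)) else a (q.+1 - i.+1)%N) c x *: 'X^i) =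
    \sum_(i < q) (if (q.+1 - bump 0 i == 0)%N then (fun=> (fun=> 1)) else a (q.+1 - bump 0 i)%N) c x *: 'X^(bump 0 i) :> {poly C}.
    by apply: eq_bigr => i _; rewrite -scalerAr -exprS.
  by ring.
have szP : size P = p.+1 := size_spoly p a c x.
have rs (u : nat -> K_family S) : resid P (wpoly p.-1 u c x) = 0.
  have su := size_wpoly p.-1 u c x.
  rewrite resid_small szP; last by apply: leq_ltn_trans su _; lia.
  by rewrite nth_default//=.
have rE : resid P E = 1.
  have EW : E = wpoly p (fun k _ _ => acoef a (p - k) c x) c x by [].
  rewrite resid_small szP; last by rewrite EW ltnS; apply: leq_trans (size_wpoly _ _ _ _) _.
  have p1 : (p.-1 < p)%N by rewrite prednK.
  rewrite /E coef_sum (bigD1 (Ordinal p1))//=.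
  rewrite coefZ coefXn eqxx mulr1 (_ : (p - p.-1.+1)%N = 0%N); last by lia.
  rewrite big1 ?addr0// => i ip.
  rewrite coefZ coefXn; case: eqP => [Ei|]; last by rewrite mulr0.
  by case/eqP: ip; apply: val_inj.
rewrite (FE w v t vp wE) (FE w' v' t' vp' wE') (@hankelE _ _ p a p0 p.-1 p 1%N)//; last by rewrite addn1.
set V := wpoly p.-1 v c x; set V' := wpoly p.-1 v' c x.
rewrite expr1; set A := acoef a p c x.
(* Replacing X E by P - A lowers every product containing E to a multiple of P plus a combination of
   V, V' and E. *)
have -> : 'X * (V + t *: E) * (V' + t' *: E) =
  'X * V * V' + P * (t *: V' + t' *: V + (t * t') *: E)
  + ((- (A * t)) *: V' + (- (A * t')) *: V + (- (A * t * t')) *: E).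
  have -> : P = 'X * E + A%:P by rewrite XE subrK.
  rewrite -!mul_polyC !polyCN !polyCM; ring.
by rewrite !residD resid_mul !residZ !rs rE; ring.
Qed.

End CyclicResidue.

(** * The map psi from the explicit to the spectral V *)

Section Psi.
Context {R : realType} {S : riemann_surface R}.
Local Notation C := (Cx R).
Variables (p : nat) (a : nat -> K_family S) (D Dp Dm : set S) (e : S -> C)
  (N : line_bundle S) (sp : lb_family N)
  (sm : lb_family (lb_tensor (Kpow S (2 * p)%:Z) (lb_pow N (-1)))).
Hypothesis p0 : (0 < p)%N.
Hypothesis aS : forall k, (1 <= k <= p)%N -> sections (Kpow S (2 * k)%:Z) setT (a k).
Hypothesis areg : regular p a.
Hypothesis DU : Dp `|` Dm = D.
Hypothesis DI : Dp `&` Dm = set0.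
Hypothesis ep : forall x, Dp x -> e x = 1.
Hypothesis em : forall x, Dm x -> e x = -1.
Hypothesis NB : is_line_bundle N.
Hypothesis spD : section_with_divisor sp Dp.
Hypothesis smD : section_with_divisor sm Dm.
Hypothesis spm : forall c j x, dom c x -> lb_dom j x -> sp j x * sm (c, j) x = a p c x / 2.
Implicit Types (c d : chart S) (x y : S) (i j : lb_idx N).

Local Notation LB m := (lb_tensor (Kpow S m) N).
Local Notation LBd m := (lb_tensor (Kpow S m) (lb_pow N (-1))).

Lemma LB_tr m U g c d i j x : sections (LB m) U g -> U x -> dom c x -> dom d x ->
  lb_dom i x -> lb_dom j x -> g (d, j) x = g (c, i) x * (kap c d x ^ m * lb_tr i j x).
Proof. by move=> [_ gt _] Ux cx dx ix jx; exact: (gt (c, i) (d, j) x Ux (conj cx ix) (conj dx jx)). Qed.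

Lemma LBd_tr m U g c d i j x : sections (LBd m) U g -> U x -> dom c x -> dom d x ->
  lb_dom i x -> lb_dom j x -> g (d, j) x = g (c, i) x * (kap c d x ^ m * (lb_tr i j x)^-1).
Proof. by move=> [_ gt _] Ux cx dx ix jx; exact: (gt (c, i) (d, j) x Ux (conj cx ix) (conj dx jx)). Qed.

Lemma sm_open (q : lb_idx (LBd (2 * p)%:Z)) : open (lb_dom q).
Proof. by apply: openI; [exact: dom_open|exact: (N_open NB)]. Qed.

Lemma sp_eq0 j x : lb_dom j x -> sp j x = 0 <-> Dp x.
Proof. exact: (div_eq0 spD). Qed.
Lemma sm_eq0 c j x : dom c x -> lb_dom j x -> sm (c, j) x = 0 <-> Dm x.
Proof. by move=> cx jx; apply: (@div_eq0 _ _ _ sm Dm smD (c, j)). Qed.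
Lemma sp_hol j x : lb_dom j x -> hol (sp j) x.
Proof. exact: (div_hol spD). Qed.
Lemma sm_hol c j x : dom c x -> lb_dom j x -> hol (sm (c, j)) x.
Proof. by move=> cx jx; apply: (@div_hol _ _ _ sm Dm smD (c, j)). Qed.

Lemma Dp_D x : Dp x -> D x. Proof. by rewrite -DU; left. Qed.
Lemma Dm_D x : Dm x -> D x. Proof. by rewrite -DU; right. Qed.
Lemma Dp_Dm x : Dp x -> ~ Dm x.
Proof. by move=> xp xm; have : (Dp `&` Dm) x by []; rewrite DI. Qed.
Lemma D_cases x : D x -> Dp x \/ Dm x. Proof. by rewrite -DU. Qed.

Lemma sp_neq0 j x : lb_dom j x -> ~ Dp x -> sp j x != 0.
Proof. by move=> jx H; apply/eqP => /(sp_eq0 jx). Qed.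
Lemma sm_neq0 c j x : dom c x -> lb_dom j x -> ~ Dm x -> sm (c, j) x != 0.
Proof. by move=> cx jx H; apply/eqP => /(sm_eq0 cx jx). Qed.

Lemma acoefp : acoef a p = a p.
Proof. by rewrite /acoef; case: eqP p0 => // ->. Qed.

Lemma acoefpE c j x : dom c x -> lb_dom j x -> acoef a p c x = 2 * (sp j x * sm (c, j) x).
Proof. by move=> cx jx; rewrite acoefp spm// mulrC divfK// pnatr_eq0. Qed.

Lemma D_acoef c x : dom c x -> D x <-> acoef a p c x = 0.
Proof.
move=> cx; have [j jx] := N_cover NB x; rewrite (acoefpE cx jx); split.
  move=> /D_cases[/(sp_eq0 jx) ->|/(sm_eq0 cx jx) ->]; by rewrite ?mul0r ?mulr0.
move/eqP; rewrite !mulf_eq0 pnatr_eq0 /= => /orP[/eqP/(sp_eq0 jx)|/eqP/(sm_eq0 cx jx)].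
  exact: Dp_D.
exact: Dm_D.
Qed.

Lemma zeta_neq0 c x y : dom c x -> dom c y -> y <> x -> coord c y - coord c x != 0.
Proof. by move=> cx cy yx; rewrite subr_eq0; apply/eqP => /(coord_inj cy cx). Qed.

(** Near a zero s_+ or s_- is the coordinate times a nonvanishing function; near any other point it
    has no zero. *)
Lemma D_isolated x : \forall y \near x, y <> x -> ~ D y.
Proof.
have [c cx] := dom_cover x; have [j jx] := N_cover NB x.
have cn := nbhs_open (dom_open c) cx; have jn := nbhs_open (N_open NB j) jx.
have spn : \forall y \near x, y <> x -> ~ Dp y.
  have [xp|xp] := pselect (Dp x).
    have [q qn qE] := div_factor spD (N_open NB) xp cx jx.
    apply: filterS2 (filterI qn qE) (filterI cn jn) => y [[_ q0] yE] [cy jy] yx /(sp_eq0 jy)/eqP.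
    by rewrite yE mulf_eq0 (negPf q0) (negPf (zeta_neq0 cx cy yx)).
  apply: filterS2 jn (scts_neq0 (hol_scts (sp_hol jx)) (sp_neq0 jx xp)) => y jy s0 _ /(sp_eq0 jy) s1.
  by rewrite s1 eqxx in s0.
have smn : \forall y \near x, y <> x -> ~ Dm y.
  have [xm|xm] := pselect (Dm x).
    have [q qn qE] := @div_factor _ _ _ sm Dm smD sm_open c (c, j) x xm cx (conj cx jx).
    apply: filterS2 (filterI qn qE) (filterI cn jn) => y [[_ q0] yE] [cy jy] yx /(sm_eq0 cy jy)/eqP.
    by rewrite yE mulf_eq0 (negPf q0) (negPf (zeta_neq0 cx cy yx)).
  apply: filterS2 (filterI cn jn) (scts_neq0 (hol_scts (sm_hol cx jx)) (sm_neq0 cx jx xm)).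
  by move=> y [cy jy] s0 _ /(sm_eq0 cy jy) s1; rewrite s1 eqxx in s0.
by apply: filterS2 spn smn => y h1 h2 yx /D_cases[/(h1 yx)|/(h2 yx)].
Qed.

Lemma notD_near x : ~ D x -> \forall y \near x, ~ D y.
Proof.
by move=> xD; apply: filterS (D_isolated x) => y h; have [->|/h] := pselect (y = x).
Qed.

Lemma open_minusD (U : set S) : open U -> open (U `\` D).
Proof.
move=> Uo; apply: open_near => x [Ux xD].
by apply: filterS2 (nbhs_open Uo Ux) (notD_near xD) => y.
Qed.

(** The functions t and b carry no index of N, so one trivialisation is chosen at each point;
    [psi_frac_tr] shows that the choice is immaterial. *)
Definition idx_at : S -> lb_idx N := projT1 (boolp.choice (N_cover NB)).
Lemma idx_atP x : lb_dom (idx_at x) x. Proof. exact: (projT2 (boolp.choice (N_cover NB))). Qed.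

Local Notation rawV := ((nat -> K_family S) * (chart S * lb_idx N -> S -> C)
  * (chart S * lb_idx N -> S -> C))%type.
Implicit Types (v : rawV).

(* The functions t and b of the header, set to 0 on D, where s_+ or s_- vanishes. *)
Definition psi_top v : K_family S := fun c x => if `[< D x >] then 0 else
  v.1.2 (c, idx_at x) x / (2 * sp (idx_at x) x) - v.2 (c, idx_at x) x / (2 * sm (c, idx_at x) x).
Definition psi_snd v : K_family S := fun c x => if `[< D x >] then 0 else
  - (v.1.2 (c, idx_at x) x / (2 * sp (idx_at x) x) + v.2 (c, idx_at x) x / (2 * sm (c, idx_at x) x)).
(** The coefficients of the function f of the header: a_(p-k) is the coefficient of xi^(k-1) in the
    bracket that t multiplies. *)
Definition psi_coef v : nat -> K_family S := fun k c x =>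
  if `[< D x \/ ~~ (1 <= k <= p)%N >] then 0 else v.1.1 k c x + psi_top v c x * acoef a (p - k) c x.

Section PsiSection.
Variables (n : int) (U : set S) (v : rawV).
Hypothesis Uo : open U.
Hypothesis v1 : K_sum_sections p.-1 (p%:Z + n) U v.1.1.
Hypothesis v2 : sections (LB (- p%:Z + n)) U v.1.2.
Hypothesis v3 : sections (LBd (p%:Z + n)) U v.2.

Lemma g_hol c j x : U x -> dom c x -> lb_dom j x -> hol (v.1.2 (c, j)) x.
Proof. by move=> Ux cx jx'; refine (@sec_hol R S (LB (- p%:Z + n)) U v.1.2 (c, j) x v2 Ux (conj cx jx')). Qed.
Lemma h_hol c j x : U x -> dom c x -> lb_dom j x -> hol (v.2 (c, j)) x.
Proof. by move=> Ux cx jx'; refine (@sec_hol R S (LBd (p%:Z + n)) U v.2 (c, j) x v3 Ux (conj cx jx')). Qed.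

(** N cancels in both fractions: B by O(D_+) and the dual of B by O(D_-) = K^(2p) N^(-1) both leave
    K^(-p). *)
Lemma psi_frac_tr c d i j x : U x -> ~ D x -> dom c x -> dom d x -> lb_dom i x -> lb_dom j x ->
  v.1.2 (d, j) x / (2 * sp j x) = v.1.2 (c, i) x / (2 * sp i x) * kap c d x ^ (n - p%:Z) /\
  v.2 (d, j) x / (2 * sm (d, j) x) = v.2 (c, i) x / (2 * sm (c, i) x) * kap c d x ^ (n - p%:Z).
Proof.
move=> Ux xD cx dx ix jx'.
have k0 : kap c d x != 0 by exact: kap_neq0.
have t0 : lb_tr i j x != 0 by exact: (N_tr_neq0 NB).
have nDp : ~ Dp x by move=> /Dp_D.
have nDm : ~ Dm x by move=> /Dm_D.
have s1 := sp_neq0 ix nDp; have s2 := sm_neq0 cx ix nDm.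
rewrite (LB_tr v2 Ux cx dx ix jx') (LBd_tr v3 Ux cx dx ix jx').
rewrite (sec_tr (div_sec spD) I ix jx') (LBd_tr (div_sec smD) I cx dx ix jx').
have E1 : kap c d x ^ (- p%:Z + n) = kap c d x ^ (n - p%:Z) by rewrite addrC.
have E2 : kap c d x ^ (p%:Z + n) = kap c d x ^ (n - p%:Z) * kap c d x ^ (2 * p)%:Z.
  by rewrite -expfzDr//; congr (_ ^ _); lia.
rewrite E1 E2; have k2 : kap c d x ^ (2 * p)%:Z != 0 by rewrite expfz_neq0.
move: (kap c d x ^ (n - _)) (kap c d x ^ (2 * p)%:Z) k2 => A B B0.
by split; field; rewrite ?s1 ?s2 ?t0 ?B0.
Qed.

Lemma psi_topE c j x : U x -> ~ D x -> dom c x -> lb_dom j x ->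
  psi_top v c x = v.1.2 (c, j) x / (2 * sp j x) - v.2 (c, j) x / (2 * sm (c, j) x).
Proof.
move=> Ux xD cx jx'; rewrite /psi_top; case: asboolP => // _.
have [-> ->] := psi_frac_tr Ux xD cx cx jx' (idx_atP x).
by rewrite (kap_self cx) exp1rz !mulr1.
Qed.

Lemma psi_sndE c j x : U x -> ~ D x -> dom c x -> lb_dom j x ->
  psi_snd v c x = - (v.1.2 (c, j) x / (2 * sp j x) + v.2 (c, j) x / (2 * sm (c, j) x)).
Proof.
move=> Ux xD cx jx'; rewrite /psi_snd; case: asboolP => // _.
have [-> ->] := psi_frac_tr Ux xD cx cx jx' (idx_atP x).
by rewrite (kap_self cx) exp1rz !mulr1.
Qed.

Lemma psi_frac_hol c j x : U x -> ~ D x -> dom c x -> lb_dom j x ->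
  hol (fun y => v.1.2 (c, j) y / (2 * sp j y)) x /\ hol (fun y => v.2 (c, j) y / (2 * sm (c, j) y)) x.
Proof.
move=> Ux xD cx jx'.
have s1 : 2 * sp j x != 0.
  by rewrite mulf_neq0 ?pnatr_eq0//; apply: sp_neq0 => // /Dp_D.
have s2 : 2 * sm (c, j) x != 0.
  by rewrite mulf_neq0 ?pnatr_eq0//; apply: sm_neq0 => // /Dm_D.
have h1 : hol (fun y => 2 * sp j y) x := holM (@holC _ _ 2 x) (sp_hol jx').
have h2 : hol (fun y => 2 * sm (c, j) y) x := holM (@holC _ _ 2 x) (sm_hol cx jx').
split; first exact: (holM (g_hol Ux cx jx') (holV s1 h1)).
exact: (holM (h_hol Ux cx jx') (holV s2 h2)).
Qed.

Lemma UD_near c x : (U `\` D) x -> dom c x -> \forall y \near x, [/\ U y, ~ D y, dom c y & lb_dom (idx_at x) y].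
Proof.
move=> [Ux xD] cx.
apply: filterS2 (filterI (nbhs_open Uo Ux) (notD_near xD))
  (filterI (nbhs_open (dom_open c) cx) (nbhs_open (N_open NB _) (idx_atP x))).
by move=> y [Uy yD] [cy jy].
Qed.

Lemma g_out c j x : ~ (U x /\ dom c x) -> v.1.2 (c, j) x = 0.
Proof. by move=> H; apply: (@sec_out R S (LB (- p%:Z + n)) U v.1.2 (c, j) x v2) => -[Ux [cx _]]; exact: H. Qed.
Lemma h_out c j x : ~ (U x /\ dom c x) -> v.2 (c, j) x = 0.
Proof. by move=> H; apply: (@sec_out R S (LBd (p%:Z + n)) U v.2 (c, j) x v3) => -[Ux [cx _]]; exact: H. Qed.

Lemma psi_top_sec : sections (Kpow S (n - p%:Z)) (U `\` D) (psi_top v).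
Proof.
apply: KpowI.
- move=> c x UDx cx; have [Ux xD] := UDx.
  have [h1 h2] := psi_frac_hol Ux xD cx (idx_atP x).
  apply: (@hol_near _ _ _ _ _ _ (holD h1 (holN h2))).
  by apply: filterS (UD_near UDx cx) => y [Uy yD cy jy]; rewrite (psi_topE Uy yD cy jy).
- move=> c d x [Ux xD] cx dx; have [h1 h2] := psi_frac_tr Ux xD cx dx (idx_atP x) (idx_atP x).
  by rewrite (psi_topE Ux xD cx (idx_atP x)) (psi_topE Ux xD dx (idx_atP x)) h1 h2 mulrBl.
move=> c x H; rewrite /psi_top; case: asboolP => // xD.
have H' : ~ (U x /\ dom c x) by move=> -[Ux cx]; apply: H.
by rewrite (g_out _ H') (h_out _ H') !mul0r subr0.
Qed.

Lemma psi_snd_sec : sections (Kpow S (n - p%:Z)) (U `\` D) (psi_snd v).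
Proof.
apply: KpowI.
- move=> c x UDx cx; have [Ux xD] := UDx.
  have [h1 h2] := psi_frac_hol Ux xD cx (idx_atP x).
  apply: (@hol_near _ _ _ _ _ _ (holN (holD h1 h2))).
  by apply: filterS (UD_near UDx cx) => y [Uy yD cy jy]; rewrite (psi_sndE Uy yD cy jy).
- move=> c d x [Ux xD] cx dx; have [h1 h2] := psi_frac_tr Ux xD cx dx (idx_atP x) (idx_atP x).
  by rewrite (psi_sndE Ux xD cx (idx_atP x)) (psi_sndE Ux xD dx (idx_atP x)) h1 h2 -mulrDl mulNr.
move=> c x H; rewrite /psi_snd; case: asboolP => // xD.
have H' : ~ (U x /\ dom c x) by move=> -[Ux cx]; apply: H.
by rewrite (g_out _ H') (h_out _ H') !mul0r addr0 oppr0.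
Qed.

Lemma psi_coefE k c x : ~ D x -> (1 <= k <= p)%N -> psi_coef v k c x = v.1.1 k c x + psi_top v c x * acoef a (p - k) c x.
Proof. by move=> xD kp; rewrite /psi_coef kp; case: asboolP => // -[]. Qed.

Lemma v_p k : (p <= k)%N -> v.1.1 k = 0.
Proof. by move=> pk; apply: (v1.2); lia. Qed.

(** As v has no p-th slot and a_0 = 1, the top coefficient recovers t from the image; injectivity
    and surjectivity rest on this. *)
Lemma psi_coef_p c x : psi_coef v p c x = psi_top v c x.
Proof.
have [xD|xD] := pselect (D x).
  by rewrite /psi_coef /psi_top; case: asboolP => [_|[]]; [case: asboolP|left].
by rewrite psi_coefE ?p0 ?leqnn// v_p// subnn /acoef eqxx mulr1 add0r.
Qed.

Lemma v_hol k c x : U x -> dom c x -> hol (v.1.1 k c) x.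
Proof.
move=> Ux cx; have [kp|kp] := boolP (1 <= k <= p.-1)%N.
  exact: Kpow_hol (v1.1 k kp) Ux cx.
by rewrite (v1.2 k kp); exact: holC.
Qed.

Lemma psi_coef_sec : K_sum_sections p (p%:Z + n) (U `\` D) (psi_coef v).
Proof.
split=> k kp; last first.
  apply/funext => c; apply/funext => x; rewrite /psi_coef; case: asboolP => // -[]; by right.
have kp' : (p - k <= p)%N by exact: leq_subr.
apply: KpowI.
- move=> c x UDx cx; have [Ux xD] := UDx.
  have h1 := @v_hol k c x Ux cx; have h2 := Kpow_hol psi_top_sec UDx cx.
  have h3 := acoef_hol aS kp' cx.
  apply: (@hol_near _ _ _ _ _ _ (holD h1 (holM h2 h3))).
  by apply: filterS (UD_near UDx cx) => y [Uy yD cy jy]; rewrite psi_coefE.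
- move=> c d x UDx cx dx; have [Ux xD] := UDx.
  have k0 : kap c d x != 0 by exact: kap_neq0.
  rewrite !psi_coefE// (Kpow_tr psi_top_sec UDx cx dx) (acoef_tr aS kp' cx dx) mulrDl; congr (_ + _).
    have [kp1|kp1] := boolP (1 <= k <= p.-1)%N; last by rewrite (v1.2 k kp1) mul0r.
    exact: Kpow_tr (v1.1 k kp1) Ux cx dx.
  rewrite exprnP mulrACA -expfzDr//; congr (_ * _ ^ _); lia.
move=> c x H; rewrite /psi_coef; case: asboolP => // xD.
rewrite (Kpow_out psi_top_sec H) mul0r addr0.
have [kp1|kp1] := boolP (1 <= k <= p.-1)%N; last by rewrite (v1.2 k kp1).
apply: (Kpow_out (v1.1 k kp1)) => -[Ux cx]; apply: H; split => //; split => // xD'.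
by apply: xD; left.
Qed.

(** At D_+ only g / s_+ has a pole, and it enters t and b with opposite signs; at D_- only h / s_-
    has one, with equal signs. The chart c supplies the coordinate, d the trivialisation. *)
Lemma psi_top_snd_local c d x : U x -> D x -> dom c x -> dom d x ->
  exists T B : S -> C, [/\ \forall y \near x, hol T y /\ hol B y,
    \forall y \near x, y <> x -> T y = (coord c y - coord c x) * psi_top v d y /\
                                 B y = (coord c y - coord c x) * psi_snd v d y &
    T x = - (e x * B x)].
Proof.
move=> Ux xD cx dx; pose j := idx_at x; have jx' : lb_dom j x := idx_atP x.
pose ze y : C := coord c y - coord c x.
have zex : ze x = 0 by rewrite /ze subrr.
have cn := nbhs_open (dom_open c) cx; have dn := nbhs_open (dom_open d) dx.
have jn := nbhs_open (N_open NB j) jx'; have Un := nbhs_open Uo Ux.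
have all4 : \forall y \near x, [/\ U y, dom c y, dom d y & lb_dom j y].
  by apply: filterS2 (filterI Un cn) (filterI dn jn) => y [? ?] [].
have zeh y : dom c y -> hol ze y.
  by move=> cy; apply: holD; [exact: hol_coord|exact: holC].
have Gh y : U y -> dom d y -> lb_dom j y -> hol (v.1.2 (d, j)) y by exact: g_hol.
have Hh y : U y -> dom d y -> lb_dom j y -> hol (v.2 (d, j)) y by exact: h_hol.
have C2 : (2 : C) != 0 by rewrite pnatr_eq0.
(* [A] and [B] stand for the extensions of the coordinate times g / (2 s_+) and h / (2 s_-); the two
   kinds of points differ only in which of them is nonzero at x. *)
have fin (A B : S -> C) : (\forall y \near x, hol A y) -> (\forall y \near x, hol B y) ->
    (\forall y \near x, y <> x -> A y = ze y * (v.1.2 (d, j) y / (2 * sp j y)) /\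
       B y = ze y * (v.2 (d, j) y / (2 * sm (d, j) y))) ->
    A x - B x = - (e x * - (A x + B x)) ->
  exists T B : S -> C, [/\ \forall y \near x, hol T y /\ hol B y,
    \forall y \near x, y <> x -> T y = ze y * psi_top v d y /\ B y = ze y * psi_snd v d y &
    T x = - (e x * B x)].
  move=> Ah Bh AB ABx; exists (fun y => A y + - B y), (fun y => - (A y + B y)); split => //.
    apply: filterS2 Ah Bh => y Ay By; split; first exact: (holD Ay (holN By)).
    exact: (holN (holD Ay By)).
  apply: filterS3 AB all4 (D_isolated x) => y ABy [Uy cy dy jy] Dy yx.
  have [-> ->] := ABy yx; have yD := Dy yx.
  by rewrite (psi_topE Uy yD dy jy) (psi_sndE Uy yD dy jy); split; ring.
have [xp|xm] := D_cases xD.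
  have [q qn qE] := div_factor spD (N_open NB) xp cx jx'.
  have nm : ~ Dm x := Dp_Dm xp.
  have smn := scts_neq0 (hol_scts (sm_hol dx jx')) (sm_neq0 dx jx' nm).
  apply: (fin (fun y => v.1.2 (d, j) y / (2 * q y)) (fun y => ze y * (v.2 (d, j) y / (2 * sm (d, j) y)))).
  - apply: filterS2 all4 qn => y [Uy cy dy jy] [qh q0].
    have q2 : 2 * q y != 0 by rewrite mulf_neq0.
    exact: (holM (Gh y Uy dy jy) (holV q2 (holM (@holC _ _ 2 y) qh))).
  - apply: filterS2 all4 smn => y [Uy cy dy jy] s0.
    have s2 : 2 * sm (d, j) y != 0 by rewrite mulf_neq0.
    exact: (holM (zeh y cy) (holM (Hh y Uy dy jy) (holV s2 (holM (@holC _ _ 2 y) (sm_hol dy jy))))).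
  - apply: filterS3 all4 qn qE => y [Uy cy dy jy] [qh q0] sE yx; split => //.
    have z0 : ze y != 0 by exact: zeta_neq0 cx cy yx.
    by rewrite sE -/(ze y); field; rewrite z0 q0.
  - by rewrite zex (ep xp) !mul0r; ring.
have [q qn qE] := @div_factor _ _ _ sm Dm smD sm_open c (d, j) x xm cx (conj dx jx').
have np : ~ Dp x by move=> xp; exact: Dp_Dm xp xm.
have spn := scts_neq0 (hol_scts (sp_hol jx')) (sp_neq0 jx' np).
apply: (fin (fun y => ze y * (v.1.2 (d, j) y / (2 * sp j y))) (fun y => v.2 (d, j) y / (2 * q y))).
- apply: filterS2 all4 spn => y [Uy cy dy jy] s0.
  have s2 : 2 * sp j y != 0 by rewrite mulf_neq0.
  exact: (holM (zeh y cy) (holM (Gh y Uy dy jy) (holV s2 (holM (@holC _ _ 2 y) (sp_hol jy))))).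
- apply: filterS2 all4 qn => y [Uy cy dy jy] [qh q0].
  have q2 : 2 * q y != 0 by rewrite mulf_neq0.
  exact: (holM (Hh y Uy dy jy) (holV q2 (holM (@holC _ _ 2 y) qh))).
- apply: filterS3 all4 qn qE => y [Uy cy dy jy] [qh q0] sE yx; split => //.
  have z0 : ze y != 0 by exact: zeta_neq0 cx cy yx.
  by rewrite sE -/(ze y); field; rewrite z0 q0.
- by rewrite zex (em xm) !mul0r; ring.
Qed.

Lemma Kpow_extension (m : int) (A : set S) (s : K_family S) : open A ->
  sections (Kpow S m) (A `\` D) s ->
  (forall x c, A x -> D x -> dom c x -> exists2 f : S -> C,
     \forall y \near x, hol f y & \forall y \near x, y <> x -> s c y = f y) ->
  exists2 s', sections (Kpow S m) A s' & forall c y, ~ D y -> s' c y = s c y.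
Proof.
move=> Ao ss H; apply: (@section_extension _ _ (Kpow S m) A D s Ao _ _ D_isolated ss H).
- by move=> c; exact: dom_open.
- by move=> c d x cx dx; exact: Kpow_tr_scts.
Qed.

Lemma Kpow_mulf (m : int) (A : set S) (f : S -> C) (s : K_family S) :
  (forall x, A x -> hol f x) -> sections (Kpow S m) A s ->
  sections (Kpow S m) A (fun c y => f y * s c y).
Proof.
move=> fh sS; apply: KpowI.
- by move=> c x Ax cx; apply: holM; [exact: fh|exact: Kpow_hol sS Ax cx].
- by move=> c d x Ax cx dx; rewrite (Kpow_tr sS Ax cx dx) mulrA.
by move=> c x H; rewrite (Kpow_out sS H) mulr0.
Qed.

Lemma Kpow_cut (m : int) (A B : set S) (s : K_family S) : open B -> B `<=` A ->
  sections (Kpow S m) A s -> sections (Kpow S m) B (cut B s).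
Proof.
move=> Bo BA sS; apply: KpowI.
- move=> c x Bx cx; apply: (@hol_near _ _ (s c)); last exact: Kpow_hol sS (BA _ Bx) cx.
  by apply: filterS (nbhs_open Bo Bx) => y By; rewrite /cut /patch mem_set.
- by move=> c d x Bx cx dx; rewrite /cut /patch mem_set//; exact: Kpow_tr sS (BA _ Bx) cx dx.
move=> c x H; rewrite /cut /patch; case: ifP => // /set_mem Bx.
by apply: (Kpow_out sS) => -[_ cx]; exact: H.
Qed.

(** The witnesses are built on coefficients and then transported by [phi], so that all extensions
    take place for sections of powers of K on the surface. *)
Lemma psi_residue x : U x -> D x -> residue_in_Gamma p a D e n x (phi p a (psi_coef v)) (psi_snd v).
Proof.
move=> Ux xD c cx ze.
pose zf (y : S) : C := coord c y - coord c x.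
have [A [Ao Ax AP]] : exists A : set S, [/\ open A, A x & forall y, A y ->
    [/\ U y, dom c y & y <> x -> ~ D y]].
  apply/nbhs_openP; apply: filterS3 (nbhs_open Uo Ux) (nbhs_open (dom_open c) cx) (D_isolated x).
  by move=> y; split.
have AU : A `<=` U by move=> y /AP[].
have Ac : A `<=` dom c by move=> y /AP[].
have AD y : A y -> D y -> y = x.
  by move=> /AP[_ _ h] yD; apply: contrapT => yx; exact: h yx yD.
have ADo := open_minusD Ao.
have sub : A `\` D `<=` U `\` D by move=> y [/AU ? ?].
have zfh y : A y -> hol zf y.
  by move=> /Ac cy; apply: holD; [exact: hol_coord|exact: holC].
have zfx : zf x = 0 by rewrite /zf subrr.
have zf0 y : A y -> ~ D y -> zf y != 0.
  move=> Ay yD; apply: zeta_neq0 cx (Ac y Ay) _ => yx; apply: yD; by rewrite yx.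
have zn := nbhs_open Ao Ax.
(* The coordinate times the k-th coefficient of f extends over x; together these give f1. *)
have uex k : exists uk : K_family S, (1 <= k <= p)%N ->
    sections (Kpow S (p%:Z + n - (2 * k)%:Z)) A uk /\
    (forall d y, A y -> ~ D y -> uk d y = zf y * psi_coef v k d y).
  have [kp|kp] := boolP (1 <= k <= p)%N; last by exists (fun _ _ => 0).
  have s1 : sections (Kpow S (p%:Z + n - (2 * k)%:Z)) (A `\` D) (fun d y => zf y * cut (A `\` D) (psi_coef v k) d y).
    apply: Kpow_mulf; first by move=> y [Ay _]; exact: zfh.
    apply: (Kpow_cut ADo sub); exact: psi_coef_sec.1 k kp.
  have [|uk uk1 uk2] := Kpow_extension Ao s1.
    move=> y d Ay yD dy; have E := AD y Ay yD; subst y.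
    have [T [B [TBh TB _]]] := psi_top_snd_local Ux xD cx dy.
    exists (fun y => zf y * v.1.1 k d y + T y * acoef a (p - k) d y).
      apply: filterS3 TBh zn (nbhs_open (dom_open d) dy) => y [Th _] Ay' dy'.
      apply: (holD (holM (zfh y Ay') (@v_hol k d y (AU y Ay') dy')) (holM Th _)).
      by apply: (acoef_hol aS) => //; exact: leq_subr.
    apply: filterS2 TB zn => y H Ay' yx; have [Ty _] := H yx.
    have yD' : ~ D y by have [_ _] := AP y Ay'; apply.
    by rewrite /cut /patch mem_set// psi_coefE// Ty mulrDr mulrA.
  exists uk => _; split => // d y Ay yD; rewrite uk2// /cut /patch mem_set//.
have [u0 u0P] := boolp.choice uex.
pose u k : K_family S := if (1 <= k <= p)%N then u0 k else 0.
have uE k d y : (1 <= k <= p)%N -> A y -> ~ D y -> u k d y = zf y * psi_coef v k d y.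
  by move=> kp Ay yD; rewrite /u kp; have [_] := u0P k kp; apply.
have uS : K_sum_sections p (p%:Z + n) A u.
  split=> k kp; last by rewrite /u (negPf kp).
  by rewrite /u kp; case: (u0P k kp).
have [be beS beE] : exists2 be : K_family S, sections (Kpow S (n - p%:Z)) A be &
    forall d y, A y -> ~ D y -> be d y = zf y * psi_snd v d y.
  have s1 : sections (Kpow S (n - p%:Z)) (A `\` D) (fun d y => zf y * cut (A `\` D) (psi_snd v) d y).
    apply: Kpow_mulf; first by move=> y [Ay _]; exact: zfh.
    apply: (Kpow_cut ADo sub); exact: psi_snd_sec.
  have [|be be1 be2] := Kpow_extension Ao s1.
    move=> y d Ay yD dy; have E := AD y Ay yD; subst y.
    have [T [B [TBh TB _]]] := psi_top_snd_local Ux xD cx dy.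
    exists B; first by apply: filterS TBh => y [].
    apply: filterS2 TB zn => y H Ay' yx; have [_ By] := H yx.
    have yD' : ~ D y by have [_ _] := AP y Ay'; apply.
    by rewrite /cut /patch mem_set// By.
  by exists be => // d y Ay yD; rewrite be2// /cut /patch mem_set.
have pp : (1 <= p <= p)%N by rewrite p0 leqnn.
(* In the limit the contribution of v disappears, and the residue of f is the residue of t times the
   coefficients of E. *)
have at_x d : dom d x -> (forall k, (1 <= k <= p)%N -> u k d x = u p d x * acoef a (p - k) d x) /\
    u p d x = - (e x * be d x).
  move=> dx; have [T [B [TBh TB TBx]]] := psi_top_snd_local Ux xD cx dx.
  have [Th Bh] := nbhs_singleton TBh.
  have lim k : (1 <= k <= p)%N -> u k d x = T x * acoef a (p - k) d x.
    move=> kp; have h := hol_scts (Kpow_hol (uS.1 k kp) Ax dx).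
    have h1 : hol (fun y => zf y * v.1.1 k d y + T y * acoef a (p - k) d y) x.
      apply: (holD (holM (zfh x Ax) (@v_hol k d x Ux dx)) (holM Th _)).
      by apply: (acoef_hol aS) => //; exact: leq_subr.
    rewrite (scts_eq_limit h (hol_scts h1)); first by rewrite zfx mul0r add0r.
    apply: filterS2 TB zn => y H Ay yx; have [Ty _] := H yx.
    have yD : ~ D y by have [_ _] := AP y Ay; apply.
    by rewrite uE// psi_coefE// Ty mulrDr mulrA.
  have upT : u p d x = T x by rewrite lim// subnn mulr1.
  have beB : be d x = B x.
    apply: scts_eq_limit; [exact: hol_scts (Kpow_hol beS Ax dx)|exact: hol_scts|].
    apply: filterS2 TB zn => y H Ay yx; have [_ ->] := H yx.
    by rewrite beE//; have [_ _] := AP y Ay; apply.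
  by split; [move=> k kp; rewrite lim// upT|rewrite upT beB].
have gS := mul_xi_sec p0 aS uS.
(* The first entry is - u_p a_p, and a_p vanishes at x; the others cancel by the shape of the
   residue. *)
have gx k d : (1 <= k <= p)%N -> dom d x -> mul_xi p a u k d x = 0.
  move=> kp dx; rewrite /mul_xi kp; case: eqP => [->|/eqP k1].
    rewrite subn1 prednK// sub0r; apply/eqP; rewrite oppr_eq0; apply/eqP.
    by have /(D_acoef dx) -> := xD; rewrite mulr0.
  have kp' : (1 <= k.-1 <= p)%N by lia.
  rewrite (at_x d dx).1// (_ : (p - k.-1)%N = (p - k).+1); last by lia.
  by rewrite subrr.
(* Since xi f1 vanishes at x, its coefficients can be divided by the coordinate; the quotients give
   f2. *)
have qex k : exists uk : K_family S, (1 <= k <= p)%N ->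
    sections (Kpow S (p%:Z + n + 2 - (2 * k)%:Z)) A uk /\
    (forall d y, A y -> dom d y -> mul_xi p a u k d y = zf y * uk d y).
  have [kp|kp] := boolP (1 <= k <= p)%N; last by exists (fun _ _ => 0).
  have s1 : sections (Kpow S (p%:Z + n + 2 - (2 * k)%:Z)) (A `\` D)
      (fun d y => (zf y)^-1 * cut (A `\` D) (mul_xi p a u k) d y).
    apply: Kpow_mulf; first by move=> y [Ay yD]; apply: holV; [exact: zf0|exact: zfh].
    exact: (Kpow_cut ADo (@subDsetl _ A D) (gS.1 k kp)).
  have [|uk uk1 uk2] := Kpow_extension Ao s1.
    move=> y d Ay yD dy; have E := AD y Ay yD; subst y.
    have gh : \forall y \near x, hol (mul_xi p a u k d) y.
      by apply: filterS2 zn (nbhs_open (dom_open d) dy) => y Ay' dy'; exact: Kpow_hol (gS.1 k kp) Ay' dy'.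
    have [q [qh qE _]] := coord_quotient cx gh; exists q => //.
    apply: filterS2 qE zn => y yE Ay' yx.
    have yD' : ~ D y by have [_ _] := AP y Ay'; apply.
    by rewrite /cut /patch mem_set// yE (gx k d kp dy) add0r -/(zf y) mulKf//; exact: zf0.
  exists uk => _; split => // d y Ay dy; have [yD|yD] := pselect (D y).
    have E := AD y Ay yD; subst y; by rewrite gx// zfx mul0r.
  by rewrite uk2// /cut /patch mem_set// mulVKf//; exact: zf0.
have [u20 u20P] := boolp.choice qex.
pose u2 k : K_family S := if (1 <= k <= p)%N then u20 k else 0.
have u2S : K_sum_sections p (p%:Z + n + 2) A u2.
  split=> k kp; last by rewrite /u2 (negPf kp).
  by rewrite /u2 kp; case: (u20P k kp).
exists A, (phi p a u), (phi p a u2), be; split; [by split|split]; split => //.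
- apply: (@phi_in _ _ p a p0 aS (p%:Z - 2 + n) A u Ao).
  by rewrite (_ : p%:Z - 2 + n + 2 = p%:Z + n)//; ring.
- exact: (@phi_in _ _ p a p0 aS (p%:Z + n) A u2 Ao u2S).
- apply/funext => d; apply/funext => y; apply/funext => t; rewrite /cut /patch.
  case: ifP => // /set_mem [Ay yD]; rewrite /mul_curve /phi; case: ifP => _; last by rewrite mulr0.
  rewrite mulr_sumr; apply: eq_bigr => i _; by rewrite uE//; [rewrite mulrA|exact: ltn_ord].
- apply/funext => d; apply/funext => y; rewrite /cut /patch.
  by case: ifP => // /set_mem [Ay yD]; rewrite beE.
- rewrite -(phi_mul_xi a p0); apply/funext => d; apply/funext => y; apply/funext => t.
  rewrite /mul_curve /phi; case: ifP => tr; last by rewrite mulr0.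
  rewrite mulr_sumr; apply: eq_bigr => i _; rewrite mulrA; congr (_ * _).
  have ip : (1 <= i.+1 <= p)%N by have := ltn_ord i.
  have [[Ay dy]|H] := pselect (A y /\ dom d y).
    by rewrite /u2 ip; have [_ ->] := u20P i.+1 ip.
  by rewrite (Kpow_out (gS.1 _ ip) H) (Kpow_out (u2S.1 _ ip) H) mulr0.
have r0 : root (spoly p a c x) 0.
  rewrite rootE (horner_coef0 (spoly p a c x)) (coef_spoly p a) leq0n subn0.
  by apply/eqP/(D_acoef cx).
rewrite phiE// (bigD1 (Ordinal p0)) //= big1 ?addr0; last first.
  move=> i i0; rewrite expr0n; case: eqP => [E|_]; last by rewrite mulr0.
  by case/eqP: i0; apply: val_inj.
have [h1 h2] := at_x c cx.
rewrite expr0 mulr1 h1; last by rewrite p0.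
by rewrite h2 subn1; ring.
Qed.

End PsiSection.

(** The gluing condition read on coefficients. Divisibility of xi f1 by the coordinate forces u_k =
    u_p a_(p-k) at x, so f1 takes the value u_p a_(p-1) at x'. By regularity a_(p-1) is nonzero
    there and cancels from the condition. *)
Lemma residue_coef n (U : set S) F b x : open U ->
  K_sum_sections p (p%:Z + n) (U `\` D) F -> U x -> D x ->
  residue_in_Gamma p a D e n x (phi p a F) b -> forall c, dom c x ->
  exists (A : set S) (u : nat -> K_family S) (be : K_family S),
  [/\ open A, A x & A `<=` dom c] /\
  [/\ K_sum_sections p (p%:Z + n) A u, sections (Kpow S (n - p%:Z)) A be,
      forall k d y, (1 <= k <= p)%N -> A y -> U y -> ~ D y -> dom d y ->
        u k d y = (coord c y - coord c x) * F k d y,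
      forall d y, A y -> ~ D y -> be d y = (coord c y - coord c x) * b d y &
      (forall k, (1 <= k <= p)%N -> u k c x = u p c x * acoef a (p - k) c x) /\
      u p c x = - (e x * be c x)].
Proof.
move=> Uo FS Ux xD res c cx.
have [A [f1 [f2 [be [[Ao Ax Ac] [[f1S f2S beS] [E1 E2 E3 E4]]]]]]] := res c cx.
have [u uS uE] := @phi_surj _ _ p a p0 aS areg _ A f1 Ao f1S.
have {}uS : K_sum_sections p (p%:Z + n) A u.
  by move: uS; rewrite (_ : p%:Z - 2 + n + 2 = p%:Z + n)//; ring.
have [u2 u2S u2E] := @phi_surj _ _ p a p0 aS areg _ A f2 Ao f2S.
have gS := mul_xi_sec p0 aS uS.
pose zf (y : S) : C := coord c y - coord c x.
have zfh y : A y -> hol zf y.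
  by move=> /Ac cy; apply: holD; [exact: hol_coord|exact: holC].
have uF k d y : (1 <= k <= p)%N -> A y -> U y -> ~ D y -> dom d y -> u k d y = zf y * F k d y.
  case: k => // k kp Ay Uy yD dy.
  refine (@coef_uniq _ _ p a p0 aS areg d y (fun i : nat => u i.+1 d) (fun (i : nat) z => zf z * F i.+1 d z) dy _ _ _ k kp).
  - by move=> i ip; apply: hol_scts; refine (Kpow_hol (uS.1 i.+1 _) Ay dy).
  - move=> i ip; apply: hol_scts; apply: (holM (zfh y Ay)).
    by refine (Kpow_hol (FS.1 i.+1 _) _ dy).
  apply: filterS3 (nbhs_open Ao Ay) (nbhs_open Uo Uy) (notD_near yD) => z Az Uz zD t tr.
  have := congr1 (fun f : curve_family S => f d z t) E1; rewrite /cut /patch mem_set//.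
  rewrite -uE /mul_curve !phiE// => ->; rewrite mulr_sumr; apply: eq_bigr => i _.
  by rewrite mulrA.
have gx k : (1 <= k <= p)%N -> mul_xi p a u k c x = 0.
  case: k => // k kp.
  have E : mul_xi p a u k.+1 c x = zf x * u2 k.+1 c x.
    refine (@coef_uniq _ _ p a p0 aS areg c x (fun i : nat => mul_xi p a u i.+1 c) (fun (i : nat) z => zf z * u2 i.+1 c z) cx _ _ _ k kp).
    - by move=> i ip; apply: hol_scts; refine (Kpow_hol (gS.1 i.+1 _) Ax cx).
    - by move=> i ip; apply: hol_scts; apply: (holM (zfh x Ax)); refine (Kpow_hol (u2S.1 i.+1 _) Ax cx).
    apply: filterS (nbhs_open Ao Ax) => z Az t tr.
    have := congr1 (fun f : curve_family S => f c z t) E3; rewrite -uE -(phi_mul_xi a p0) -u2E /mul_curve !phiE// => ->.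
    by rewrite mulr_sumr; apply: eq_bigr => i _; rewrite mulrA.
  by rewrite E /zf subrr mul0r.
have ux k : (1 <= k <= p)%N -> u k c x = u p c x * acoef a (p - k) c x.
  move=> kp; have [->|kp'] := eqVneq k p; first by rewrite subnn mulr1.
  have kp1 : (1 <= k.+1 <= p)%N by lia.
  move: (gx _ kp1); rewrite /mul_xi kp1 /= eqSS (_ : (p - k.+1).+1 = (p - k)%N); last by lia.
  by case: eqP => [k0|_ /eqP]; [lia|rewrite subr_eq0 => /eqP].
exists A, u, be; split; [by split|split => //].
  move=> d y Ay yD; have := congr1 (fun f : K_family S => f d y) E2.
  by rewrite /cut /patch mem_set.
split => //.
have p11 : (1 <= 1 <= p)%N by rewrite p0.
have ap0 : acoef a p c x = 0 by apply/(D_acoef cx).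
have a1 : acoef a p.-1 c x != 0.
  by apply/eqP => H; have [_ /(_ c x cx)] := areg; apply.
have r0 : root (spoly p a c x) 0.
  rewrite rootE (horner_coef0 (spoly p a c x)) (coef_spoly p a) leq0n subn0.
  by apply/eqP/(D_acoef cx).
move: E4; rewrite -uE phiE// (bigD1 (Ordinal p0)) //= big1 ?addr0; last first.
  move=> i i0; rewrite expr0n; case: eqP => [E|_]; last by rewrite mulr0.
  by case/eqP: i0; apply: val_inj.
rewrite expr0 mulr1 (ux _ p11) subn1 => E; apply: (mulIf a1); rewrite E; ring.
Qed.

Lemma quot_ext c x (G : S -> C) : dom c x -> (\forall y \near x, hol G y) -> G x = 0 ->
  exists2 q : S -> C, \forall y \near x, hol q y &
    \forall y \near x, G y = (coord c y - coord c x) * q y.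
Proof.
move=> cx Gh G0; have [q [qh qE _]] := coord_quotient cx Gh; exists q => //.
by apply: filterS qE => y ->; rewrite G0 add0r.
Qed.

Lemma sec_eq (L : line_bundle S) U (s s' : lb_family L) : sections L U s -> sections L U s' ->
  (forall (i : lb_idx L) x, U x -> lb_dom i x -> s i x = s' i x) -> s = s'.
Proof.
move=> sS s'S H; apply/funext => i; apply/funext => x.
have [[Ux ix]|ni] := pselect (U x /\ lb_dom i x); first exact: H.
by rewrite (sec_out sS ni) (sec_out s'S ni).
Qed.

Definition psi v : curve_family S * K_family S := (phi p a (psi_coef v), psi_snd v).

Definition V_secs n U v := [/\ K_sum_sections p.-1 (p%:Z + n) U v.1.1,
  sections (LB (- p%:Z + n)) U v.1.2 & sections (LBd (p%:Z + n)) U v.2].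

(** Off D the preimage is forced, with t the top coefficient of f; each of its components is then
    extended over D by means of [residue_coef]. *)
Lemma psi_surj n U f b : open U -> curve_sections p a (p%:Z - 2 + n) (U `\` D) f ->
  sections (Kpow S (n - p%:Z)) (U `\` D) b ->
  (forall x, U x -> D x -> residue_in_Gamma p a D e n x f b) ->
  exists2 v, V_secs n U v & psi v = (f, b).
Proof.
move=> Uo fS bS res; have UDo := open_minusD Uo.
have [F FS FE] := @phi_surj _ _ p a p0 aS areg _ _ f UDo fS.
have {}FS : K_sum_sections p (p%:Z + n) (U `\` D) F.
  by move: FS; rewrite (_ : p%:Z - 2 + n + 2 = p%:Z + n)//; ring.
have {}res x : U x -> D x -> residue_in_Gamma p a D e n x (phi p a F) b by rewrite FE; exact: res.
have pp : (1 <= p <= p)%N by rewrite p0 leqnn.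
have FpS := FS.1 p pp.
have Fp_tr c d x : (U `\` D) x -> dom c x -> dom d x -> F p d x = F p c x * kap c d x ^ (n - p%:Z).
  move=> Ux cx dx; rewrite (Kpow_tr FpS Ux cx dx); congr (_ * _ ^ _); lia.
have loc x d : U x -> D x -> dom d x -> exists (u : nat -> S -> C) (be : S -> C),
   [/\ (forall k, (1 <= k <= p)%N -> \forall y \near x, hol (u k) y), \forall y \near x, hol be y,
     (forall k, (1 <= k <= p)%N -> \forall y \near x, y <> x -> u k y = (coord d y - coord d x) * F k d y),
     \forall y \near x, y <> x -> be y = (coord d y - coord d x) * b d y &
     (forall k, (1 <= k <= p)%N -> u k x = u p x * acoef a (p - k) d x) /\ u p x = - (e x * be x)].
  move=> Ux xD dx; have [A [u [be [[Ao Ax Ad] [uS beS uF bF [u1 u2]]]]]] := residue_coef Uo FS Ux xD (res x Ux xD) dx.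
  exists (fun k => u k d), (be d); split => //.
  - move=> k kp; apply: filterS (nbhs_open Ao Ax) => y Ay; exact: Kpow_hol (uS.1 k kp) Ay (Ad y Ay).
  - apply: filterS (nbhs_open Ao Ax) => y Ay; exact: Kpow_hol beS Ay (Ad y Ay).
  - move=> k kp; apply: filterS3 (nbhs_open Ao Ax) (nbhs_open Uo Ux) (D_isolated x) => y Ay Uy yD yx.
    by apply: uF => //; [exact: yD|exact: Ad].
  - apply: filterS2 (nbhs_open Ao Ax) (D_isolated x) => y Ay yD yx.
    by apply: bF => //; exact: yD.
have dn d x : dom d x -> \forall y \near x, dom d y by move=> dx; exact: nbhs_open (dom_open d) dx.
have near_all d x : U x -> D x -> dom d x -> \forall y \near x, [/\ U y, dom d y & y <> x -> coord d y - coord d x != 0].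
  move=> Ux xD dx; apply: filterS2 (nbhs_open Uo Ux) (dn d x dx) => y Uy dy; split => // yx.
  exact: zeta_neq0.
have vex k : exists vk : K_family S, (1 <= k <= p.-1)%N ->
    sections (Kpow S (p%:Z + n - (2 * k)%:Z)) U vk /\
    (forall c y, ~ D y -> vk c y = F k c y - F p c y * acoef a (p - k) c y).
  have [kp|kp] := boolP (1 <= k <= p.-1)%N; last by exists (fun _ _ => 0).
  have kp1 : (1 <= k <= p)%N by lia.
  have kp2 : (p - k <= p)%N by exact: leq_subr.
  have s1 : sections (Kpow S (p%:Z + n - (2 * k)%:Z)) (U `\` D) (fun c y => F k c y - F p c y * acoef a (p - k) c y).
    apply: KpowI.
    - move=> c y Uy cy.
      have h1 := Kpow_hol (FS.1 k kp1) Uy cy; have h2 := Kpow_hol FpS Uy cy.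
      exact: (holD h1 (holN (holM h2 (acoef_hol aS kp2 cy)))).
    - move=> c d y Uy cy dy; rewrite (Kpow_tr (FS.1 k kp1) Uy cy dy) (Kpow_tr FpS Uy cy dy) (acoef_tr aS kp2 cy dy).
      have k0 : kap c d y != 0 by exact: kap_neq0.
      rewrite mulrBl; congr (_ - _); rewrite exprnP mulrACA -expfzDr//; congr (_ * _ ^ _); lia.
    by move=> c y H; rewrite (Kpow_out (FS.1 k kp1) H) (Kpow_out FpS H) mul0r subr0.
  have [|vk vk1 vk2] := Kpow_extension Uo s1; last by exists vk.
  move=> x d Ux xD dx; have [u [be [uh beh uF _ [ux _]]]] := loc x d Ux xD dx.
  have Gh : \forall y \near x, hol (fun y => u k y - u p y * acoef a (p - k) d y) y.
    apply: filterS3 (uh k kp1) (uh p pp) (dn d x dx) => y h1 h2 dy.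
    exact: (holD h1 (holN (holM h2 (acoef_hol aS kp2 dy)))).
  have G0 : u k x - u p x * acoef a (p - k) d x = 0 by rewrite (ux k kp1) subrr.
  have [q qh qE] := quot_ext dx Gh G0.
  exists q => //; apply: filterS3 (filterI (uF k kp1) (uF p pp)) qE (near_all d x Ux xD dx).
  move=> y [h1 h2] yE [Uy dy z0] yx; apply: (mulfI (z0 yx)).
  by rewrite -yE h1// h2//; ring.
have [v0 v0P] := boolp.choice vex.
pose vv k : K_family S := if (1 <= k <= p.-1)%N then v0 k else 0.
have vvS : K_sum_sections p.-1 (p%:Z + n) U vv.
  split=> k kp; last by rewrite /vv (negPf kp).
  by rewrite /vv kp; have [] := v0P k kp.
have trs m k0 := @KN_tr_scts _ _ N NB m k0.
have [g gS gE] : exists2 g, sections (LB (- p%:Z + n)) U g &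
    forall q y, ~ D y -> g q y = sp q.2 y * (F p q.1 y - b q.1 y).
  have s1 : sections (LB (- p%:Z + n)) (U `\` D) (fun q y => sp q.2 y * (F p q.1 y - b q.1 y)).
    apply: sectionsI.
    - move=> [c j] y Uy [cy jy] /=.
      have h1 := Kpow_hol FpS Uy cy; have h2 := Kpow_hol bS Uy cy.
      exact: (holM (sp_hol jy) (holD h1 (holN h2))).
    - move=> [c i] [d j] y Uy [cy iy] [dy jy] /=.
      rewrite (sec_tr (div_sec spD) I iy jy) (Fp_tr _ _ _ Uy cy dy) (Kpow_tr bS Uy cy dy) -/(kap c d y).
      by rewrite (addrC (- p%:Z)); ring.
    move=> [c j] y H /=; have [[Uy cy]|H1] := pselect ((U `\` D) y /\ dom c y).
      rewrite (sec_out (div_sec spD)) ?mul0r// => -[_ jy]; exact: H.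
    by rewrite (Kpow_out FpS H1) (Kpow_out bS H1) subrr mulr0.
  apply: (section_extension Uo _ _ D_isolated s1).
  - by move=> [c j]; apply: openI; [exact: dom_open|exact: (N_open NB)].
  - by rewrite (@tensor_KN R S N (- p%:Z + n)); exact: trs.
  move=> x [d j] Ux xD [dx jx'] /=; have [u [be [uh beh uF bF [_ ux]]]] := loc x d Ux xD dx.
  have jn := nbhs_open (N_open NB j) jx'.
  have Gh : \forall y \near x, hol (fun y => u p y - be y) y.
    apply: filterS2 (uh p pp) beh => y h1 h2; exact: (holD h1 (holN h2)).
  (* For g = s_+ (t - b): at D_+ the zero of s_+ absorbs the pole, at D_- the residues of t and b
     agree and there is none. *)
  have [xp|xm] := D_cases xD.
    have [q qn qE] := div_factor spD (N_open NB) xp dx jx'.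
    exists (fun y => q y * (u p y - be y)).
      apply: filterS2 qn Gh => y [h1 _] h2; exact: (holM h1 h2).
    apply: filterS3 (filterI (uF p pp) bF) qE (near_all d x Ux xD dx) => y [h1 h2] yE [Uy dy z0] yx.
    by rewrite yE h1// h2//; ring.
  have G0 : u p x - be x = 0 by rewrite ux (em xm); ring.
  have [q qh qE] := quot_ext dx Gh G0.
  exists (fun y => sp j y * q y).
    apply: filterS2 jn qh => y jy h2; exact: (holM (sp_hol jy) h2).
  apply: filterS3 (filterI (uF p pp) bF) qE (near_all d x Ux xD dx) => y [h1 h2] yE [Uy dy z0] yx.
  congr (_ * _); apply: (mulfI (z0 yx)); rewrite -yE h1// h2//; ring.
have [h hS hE] : exists2 h, sections (LBd (p%:Z + n)) U h &
    forall q y, ~ D y -> h q y = - (sm q y * (F p q.1 y + b q.1 y)).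
  have s1 : sections (LBd (p%:Z + n)) (U `\` D) (fun q y => - (sm q y * (F p q.1 y + b q.1 y))).
    apply: sectionsI.
    - move=> [c j] y Uy [cy jy] /=.
      have h1 := Kpow_hol FpS Uy cy; have h2 := Kpow_hol bS Uy cy.
      exact: (holN (holM (sm_hol cy jy) (holD h1 h2))).
    - move=> [c i] [d j] y Uy [cy iy] [dy jy] /=.
      rewrite (LBd_tr (div_sec smD) I cy dy iy jy) (Fp_tr _ _ _ Uy cy dy) (Kpow_tr bS Uy cy dy) -/(kap c d y).
      have k0 : kap c d y != 0 by exact: kap_neq0.
      have -> : kap c d y ^ (p%:Z + n) = kap c d y ^ (n - p%:Z) * kap c d y ^ (2 * p)%:Z.
        by rewrite -expfzDr//; congr (_ ^ _); lia.
      by rewrite exprN1 /=; ring.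
    move=> [c j] y H /=; have [[Uy cy]|H1] := pselect ((U `\` D) y /\ dom c y).
      have E : sm (c, j) y = 0.
        by apply: (@sec_out _ _ _ _ sm (c, j) y (div_sec smD)) => -[_ [_ jy]]; apply: H.
      by rewrite E mul0r oppr0.
    by rewrite (Kpow_out FpS H1) (Kpow_out bS H1) addr0 mulr0 oppr0.
  apply: (section_extension Uo _ _ D_isolated s1).
  - by move=> [c j]; apply: openI; [exact: dom_open|exact: (N_open NB)].
  - exact: trs.
  move=> x [d j] Ux xD [dx jx'] /=; have [u [be [uh beh uF bF [_ ux]]]] := loc x d Ux xD dx.
  have jn := nbhs_open (N_open NB j) jx'.
  have Gh : \forall y \near x, hol (fun y => u p y + be y) y.
    apply: filterS2 (uh p pp) beh => y h1 h2; exact: (holD h1 h2).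
  (* For h = - s_- (t + b) the roles are exchanged: at D_+ the residues of t and b are opposite, at
     D_- the zero of s_- absorbs the pole. *)
  have [xp|xm] := D_cases xD.
    have G0 : u p x + be x = 0 by rewrite ux (ep xp); ring.
    have [q qh qE] := quot_ext dx Gh G0.
    exists (fun y => - (sm (d, j) y * q y)).
      apply: filterS3 jn (dn d x dx) qh => y jy dy h2; exact: (holN (holM (sm_hol dy jy) h2)).
    apply: filterS3 (filterI (uF p pp) bF) qE (near_all d x Ux xD dx) => y [h1 h2] yE [Uy dy z0] yx.
    congr (- (_ * _)); apply: (mulfI (z0 yx)); rewrite -yE h1// h2//; ring.
  have [q qn qE] := @div_factor _ _ _ sm Dm smD sm_open d (d, j) x xm dx (conj dx jx').
  exists (fun y => - (q y * (u p y + be y))).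
    apply: filterS2 qn Gh => y [h1 _] h2; exact: (holN (holM h1 h2)).
  apply: filterS3 (filterI (uF p pp) bF) qE (near_all d x Ux xD dx) => y [h1 h2] yE [Uy dy z0] yx.
  by rewrite yE h1// h2//; ring.
exists (vv, g, h); first by split.
have C2 : (2 : C) != 0 by rewrite pnatr_eq0.
have tb c y : (U `\` D) y -> dom c y -> psi_top (vv, g, h) c y = F p c y /\ psi_snd (vv, g, h) c y = b c y.
  move=> [Uy yD] cy; have jy := idx_atP y.
  have s1 : sp (idx_at y) y != 0 by apply: sp_neq0 => // /Dp_D.
  have s2 : sm (c, idx_at y) y != 0 by apply: sm_neq0 => // /Dm_D.
  rewrite (@psi_topE n U (vv, g, h) gS hS c (idx_at y) y Uy yD cy jy) (@psi_sndE n U (vv, g, h) gS hS c (idx_at y) y Uy yD cy jy) /=.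
  by rewrite gE// hE//=; split; field; rewrite s1 s2.
congr pair.
  rewrite -FE; congr phi.
  apply: (Ksum_ext (@psi_coef_sec n U (vv, g, h) Uo vvS gS hS) FS) => c y i UDy cy ip.
  have [Uy yD] := UDy; rewrite psi_coefE// (tb c y UDy cy).1 /=.
  have [ip1|ip1] := boolP (1 <= i.+1 <= p.-1)%N.
    by rewrite {1}/vv ip1; have [_ ->] := v0P _ ip1 => //; rewrite subrK.
  by rewrite /vv (negPf ip1) (_ : i.+1 = p) ?subnn ?mulr1 ?add0r//; lia.
apply: (@sec_eq (Kpow S (n - p%:Z)) _ _ _ (@psi_snd_sec n U (vv, g, h) Uo gS hS) bS) => c y UDy cy.
exact: (tb c y UDy cy).2.
Qed.

Lemma eq_dense (U : set S) c j (f g : S -> C) : open U ->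
  (forall x, U x -> dom c x -> lb_dom j x -> hol f x) ->
  (forall x, U x -> dom c x -> lb_dom j x -> hol g x) ->
  (forall x, U x -> ~ D x -> dom c x -> lb_dom j x -> f x = g x) ->
  forall x, U x -> dom c x -> lb_dom j x -> f x = g x.
Proof.
move=> Uo fh gh E x Ux cx jx'.
apply: (scts_eq_limit (hol_scts (fh x Ux cx jx')) (hol_scts (gh x Ux cx jx'))).
apply: filterS3 (nbhs_open Uo Ux) (filterI (nbhs_open (dom_open c) cx) (nbhs_open (N_open NB j) jx')) (D_isolated x).
by move=> y Uy [cy jy] yD yx; exact: E (yD yx) cy jy.
Qed.

Lemma psi_in n U v : open U -> V_secs n U v -> secs (spectral_V p a D e) n U (psi v).
Proof.
move=> Uo [v1 v2 v3]; split; [|exact: psi_snd_sec Uo v2 v3|].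
  apply: (@phi_in _ _ p a p0 aS (p%:Z - 2 + n) _ (psi_coef v) (open_minusD Uo)).
  rewrite (_ : p%:Z - 2 + n + 2 = p%:Z + n); last by ring.
  exact: psi_coef_sec Uo v1 v2 v3.
by move=> x Ux xD; exact: psi_residue Uo v1 v2 v3 x Ux xD.
Qed.

Lemma psi_gh_inv n U v c j x : V_secs n U v -> U x -> ~ D x -> dom c x -> lb_dom j x ->
  v.1.2 (c, j) x = sp j x * (psi_top v c x - psi_snd v c x) /\
  v.2 (c, j) x = - (sm (c, j) x * (psi_top v c x + psi_snd v c x)).
Proof.
move=> [v1 v2 v3] Ux xD cx jx'; have C2 : (2 : C) != 0 by rewrite pnatr_eq0.
have s1 : sp j x != 0 by apply: sp_neq0 => // /Dp_D.
have s2 : sm (c, j) x != 0 by apply: sm_neq0 => // /Dm_D.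
rewrite (psi_topE v2 v3 Ux xD cx jx') (psi_sndE v2 v3 Ux xD cx jx').
by split; field; rewrite s1 s2.
Qed.

Lemma V_hol n U v c j x : V_secs n U v -> U x -> dom c x -> lb_dom j x ->
  [/\ forall k, hol (v.1.1 k c) x, hol (v.1.2 (c, j)) x & hol (v.2 (c, j)) x].
Proof.
move=> [v1 v2 v3] Ux cx jx'; split; [|exact: g_hol v2 _ _ _ Ux cx jx'|exact: h_hol v3 _ _ _ Ux cx jx'].
by move=> k; exact: v_hol v1 _ _ _ Ux cx.
Qed.

Lemma V_eq n U v v' : V_secs n U v -> V_secs n U v' ->
  (forall c j x, U x -> dom c x -> lb_dom j x ->
    [/\ forall k, v.1.1 k c x = v'.1.1 k c x, v.1.2 (c, j) x = v'.1.2 (c, j) x &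
        v.2 (c, j) x = v'.2 (c, j) x]) -> v = v'.
Proof.
case: v v' => [[v1 g] h] [[v1' g'] h'] [v1S gS hS] [v1S' gS' hS'] E /=.
congr (_, _, _).
- apply/funext => k; have [kp|kp] := boolP (1 <= k <= p.-1)%N; last first.
    by have E1 := v1S.2 k kp; have E2 := v1S'.2 k kp; rewrite /= in E1 E2; rewrite E1 E2.
  apply: (sec_eq (v1S.1 k kp) (v1S'.1 k kp)) => c x Ux cx.
  by have [j jx'] := N_cover NB x; have [] := E c j x Ux cx jx'.
- by apply: (sec_eq gS gS') => -[c j] x Ux [cx jx']; have [] := E c j x Ux cx jx'.
by apply: (sec_eq hS hS') => -[c j] x Ux [cx jx']; have [] := E c j x Ux cx jx'.
Qed.

Lemma psi_coef_inv n U v k c x : V_secs n U v -> ~ D x -> (1 <= k <= p)%N ->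
  v.1.1 k c x = psi_coef v k c x - psi_top v c x * acoef a (p - k) c x.
Proof. by move=> vS xD kp; rewrite psi_coefE// addrK. Qed.

Lemma psi_inj n U v v' : open U -> V_secs n U v -> V_secs n U v' -> psi v = psi v' -> v = v'.
Proof.
move=> Uo vS vS' [E1 E2]; have [v1 v2 v3] := vS; have [v1' v2' v3'] := vS'.
have FE : psi_coef v = psi_coef v' := phi_inj p0 aS areg (open_minusD Uo) (psi_coef_sec Uo v1 v2 v3) (psi_coef_sec Uo v1' v2' v3') E1.
have tE c x : psi_top v c x = psi_top v' c x by rewrite -(psi_coef_p v1) -(psi_coef_p v1') FE.
apply: (V_eq vS vS') => c j x Ux cx jx'; split.
- move=> k; have [kp|kp] := boolP (1 <= k <= p)%N; last by rewrite v1.2 ?v1'.2//; lia.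
  apply: (@eq_dense U c j (v.1.1 k c) (v'.1.1 k c) Uo) x Ux cx jx'.
  + move=> {}x Ux cx jx'; have [h1 h2 h3] := V_hol vS Ux cx jx'; exact: (h1 k).
  + move=> {}x Ux cx jx'; have [h1 h2 h3] := V_hol vS' Ux cx jx'; exact: (h1 k).
  by move=> {}x Ux xD cx jx'; rewrite (psi_coef_inv _ vS)// (psi_coef_inv _ vS')// FE tE.
- apply: (@eq_dense U c j (v.1.2 (c, j)) (v'.1.2 (c, j)) Uo) x Ux cx jx'.
  + move=> {}x Ux cx jx'; have [h1 h2 h3] := V_hol vS Ux cx jx'; exact: h2.
  + move=> {}x Ux cx jx'; have [h1 h2 h3] := V_hol vS' Ux cx jx'; exact: h2.
  move=> {}x Ux xD cx jx'; have [-> _] := psi_gh_inv vS Ux xD cx jx'; have [-> _] := psi_gh_inv vS' Ux xD cx jx'.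
  by rewrite tE E2.
apply: (@eq_dense U c j (v.2 (c, j)) (v'.2 (c, j)) Uo) x Ux cx jx'.
+ move=> {}x Ux cx jx'; have [h1 h2 h3] := V_hol vS Ux cx jx'; exact: h3.
+ move=> {}x Ux cx jx'; have [h1 h2 h3] := V_hol vS' Ux cx jx'; exact: h3.
move=> {}x Ux xD cx jx'; have [_ ->] := psi_gh_inv vS Ux xD cx jx'; have [_ ->] := psi_gh_inv vS' Ux xD cx jx'.
by rewrite tE E2.
Qed.

Lemma psiD v v' : psi (v + v') = psi v + psi v'.
Proof.
have tD c x : psi_top (v + v') c x = psi_top v c x + psi_top v' c x.
  rewrite /psi_top; case: asboolP => _; first by rewrite addr0.
  by rewrite /= !fctE !mulrDl; ring.
have bD c x : psi_snd (v + v') c x = psi_snd v c x + psi_snd v' c x.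
  rewrite /psi_snd; case: asboolP => _; first by rewrite addr0.
  by rewrite /= !fctE !mulrDl; ring.
rewrite /psi; congr pair; last by apply/funext => c; apply/funext => x; exact: bD.
rewrite -phiD; congr phi; apply/funext => k; apply/funext => c; apply/funext => x.
have -> : (psi_coef v + psi_coef v') k c x = psi_coef v k c x + psi_coef v' k c x by [].
rewrite /psi_coef tD; case: asboolP => _; first by rewrite addr0.
by rewrite /= !fctE mulrDl addrACA.
Qed.

Lemma psi_rest (U : set S) v :
  psi (fun i : nat => cut U (v.1.1 i), cut U v.1.2, cut U v.2) = (cut U (phi p a (psi_coef v)), cut U (psi_snd v)).
Proof.
set v' := (_, _, _).
have cE (I : Type) (s : I -> S -> C) (i : I) x : cut U s i x = if x \in U then s i x else 0 by [].
have tE c x : psi_top v' c x = if x \in U then psi_top v c x else 0.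
  rewrite /psi_top /= !cE; case: (x \in U) => //; case: asboolP => // _.
  by rewrite !mul0r subr0.
rewrite /psi; congr pair; last first.
  apply/funext => c; apply/funext => x; rewrite cE /psi_snd /= !cE; case: (x \in U) => //; case: asboolP => // _.
  by rewrite !mul0r addr0 oppr0.
rewrite -phi_cut; congr phi; apply/funext => k; apply/funext => c; apply/funext => x.
rewrite cE /psi_coef tE /= cE; case: (x \in U) => //; case: asboolP => // _.
by rewrite mul0r addr0.
Qed.

Lemma psi_act (k : K_family S) v :
  psi (fun (i : nat) c x => k c x * v.1.1 i c x, fun ij x => k ij.1 x * v.1.2 ij x,
       fun ij x => k ij.1 x * v.2 ij x) =
  (mul_curve k (phi p a (psi_coef v)), fun c x => k c x * psi_snd v c x).
Proof.
set v' := (_, _, _).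
have tE c x : psi_top v' c x = k c x * psi_top v c x.
  by rewrite /psi_top /=; case: asboolP => _; [rewrite mulr0|ring].
rewrite /psi; congr pair; last first.
  by apply/funext => c; apply/funext => x; rewrite /psi_snd /=; case: asboolP => _; [rewrite mulr0|ring].
rewrite -phi_act; congr phi; apply/funext => i; apply/funext => c; apply/funext => x.
by rewrite /psi_coef tE /=; case: asboolP => _; [rewrite mulr0|ring].
Qed.

Definition QV_explicit v v' c j x : C := hankel p a p.-1 p v.1.1 v'.1.1 c x
  + (v.1.2 (c, j) x * v'.2 (c, j) x + v.2 (c, j) x * v'.1.2 (c, j) x).

Lemma QV_explicit_hol n n' U v v' c j x : open U -> V_secs n U v -> V_secs n' U v' -> U x -> dom c x ->
  lb_dom j x -> hol (QV_explicit v v' c j) x.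
Proof.
move=> Uo vS vS' Ux cx jx'; have [v1 v2 v3] := V_hol vS Ux cx jx'.
have [w1 w2 w3] := V_hol vS' Ux cx jx'.
have me : (p + 1 = p.+1)%N by rewrite addn1.
have hh : hol (fun y => hankel p a p.-1 p v.1.1 v'.1.1 c y) x.
  rewrite (_ : (fun y => _) = fun y => resid (spoly p a c y) ('X^1 * wpoly p.-1 v.1.1 c y * wpoly p.-1 v'.1.1 c y)).
    by apply: (@resid_wpoly_hol _ _ p a p0 aS p.-1 1%N v.1.1 v'.1.1 c x cx) => k _; [exact: v1|exact: w1].
  by apply/funext => y; rewrite (hankelE a p0 p.-1 _ _ _ _ me).
exact: (holD hh (holD (holM v2 w3) (holM v3 w2))).
Qed.

(** The dual pairing g h' + h g' equals a_p (b b' - t t'), and by [resid_cyclic] the term - a_p t t'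
    belongs to the residue. *)
Lemma QV_explicitE n n' U v v' c j x : V_secs n U v -> V_secs n' U v' -> U x -> ~ D x -> dom c x ->
  lb_dom j x -> QV_explicit v v' c j x =
  resid (spoly p a c x) ('X^1 * wpoly p (psi_coef v) c x * wpoly p (psi_coef v') c x)
  + acoef a p c x * psi_snd v c x * psi_snd v' c x.
Proof.
move=> vS vS' Ux xD cx jx'.
have vp : v.1.1 p c x = 0 by case: vS => v1 _ _; rewrite (v_p v1).
have vp' : v'.1.1 p c x = 0 by case: vS' => v1 _ _; rewrite (v_p v1).
have FE u (k : nat) : (k < p)%N -> psi_coef u k.+1 c x = u.1.1 k.+1 c x + psi_top u c x * acoef a (p - k.+1) c x.
  by move=> kp; rewrite psi_coefE.
rewrite (@resid_cyclic _ _ p a p0 _ _ _ _ _ _ c x vp vp' (FE v) (FE v')) /QV_explicit.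
have [-> ->] := psi_gh_inv vS Ux xD cx jx'; have [-> ->] := psi_gh_inv vS' Ux xD cx jx'.
by rewrite (acoefpE cx jx'); ring.
Qed.

Lemma QV_iso U v v' q : open U -> V_secs 0 U v -> V_secs 0 U v' ->
  (forall c j x, U x -> dom c x -> lb_dom j x -> q x = QV_explicit v v' c j x) <->
  (holomorphic_on U q /\
   exists2 q1, curve_form p a (U `\` D) (beta_F (psi v).1) (psi v').1 q1 &
     forall c x, (U `\` D) x -> dom c x ->
       q x = q1 x + acoef a p c x * (psi v).2 c x * (psi v').2 c x).
Proof.
move=> Uo vS vS'; have UDo := open_minusD Uo.
have cfP q1 : curve_form p a (U `\` D) (beta_F (psi v).1) (psi v').1 q1 <->
    forall c x, (U `\` D) x -> dom c x ->
      q1 x = resid (spoly p a c x) ('X^1 * wpoly p (psi_coef v) c x * wpoly p (psi_coef v') c x).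
  apply: (@curve_formP _ _ p a p0 aS areg _ _ _
    (fun c x => 'X^1 * wpoly p (psi_coef v) c x * wpoly p (psi_coef v') c x) q1 UDo).
    by move=> c x t UDx cx tr; rewrite /beta_F /psi /= !phi_wpoly// !hornerM expr1 hornerX.
  case: vS => v1 v2 v3; case: vS' => w1 w2 w3.
  have FS := psi_coef_sec Uo v1 v2 v3; have FS' := psi_coef_sec Uo w1 w2 w3.
  move=> c x UDx cx; apply: (@resid_wpoly_hol _ _ p a p0 aS p 1%N (psi_coef v) (psi_coef v') c x cx) => k kp.
    exact: (Kpow_hol (FS.1 k.+1 kp) UDx cx).
  exact: (Kpow_hol (FS'.1 k.+1 kp) UDx cx).
split=> [H|[qh [q1 /cfP q1E qE]]].
  split.
    apply/holomorphic_onP => x Ux; have [c cx] := dom_cover x; have [j jx'] := N_cover NB x.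
    apply: hol_near (QV_explicit_hol Uo vS vS' Ux cx jx').
    apply: filterS3 (nbhs_open Uo Ux) (nbhs_open (dom_open c) cx) (nbhs_open (N_open NB j) jx').
    by move=> y Uy cy jy; rewrite (H c j).
  (* [q1] has to be a function on the surface, so a chart is chosen at each point. The value does
     not depend on it: a_p has weight K^(2p), and b and b' have weight K^(-p). *)
  pose ch := projT1 (boolp.choice (@dom_cover R S)).
  have chP x : dom (ch x) x by exact: (projT2 (boolp.choice (@dom_cover R S))).
  pose B c x := acoef a p c x * psi_snd v c x * psi_snd v' c x.
  have BE c x : (U `\` D) x -> dom c x -> B (ch x) x = B c x.
    case: vS => v1 v2 v3; case: vS' => w1 w2 w3 UDx cx.
    have k0 : kap c (ch x) x != 0 by exact: (kap_neq0 cx (chP x)).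
    rewrite /B (acoef_tr aS (leqnn p) cx (chP x)) (Kpow_tr (psi_snd_sec Uo v2 v3) UDx cx (chP x)).
    rewrite (Kpow_tr (psi_snd_sec Uo w2 w3) UDx cx (chP x)).
    rewrite sub0r -exprnN mulnC exprM; have kp0 : kap c (ch x) x ^+ p != 0 by rewrite expf_neq0.
    by field; exact: kp0.
  exists (fun x => q x - B (ch x) x).
    apply/cfP => c x UDx cx; have [Ux xD] := UDx; have [j jx'] := N_cover NB x.
    by rewrite (BE c x UDx cx) (H c j x Ux cx jx') (QV_explicitE vS vS' Ux xD cx jx') addrK.
  by move=> c x UDx cx; rewrite (BE c x UDx cx) subrK.
move=> c j; apply: (@eq_dense U c j q (QV_explicit v v' c j) Uo).
- by move=> x Ux _ _; move/holomorphic_onP: qh; apply.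
- by move=> x Ux cx jx'; exact: (QV_explicit_hol Uo vS vS' Ux cx jx').
move=> x Ux xD cx jx'; have UDx : (U `\` D) x by [].
by rewrite (QV_explicitE vS vS' Ux xD cx jx') (qE c x UDx cx) (q1E c x UDx cx).
Qed.

Lemma Ksum_cut r (m : int) (A B : set S) w : open B -> B `<=` A ->
  K_sum_sections r m A w -> K_sum_sections r m B (fun k : nat => cut B (w k)).
Proof.
move=> Bo BA wS; split=> k kp; first exact: Kpow_cut Bo BA (wS.1 k kp).
by rewrite (wS.2 k kp); apply/funext => c; apply/funext => x; rewrite /cut /patch; case: ifP.
Qed.

Lemma cut_in (I : Type) (B : set S) (s : I -> S -> C) (q : I) x : B x -> cut B s q x = s q x.
Proof. by move=> Bx; rewrite /cut /patch mem_set. Qed.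

(** The image (w, 0) has b = 0 and t = w_p. Subtracting w_p E from w leaves the W_0 part, and g and
    h become s_+ w_p and - s_- w_p. *)
Lemma beta_iso U w v : open U -> K_sum_sections p (p%:Z + 1) U w -> V_secs 1 U v ->
  (forall c j x, U x -> dom c x -> lb_dom j x ->
     [/\ forall k : nat, (1 <= k < p)%N -> v.1.1 k c x = w k c x - w p c x * a (p - k)%N c x,
         v.1.2 (c, j) x = w p c x * sp j x & v.2 (c, j) x = - (w p c x * sm (c, j) x)]) <->
  psi v = (cut (U `\` D) (phi p a w), 0).
Proof.
move=> Uo wS vS; have [v1 v2 v3] := vS; have UDo := open_minusD Uo.
have sub : U `\` D `<=` U by move=> y [].
have FS := psi_coef_sec Uo v1 v2 v3; have cS := Ksum_cut UDo sub wS.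
have aE k : (1 <= k < p)%N -> a (p - k)%N = acoef a (p - k).
  by move=> kp; rewrite /acoef; case: eqP => //; lia.
have C2 : (2 : C) != 0 by rewrite pnatr_eq0.
have pp : (1 <= p <= p)%N by rewrite p0 leqnn.
have wh k c x : (1 <= k <= p)%N -> U x -> dom c x -> hol (w k c) x.
  by move=> kp Ux cx; exact: Kpow_hol (wS.1 k kp) Ux cx.
split=> [H|[E1 E2]].
  have tb c x : U x -> ~ D x -> dom c x -> psi_top v c x = w p c x /\ psi_snd v c x = 0.
    move=> Ux xD cx; have [j jx'] := N_cover NB x; have [_ h2 h3] := H c j x Ux cx jx'.
    have s1 : sp j x != 0 by apply: sp_neq0 => // /Dp_D.
    have s2 : sm (c, j) x != 0 by apply: sm_neq0 => // /Dm_D.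
    rewrite (psi_topE v2 v3 Ux xD cx jx') (psi_sndE v2 v3 Ux xD cx jx') h2 h3.
    by split; field; rewrite s1 s2.
  congr pair; last first.
    apply/funext => c; apply/funext => x.
    have [[[Ux xD] cx]|H1] := pselect ((U `\` D) x /\ dom c x); first exact: (tb c x Ux xD cx).2.
    exact: (Kpow_out (psi_snd_sec Uo v2 v3) H1).
  rewrite -phi_cut; congr phi; apply: (Ksum_ext FS cS) => c x k UDx cx kp; have [Ux xD] := UDx.
  rewrite (cut_in (w k.+1) c UDx) psi_coefE// (tb c x Ux xD cx).1.
  have [kp1|kp1] := ltnP k.+1 p.
    have [j jx'] := N_cover NB x; have [h1 _ _] := H c j x Ux cx jx'.
    have kk : (1 <= k.+1 < p)%N by rewrite kp1.
    by rewrite (h1 _ kk) (aE _ kk) subrK.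
  have -> : k.+1 = p by apply/eqP; rewrite eqn_leq kp kp1.
  by rewrite (v_p v1)// subnn mulr1 add0r.
have FE : psi_coef v = fun k : nat => cut (U `\` D) (w k).
  by apply: (phi_inj p0 aS areg UDo FS cS); rewrite E1 phi_cut.
have bE c x : psi_snd v c x = 0 by rewrite E2.
have tE c x : U x -> ~ D x -> psi_top v c x = w p c x.
  by move=> Ux xD; rewrite -(psi_coef_p v1) FE cut_in.
move=> c j x Ux cx jx'; split.
- move=> k kp; have kp' : (1 <= k <= p)%N by lia.
  have pk : (p - k <= p)%N by exact: leq_subr.
  rewrite (aE k kp); apply: (@eq_dense U c j (v.1.1 k c) (fun y => w k c y - w p c y * acoef a (p - k) c y) Uo) x Ux cx jx'.
  + by move=> {}x Ux cx jx'; have [h1 _ _] := V_hol vS Ux cx jx'; exact: h1.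
  + move=> {}x Ux cx jx'; exact: (holD (wh k c x kp' Ux cx) (holN (holM (wh p c x pp Ux cx) (acoef_hol aS pk cx)))).
  by move=> {}x Ux xD cx jx'; rewrite (psi_coef_inv c vS xD kp') tE// FE cut_in.
- apply: (@eq_dense U c j (v.1.2 (c, j)) (fun y => w p c y * sp j y) Uo) x Ux cx jx'.
  + by move=> {}x Ux cx jx'; have [_ h1 _] := V_hol vS Ux cx jx'; exact: h1.
  + move=> {}x Ux cx jx'; exact: (holM (wh p c x pp Ux cx) (sp_hol jx')).
  by move=> {}x Ux xD cx jx'; have [-> _] := psi_gh_inv vS Ux xD cx jx'; rewrite tE// bE subr0 mulrC.
apply: (@eq_dense U c j (v.2 (c, j)) (fun y => - (w p c y * sm (c, j) y)) Uo) x Ux cx jx'.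
+ by move=> {}x Ux cx jx'; have [_ _ h1] := V_hol vS Ux cx jx'; exact: h1.
+ move=> {}x Ux cx jx'; exact: (holN (holM (wh p c x pp Ux cx) (sm_hol cx jx'))).
by move=> {}x Ux xD cx jx'; have [_ ->] := psi_gh_inv vS Ux xD cx jx'; rewrite tE// bE addr0 mulrC.
Qed.

(** Multiplication by xi shifts v by one slot and sends t E to - a_p t in the first slot, which is
    s_+ h - s_- g. *)
Lemma gamma_iso U v w : open U -> V_secs 0 U v -> K_sum_sections p (p%:Z + 2) U w ->
  (forall c j x, U x -> dom c x -> lb_dom j x ->
     w 1%N c x = sp j x * v.2 (c, j) x - sm (c, j) x * v.1.2 (c, j) x /\
     forall k : nat, (1 <= k < p)%N -> w k.+1 c x = v.1.1 k c x) <->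
  cut (U `\` D) (phi p a w) = cut (U `\` D) (beta_F (psi v).1).
Proof.
move=> Uo vS wS; have [v1 v2 v3] := vS; have UDo := open_minusD Uo.
have sub : U `\` D `<=` U by move=> y [].
have FS := psi_coef_sec Uo v1 v2 v3; have cS := Ksum_cut UDo sub wS.
have gS := mul_xi_sec p0 aS FS.
have p11 : (1 <= 1 <= p)%N by rewrite p0.
have g1 c j x : U x -> ~ D x -> dom c x -> lb_dom j x ->
    mul_xi p a (psi_coef v) 1 c x = sp j x * v.2 (c, j) x - sm (c, j) x * v.1.2 (c, j) x.
  move=> Ux xD cx jx'; have [-> ->] := psi_gh_inv vS Ux xD cx jx'.
  rewrite /mul_xi p11 /= subn1 prednK// (psi_coef_p v1) (acoefpE cx jx'); ring.
have gk k c x : (1 <= k < p)%N -> ~ D x -> mul_xi p a (psi_coef v) k.+1 c x = v.1.1 k c x.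
  move=> kp xD; have kp1 : (1 <= k.+1 <= p)%N by lia.
  have kp2 : (1 <= k <= p)%N by lia.
  rewrite /mul_xi kp1 eqSS (_ : (k == 0)%N = false); last by lia.
  rewrite (psi_coef_p v1) (psi_coef_inv c vS xD kp2) (_ : (p - k.+1).+1 = (p - k)%N)//; lia.
rewrite -(phi_mul_xi a p0 (psi_coef v)) -!phi_cut; split=> [H|E].
  congr phi; apply: (Ksum_ext cS (Ksum_cut UDo (fun y h => h) gS)) => c x k UDx cx kp.
  have [Ux xD] := UDx; rewrite !(cut_in _ c UDx).
  have [j jx'] := N_cover NB x; have [h1 h2] := H c j x Ux cx jx'.
  case: k kp => [|k] kp; first by rewrite h1 (g1 c j x).
  by rewrite gk// h2.
have {E}wE k c x : (k < p)%N -> U x -> ~ D x -> w k.+1 c x = mul_xi p a (psi_coef v) k.+1 c x.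
  move=> kp Ux xD; have gS' : K_sum_sections p (p%:Z + 2) (U `\` D) (mul_xi p a (psi_coef v)).
    by move: gS; rewrite addr0.
  have E' := phi_inj p0 aS areg UDo cS (Ksum_cut UDo (fun y h => h) gS') E.
  by have := congr1 (fun u => u k.+1 c x) E'; rewrite !cut_in.
move=> c j x Ux cx jx'; split.
  apply: (@eq_dense U c j (w 1%N c) (fun y => sp j y * v.2 (c, j) y - sm (c, j) y * v.1.2 (c, j) y) Uo) x Ux cx jx'.
  - by move=> {}x Ux cx _; exact: Kpow_hol (wS.1 1%N p11) Ux cx.
  - move=> {}x Ux cx jx'; have [_ h2 h3] := V_hol vS Ux cx jx'.
    exact: (holD (holM (sp_hol jx') h3) (holN (holM (sm_hol cx jx') h2))).
  by move=> {}x Ux xD cx jx'; rewrite wE// (g1 c j x).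
move=> k kp; have kp1 : (1 <= k.+1 <= p)%N by lia.
apply: (@eq_dense U c j (w k.+1 c) (v.1.1 k c) Uo) x Ux cx jx'.
- by move=> {}x Ux cx _; exact: Kpow_hol (wS.1 k.+1 kp1) Ux cx.
- by move=> {}x Ux cx jx'; have [h1 _ _] := V_hol vS Ux cx jx'; exact: h1.
by move=> {}x Ux xD cx jx'; rewrite wE ?gk//; lia.
Qed.

End Psi.

(** * Assembly of the isomorphism of Higgs bundles *)

Lemma phi_bundle_iso (R : realType) (S : riemann_surface R) (p : nat) (a : nat -> K_family S) :
  (0 < p)%N -> (forall k, (1 <= k <= p)%N -> sections (Kpow S (2 * k)%:Z) setT (a k)) ->
  regular p a ->
  @bundle_iso R S (explicit_W S p) (spectral_W p a) (fun _ _ => phi p a).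
Proof.
move=> p0 aS areg.
have nE (n : int) : p%:Z - 1 + n + 2 = p%:Z + 1 + n by ring.
split.
- move=> n U Uo; split.
  + move=> w wS; apply: (@phi_in _ _ p a p0 aS (p%:Z - 1 + n) U w Uo); rewrite nE; exact: wS.
  + move=> w w' /set_mem wS /set_mem wS' E; exact: (phi_inj p0 aS areg Uo wS wS' E).
  + move=> f fS; have [w wS wE] := phi_surj p0 aS areg Uo fS.
    by exists w => //; move: wS; rewrite nE.
- by move=> n U s t _ _ _; exact: phiD.
- by move=> n U U' s _ _ _ _; exact: phi_cut.
- by move=> m n U k s _ _ _; exact: phi_act.
Qed.

Theorem theorem6 (R : realType) (S : riemann_surface R) (g p : nat)
    (a : nat -> K_family S) (D Dp Dm : set S) (e : S -> Cx R)
    (N : line_bundle S) (sp : lb_family N)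
    (sm : lb_family (lb_tensor (Kpow S (2 * p)%:Z) (lb_pow N (-1)))) :
  compact [set: S] ->
  has_genus S g -> (2 <= g)%N ->
  (1 <= p)%N ->
  (forall k, (1 <= k <= p)%N -> sections (Kpow S (2 * k)%:Z) setT (a k)) ->
  regular p a ->
  D = zero_locus (N := Kpow S (2 * p)%:Z) (a p) ->
  Dp `|` Dm = D -> Dp `&` Dm = set0 ->
  (forall x, Dp x -> e x = 1) -> (forall x, Dm x -> e x = -1) ->
  is_line_bundle N ->
  section_with_divisor sp Dp ->
  section_with_divisor sm Dm ->
  (forall c j x, dom c x -> lb_dom j x -> sp j x * sm (c, j) x = a p c x / 2) ->
  higgs_iso (explicit_higgs a sp sm) (spectral_higgs p a D e).
Proof.
move=> _ _ _ p0 aS areg _ DU DI ep em NB spD smD spm.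
exists (fun _ _ => phi p a), (fun _ _ => psi a D sp sm NB); split; [|split].
- exact: phi_bundle_iso.
- split.
  + move=> n U Uo; split.
    * move=> v vS; exact: (psi_in p0 aS DU DI ep em NB spD smD spm Uo vS).
    * move=> v v' /set_mem vS /set_mem vS' E.
      exact: (psi_inj p0 aS areg DU spD smD Uo vS vS' E).
    * move=> [f b] [fS bS res].
      by have [v vS vE] := psi_surj p0 aS areg DU ep em NB spD smD spm Uo fS bS res; exists v.
  + by move=> n U s t _ _ _; exact: psiD.
  + by move=> n U U' s _ _ _ _; exact: psi_rest.
  + by move=> m n U k s _ _ _; exact: psi_act.
move=> U Uo; split.
- move=> w w' q wS wS'; exact: (QW_iso p0 aS areg q Uo wS wS').
- move=> v v' q vS vS'; exact: (QV_iso p0 aS areg DU NB spD smD spm q Uo vS vS').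
- move=> w v wS vS; apply: (beta_iso p0 aS areg DU NB spD smD Uo _ vS).
  by move: wS; rewrite /= addr0.
move=> v w vS wS; apply: (gamma_iso p0 aS areg DU NB spD smD spm Uo vS).
by move: wS; rewrite /= -addrA.
Qed.
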